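(* Let $\mathbf{C}^-:=\inf_{F\in\mathcal{H}_{\pi\Delta},F\ne0}\|F\|_{L^2(\mathbb{R},W)}/\|F\|_{L^2(\mathbb{R})}$ and $\mathbf{C}^+:=\sup_{F\in\mathcal{H}_{\pi\Delta},F\ne0}\|F\|_{L^2(\mathbb{R},W)}/\|F\|_{L^2(\mathbb{R})}$, where $W(x)=1-\frac{\sin 2\pi x}{2\pi x}+\boldsymbol{\delta}_0(x)$. (i) For $0<\Delta\le1$: $\mathbf{C}^-=1$ and $\mathbf{C}^+=\sqrt{1+\frac{\Delta}{2}}$. (ii) For $1<\Delta\le2$, let $\eta^+$ and $\eta^-$ be the largest and the smallest real solutions $\eta$ of \[ \left(\tfrac{3}{2}-\tfrac{2-\Delta}{4\eta}\right)\cos\left(\tfrac{\Delta-1}{2\eta}\right)-\sin\left(\tfrac{\Delta-1}{2\eta}\right) = 1. \] Then $\mathbf{C}^-=\sqrt{1+\eta^-}$ and $\mathbf{C}^+=\sqrt{1+\eta^+}$.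
   Context: $\mathcal{H}_{\pi\Delta}$ is the space of entire functions of exponential type at most $\pi\Delta$ that are square-integrable on $\mathbb{R}$. $\boldsymbol{\delta}_0$ is the Dirac delta at $0$, so $\|F\|^2_{L^2(\mathbb{R},W)}=\int_{\mathbb{R}}|F(x)|^2\big(1-\frac{\sin 2\pi x}{2\pi x}\big)dx+|F(0)|^2$. *)

(* Defs.v *)
From Stdlib Require Import Reals Lra.
From Coquelicot Require Import Coquelicot.
Open Scope R_scope.

Definition entire (F : C -> C) : Prop :=
  forall z : C, @ex_derive C_AbsRing C_NormedModule F z.

Definition exp_type_le (F : C -> C) (tau : R) : Prop :=
  forall eps : R, 0 < eps ->
    exists A : R, forall z : C, Cmod (F z) <= A * exp ((tau + eps) * Cmod z).

Definition absF2 (F : C -> C) (x : R) : R := (Cmod (F (RtoC x))) ^ 2.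

(* F is square-integrable on R (improper integral of the nonnegative continuous |F|^2 converges) *)
Definition sq_integrable_R (F : C -> C) : Prop :=
  ex_RInt_gen (absF2 F) (Rbar_locally m_infty) (Rbar_locally p_infty).

Definition PW (Delta : R) (F : C -> C) : Prop :=
  entire F /\ exp_type_le F (PI * Delta) /\ sq_integrable_R F.

Definition wcont (x : R) : R :=
  if Req_EM_T x 0 then 0 else 1 - sin (2 * PI * x) / (2 * PI * x).

Definition L2sq (F : C -> C) : R :=
  RInt_gen (absF2 F) (Rbar_locally m_infty) (Rbar_locally p_infty).

(* ||F||_{L^2(R,W)}^2 with W = wcont + delta_0 *)
Definition WL2sq (F : C -> C) : R :=
  RInt_gen (fun x => absF2 F x * wcont x) (Rbar_locally m_infty) (Rbar_locally p_infty)
  + (Cmod (F (RtoC 0))) ^ 2.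

Definition ratio (F : C -> C) : R := sqrt (WL2sq F) / sqrt (L2sq F).

Definition ratios (Delta : R) (r : R) : Prop :=
  exists F : C -> C, PW Delta F /\ (exists z : C, F z <> 0) /\ r = ratio F.

Definition eta_eq (Delta eta : R) : Prop :=
  eta <> 0 /\
  (3/2 - (2 - Delta) / (4 * eta)) * cos ((Delta - 1) / (2 * eta))
    - sin ((Delta - 1) / (2 * eta)) = 1.

(* Main.v *)
Require Import Defs.
From Stdlib Require Import Reals Lra Lia Psatz Classical ClassicalEpsilon.
From Coquelicot Require Import Coquelicot.
Open Scope R_scope.

(** On the Fourier side, [WL2sq F = ||f||^2 + Q(f)], where [F] is the transform of [f] supported in
    [[-a, a]], [a = Delta/2], and [Q] is the form with kernel [1 - 1_{|s-t|<1}/2].  For [a <= 1/2] it is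
    [(int f)^2 / 2].  For [1/2 < a <= 1], splitting [f] into even and odd parts, folding around [1/2] and
    splitting once more turns [eta ||f||^2 - Q(f)] into one-dimensional expressions
    [4 eta int (p^2 + q^2) +- 4 int q P], [P' = p], [P(0) = 0]; completing a square in [q] and
    the Wirtinger-type identity [(p - k cot(k x) P)^2 >= 0] leave a quadratic form in two numbers whose
    degeneracy is the equation for [eta].  Equality holds for explicit trigonometric [f].

    The passage from [F] to [f] needs only Goursat's theorem: after averaging over a short interval,
    dilating and multiplying by a squared sinc, [F] becomes a [C^1] function [K] of size [O(1/x^2)] on
    the line.  Its Fourier integral at a frequency beyond the type is rotated from the two half lines to rays close
    to the imaginary axis, under the protection of a Gaussian [exp (- d e^(-i b) z^2)] decaying in the whole sector,
    and therefore vanishes.  Inversion and Parseval follow from the bounds on the sine integral.  All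
    transforms are written in the real form [cas = cos + sin].

    Finally [||F|| <> 0] for [F <> 0] needs that [F] cannot vanish on the line, which follows from the maximum
    principle applied to [F(z) exp (N (i z - z^2))] on a rectangle based on the line. *)

(** Every integral here is a Riemann integral of a continuous function, and this shapes the proof.
    The transform of a general [F] is only square-integrable, so the form is evaluated at [K], whose
    transform is a uniform limit of continuous functions. The return to [F] takes place on a fixed
    interval [[-X, X]], the tails of [K] being dominated by those of [F] uniformly in the length of
    the averaging interval. Conversely the extremal [f] are only piecewise smooth, and their
    Parseval identity comes from integration by parts against the Dirichlet kernel.

    Goursat's theorem gives primitives, but not that derivatives are again entire. Where that is
    wanted, a difference [G (z + b) - G z] of a primitive [G] of [F] is used: its derivative is a
    difference of values of [F].

    For [Delta <= 2] a shift by 1 links only the two arms [[1 - a, a]] and [[-a, -(1 - a)]]. With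
    [theta = (Delta - 1) / (4 eta)] the equation for [eta] factors: [cos theta + sin theta] belongs
    to odd [f] and gives the smallest root [- (Delta - 1) / PI], the other factor belongs to even
    [f] and gives the largest root. *)

Definition cont (f : R -> R) : Prop := forall x, continuous f x.
Definition cont2 (f : R -> R -> R) : Prop := forall x y, continuity_2d_pt f x y.

Lemma cont_pt (f : R -> R) : cont f -> forall x, continuity_pt f x.
Proof. intros H x; apply continuity_pt_filterlim, H. Qed.

Lemma cont_of_pt (f : R -> R) : (forall x, continuity_pt f x) -> cont f.
Proof. intros H x; apply continuity_pt_filterlim, H. Qed.

Lemma cont_ext f g : (forall x, f x = g x) -> cont f -> cont g.
Proof. intros E H x; apply continuous_ext with f; auto. Qed.

Lemma cont_const c : cont (fun _ => c).
Proof. intros x; apply continuous_const. Qed.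

Lemma cont_id : cont (fun x => x).
Proof. intros x; apply continuous_id. Qed.

Lemma cont_plus f g : cont f -> cont g -> cont (fun x => f x + g x).
Proof. intros Hf Hg x; apply (continuous_plus f g); auto. Qed.

Lemma cont_opp f : cont f -> cont (fun x => - f x).
Proof. intros Hf x; apply (continuous_opp f); auto. Qed.

Lemma cont_minus f g : cont f -> cont g -> cont (fun x => f x - g x).
Proof. intros Hf Hg x; apply (continuous_minus f g); auto. Qed.

Lemma cont_mult f g : cont f -> cont g -> cont (fun x => f x * g x).
Proof. intros Hf Hg x; apply (continuous_mult f g); auto. Qed.

Lemma cont_comp g f : cont g -> cont f -> cont (fun x => g (f x)).
Proof. intros Hg Hf x; apply (continuous_comp f g); auto. Qed.

Lemma cont_derive f df : (forall x, is_derive f x (df x)) -> cont f.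
Proof. intros H x; apply (ex_derive_continuous f); exists (df x); auto. Qed.

Lemma cont_sin f : cont f -> cont (fun x => sin (f x)).
Proof. apply cont_comp; intros x; apply continuous_sin. Qed.

Lemma cont_cos f : cont f -> cont (fun x => cos (f x)).
Proof. apply cont_comp; intros x; apply continuous_cos. Qed.

Lemma cont_exp f : cont f -> cont (fun x => exp (f x)).
Proof. apply cont_comp; intros x; apply continuous_exp. Qed.

Lemma cont_abs f : cont f -> cont (fun x => Rabs (f x)).
Proof. apply cont_comp; intros x; apply continuous_Rabs. Qed.

Lemma cont_pow f n : cont f -> cont (fun x => f x ^ n).
Proof.
  intros Hf; induction n as [|n IH]; [exact (cont_const 1)|].
  exact (cont_mult _ _ Hf IH).
Qed.

Lemma cont_inv f : (forall x, f x <> 0) -> cont f -> cont (fun x => / f x).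
Proof.
  intros H0 Hf; apply cont_of_pt; intros x.
  apply (continuity_pt_inv f); [apply cont_pt|]; auto.
Qed.

Lemma cont_Rmax f g : cont f -> cont g -> cont (fun x => Rmax (f x) (g x)).
Proof.
  intros Hf Hg; apply cont_ext with (fun x => (f x + g x + Rabs (f x - g x)) * / 2).
  - intros x; unfold Rmax, Rabs; destruct Rle_dec, Rcase_abs; lra.
  - apply cont_mult; [|apply cont_const].
    apply cont_plus; [apply cont_plus; auto|apply cont_abs, cont_minus; auto].
Qed.

Lemma cont_Rmin f g : cont f -> cont g -> cont (fun x => Rmin (f x) (g x)).
Proof.
  intros Hf Hg; apply cont_ext with (fun x => (f x + g x - Rabs (f x - g x)) * / 2).
  - intros x; unfold Rmin, Rabs; destruct Rle_dec, Rcase_abs; lra.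
  - apply cont_mult; [|apply cont_const].
    apply cont_minus; [apply cont_plus; auto|apply cont_abs, cont_minus; auto].
Qed.

(** The cases [Rmult ?c], [sin] and the like catch goals whose function [fun x => c * x] or
    [fun x => sin x] appears eta-reduced. Constants are tried early, so that closed subterms are not
    taken apart. *)
Ltac cont_step :=
  match goal with
  | H : cont ?f |- cont ?f => exact H
  | |- cont (fun _ => ?c) => apply cont_const
  | |- cont (Rmult ?c) => apply (cont_mult (fun _ => c) (fun x => x))
  | |- cont (Rplus ?c) => apply (cont_plus (fun _ => c) (fun x => x))
  | |- cont (Rminus ?c) => apply (cont_minus (fun _ => c) (fun x => x))
  | |- cont Ropp => apply (cont_opp (fun x => x))
  | |- cont Rabs => apply (cont_abs (fun x => x))
  | |- cont sin => apply (cont_sin (fun x => x))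
  | |- cont cos => apply (cont_cos (fun x => x))
  | |- cont exp => apply (cont_exp (fun x => x))
  | |- cont (fun x => x) => apply cont_id
  | |- cont (fun x => _ + _) => apply cont_plus
  | |- cont (fun x => _ - _) => apply cont_minus
  | |- cont (fun x => _ * _) => apply cont_mult
  | |- cont (fun x => _ / ?c) => apply cont_mult; [|apply cont_const]
  | |- cont (fun x => - _) => apply cont_opp
  | |- cont (fun x => sin _) => apply cont_sin
  | |- cont (fun x => cos _) => apply cont_cos
  | |- cont (fun x => exp _) => apply cont_exp
  | |- cont (fun x => Rabs _) => apply cont_abs
  | |- cont (fun x => Rmax _ _) => apply cont_Rmax
  | |- cont (fun x => Rmin _ _) => apply cont_Rmin
  | |- cont (fun x => _ ^ _) => apply cont_pow
  | H : cont ?h |- cont (fun x => ?h (@?g x)) => apply (cont_comp h g H)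
  end.
Ltac cont := repeat cont_step.

Lemma cont2_1 f : cont f -> cont2 (fun x _ => f x).
Proof.
  intros H x y; apply (continuity_1d_2d_pt_comp f (fun x _ => x)).
  apply cont_pt, H. apply continuity_2d_pt_id1.
Qed.

Lemma cont2_2 f : cont f -> cont2 (fun _ y => f y).
Proof.
  intros H x y; apply (continuity_1d_2d_pt_comp f (fun _ y => y)).
  apply cont_pt, H. apply continuity_2d_pt_id2.
Qed.

Lemma cont2_comp g f : cont g -> cont2 f -> cont2 (fun x y => g (f x y)).
Proof.
  intros H1 H2 x y; apply (continuity_1d_2d_pt_comp g f); auto.
  apply cont_pt, H1.
Qed.

Lemma cont2_plus f g : cont2 f -> cont2 g -> cont2 (fun x y => f x y + g x y).
Proof. intros H1 H2 x y; apply continuity_2d_pt_plus; auto. Qed.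

Lemma cont2_minus f g : cont2 f -> cont2 g -> cont2 (fun x y => f x y - g x y).
Proof. intros H1 H2 x y; apply continuity_2d_pt_minus; auto. Qed.

Lemma cont2_mult f g : cont2 f -> cont2 g -> cont2 (fun x y => f x y * g x y).
Proof. intros H1 H2 x y; apply continuity_2d_pt_mult; auto. Qed.

Lemma cont2_opp f : cont2 f -> cont2 (fun x y => - f x y).
Proof. intros H1 x y; apply continuity_2d_pt_opp; auto. Qed.

Lemma cont2_const c : cont2 (fun x y => c).
Proof. intros x y; apply continuity_2d_pt_const; auto. Qed.

Lemma cont_sin0 : cont sin. Proof. intros x; apply continuous_sin. Qed.
Lemma cont_cos0 : cont cos. Proof. intros x; apply continuous_cos. Qed.
Lemma cont_exp0 : cont exp. Proof. intros x; apply continuous_exp. Qed.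

Ltac cont2_step :=
  match goal with
  | H : cont2 ?f |- cont2 ?f => exact H
  | |- cont2 (fun _ _ => ?c) => apply cont2_const
  | |- cont2 (fun x _ => x) => apply cont2_1
  | |- cont2 (fun _ y => y) => apply cont2_2
  | |- cont2 (fun x y => @?f x + @?g x) => apply cont2_1
  | |- cont2 (fun x y => _ + _) => apply cont2_plus
  | |- cont2 (fun x y => _ - _) => apply cont2_minus
  | |- cont2 (fun x y => _ * _) => apply cont2_mult
  | |- cont2 (fun x y => _ / ?c) => apply cont2_mult; [|apply cont2_const]
  | |- cont2 (fun x y => - _) => apply cont2_opp
  | |- cont2 (fun x y => sin _) => apply (cont2_comp sin); [exact cont_sin0|]
  | |- cont2 (fun x y => cos _) => apply (cont2_comp cos); [exact cont_cos0|]
  | |- cont2 (fun x y => exp _) => apply (cont2_comp exp); [exact cont_exp0|]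
  | H : cont ?h |- cont2 (fun x y => ?h (@?g x y)) => apply (cont2_comp h g H)
  end.
Ltac cont2 := repeat first [cont2_step | cont_step].

Lemma cont2_slice1 f y : cont2 f -> cont (fun x => f x y).
Proof.
  intros H; apply cont_of_pt; intros x eps Heps.
  destruct (H x y (mkposreal eps Heps)) as [d Hd].
  exists d; split; [apply cond_pos|]. intros z [_ Hz].
  apply (Hd z y). exact Hz. rewrite Rminus_diag, Rabs_R0; apply cond_pos.
Qed.

Lemma cont2_swap f : cont2 f -> cont2 (fun x y => f y x).
Proof.
  intros H x y eps. destruct (H y x eps) as [d Hd]. exists d; intros; apply Hd; auto.
Qed.

Lemma cont2_slice2 f x : cont2 f -> cont (fun y => f x y).
Proof. intros H; exact (cont2_slice1 _ x (cont2_swap _ H)). Qed.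

(** * Riemann integrals of continuous functions *)

(** Fixing real values lets the rules below be stated with the operations of [R] rather than those
    of a normed module, and so be used by [rewrite]. *)
Definition RI (f : R -> R) (a b : R) : R := RInt f a b.

Lemma cont_ex_RInt f a b : cont f -> ex_RInt f a b.
Proof. intros H; apply (ex_RInt_continuous f); auto. Qed.
#[export] Hint Resolve cont_ex_RInt : core.

Lemma RI_plus f g a b : cont f -> cont g ->
  RI (fun x => f x + g x) a b = RI f a b + RI g a b.
Proof. intros Hf Hg; apply (RInt_plus f g); auto. Qed.

Lemma RI_minus f g a b : cont f -> cont g ->
  RI (fun x => f x - g x) a b = RI f a b - RI g a b.
Proof. intros Hf Hg; apply (RInt_minus f g); auto. Qed.

Lemma RI_scal c f a b : cont f -> RI (fun x => c * f x) a b = c * RI f a b.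
Proof. intros Hf; apply (RInt_scal f a b c); auto. Qed.

Lemma RI_opp f a b : cont f -> RI (fun x => - f x) a b = - RI f a b.
Proof. intros Hf; apply (RInt_opp f a b); auto. Qed.

Lemma RI_ext (f g : R -> R) a b : (forall x, f x = g x) -> RI f a b = RI g a b.
Proof. intros H; apply RInt_ext; auto. Qed.

Lemma RI_ext_le (f g : R -> R) a b : a <= b -> (forall x, a < x < b -> f x = g x) ->
  RI f a b = RI g a b.
Proof. intros H E; apply RInt_ext; intros x; rewrite Rmin_left, Rmax_right; auto. Qed.

Lemma RI_Chasles f a b c : cont f -> RI f a b + RI f b c = RI f a c.
Proof. intros Hf; apply (RInt_Chasles f a b c); auto. Qed.

Lemma RI_swap f a b : cont f -> RI f a b = - RI f b a.
Proof. intros Hf; symmetry; apply (opp_RInt_swap f b a); auto. Qed.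

Lemma RI_point (f : R -> R) a : RI f a a = 0.
Proof. apply (RInt_point a f). Qed.

Lemma RI_const c a b : RI (fun _ => c) a b = (b - a) * c.
Proof. apply (RInt_const a b c). Qed.

Lemma RI_le f g a b : a <= b -> cont f -> cont g -> (forall x, a <= x <= b -> f x <= g x) ->
  RI f a b <= RI g a b.
Proof. intros ab Hf Hg H; apply RInt_le; auto. intros x Hx; apply H; lra. Qed.

Lemma RI_ge0 f a b : a <= b -> cont f -> (forall x, a <= x <= b -> 0 <= f x) -> 0 <= RI f a b.
Proof.
  intros ab Hf H. rewrite <- (Rmult_0_r (b - a)), <- (RI_const 0 a b).
  apply RI_le; auto. apply cont_const.
Qed.

Lemma RI_abs f g a b : a <= b -> cont f -> cont g -> (forall x, a <= x <= b -> Rabs (f x) <= g x) ->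
  Rabs (RI f a b) <= RI g a b.
Proof.
  intros ab Hf Hg H. eapply Rle_trans; [apply abs_RInt_le; auto|].
  apply RI_le; auto. cont.
Qed.

Lemma RI_abs_const f M a b : a <= b -> cont f -> (forall x, a <= x <= b -> Rabs (f x) <= M) ->
  Rabs (RI f a b) <= (b - a) * M.
Proof. intros; apply abs_RInt_le_const; auto. Qed.

Lemma is_derive_RI f a : cont f -> forall x, is_derive (fun x => RI f a x) x (f x).
Proof.
  intros Hf x; apply (is_derive_RInt f (fun x => RInt f a x) a); auto.
  exists (mkposreal 1 Rlt_0_1); intros y _; apply (RInt_correct f); auto.
Qed.

Lemma cont_RI f a : cont f -> cont (fun x => RI f a x).
Proof. intros Hf; apply cont_derive with f, is_derive_RI, Hf. Qed.

Lemma RI_FTC F f a b : (forall x, is_derive F x (f x)) -> cont f -> RI f a b = F b - F a.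
Proof.
  intros H Hf; apply is_RInt_unique, (is_RInt_derive F f); auto.
Qed.

Lemma RI_by_parts f g df dg a b :
  (forall x, is_derive f x (df x)) -> (forall x, is_derive g x (dg x)) -> cont df -> cont dg ->
  RI (fun x => f x * dg x) a b = f b * g b - f a * g a - RI (fun x => df x * g x) a b.
Proof.
  intros Hf Hg Cf Cg.
  assert (cf := cont_derive _ _ Hf). assert (cg := cont_derive _ _ Hg).
  rewrite <- (RI_FTC (fun x => f x * g x) (fun x => df x * g x + f x * dg x)).
  - rewrite RI_plus; [ring| |]; cont.
  - intros x; apply (is_derive_mult f g); auto. intros; apply Rmult_comm.
  - cont.
Qed.

Lemma RI_lin f c d a b : cont f -> RI (fun x => c * f (c * x + d)) a b = RI f (c * a + d) (c * b + d).
Proof.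
  intros Hf.
  rewrite (RI_FTC (fun x => RI f 0 (c * x + d)) (fun x => c * f (c * x + d))).
  - rewrite <- (RI_Chasles f 0 (c * a + d) (c * b + d)); auto; ring.
  - intros x. apply (is_derive_comp (fun y => RI f 0 y) (fun x => c * x + d)).
    + apply is_derive_RI; auto.
    + auto_derive; [exact I|ring].
  - cont.
Qed.

Lemma RI_shift f d a b : cont f -> RI (fun x => f (x + d)) a b = RI f (a + d) (b + d).
Proof.
  intros Hf. generalize (RI_lin f 1 d a b Hf). rewrite !Rmult_1_l; intros <-.
  apply RI_ext; intros; rewrite !Rmult_1_l; reflexivity.
Qed.

Lemma RI_neg f a b : cont f -> RI (fun x => f (- x)) a b = RI f (- b) (- a).
Proof.
  intros Hf. generalize (RI_lin f (-1) 0 a b Hf).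
  replace (-1 * a + 0) with (- a) by ring. replace (-1 * b + 0) with (- b) by ring.
  rewrite (RI_swap f (-a) (-b)) by auto; intros E.
  rewrite (RI_ext (fun x => -1 * f (-1 * x + 0)) (fun x => - f (- x))) in E.
  - rewrite RI_opp in E; [lra|cont].
  - intros x. replace (-1 * x + 0) with (- x) by ring; ring.
Qed.

Lemma RI_odd f M : cont f -> (forall x, f (- x) = - f x) -> RI f (- M) M = 0.
Proof.
  intros Hf Ho. generalize (RI_neg f (-M) M Hf); rewrite Ropp_involutive.
  rewrite (RI_ext _ (fun x => - f x)) by auto. rewrite RI_opp; auto. lra.
Qed.

Lemma cont_RI_param f a b : cont2 f -> cont (fun y => RI (fun x => f x y) a b).
Proof.
  intros Hf.
  assert (W : forall a b, a <= b -> cont (fun y => RI (fun x => f x y) a b)).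
  { clear a b; intros a b ab. apply cont_of_pt; intros y eps Heps.
    (* The [+ 1] keeps the quotient meaningful when [a = b]; the factor 2 makes the final estimate
       strict. *)
    assert (He : 0 < eps / (2 * (b - a + 1))).
    { apply Rdiv_lt_0_compat; lra. }
    destruct (uniform_continuity_2d_1d f a b y (fun x _ => Hf x y) (mkposreal _ He)) as [d Hd].
    exists d; split; [apply cond_pos|]. intros z [_ Hz].
    unfold dist in *; simpl in *; unfold R_dist in *.
    rewrite <- RI_minus by (apply cont2_slice1; auto).
    apply Rle_lt_trans with ((b - a) * (eps / (2 * (b - a + 1)))).
    - apply RI_abs_const; auto.
      + apply cont_minus; apply cont2_slice1; auto.
      + intros x Hx. apply Rlt_le, (Hd x y x z); auto.
        * generalize (cond_pos d); lra.
        * apply Rabs_lt_between' in Hz; lra.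
        * rewrite Rminus_diag, Rabs_R0; apply cond_pos.
    - replace ((b - a) * (eps / (2 * (b - a + 1)))) with (eps * ((b - a) / (2 * (b - a + 1)))) by (field; lra).
      rewrite <- (Rmult_1_r eps) at 2. apply Rmult_lt_compat_l; auto.
      apply Rlt_div_l; lra. }
  destruct (Rle_dec a b) as [ab|ab]; [auto|].
  apply cont_ext with (fun y => - RI (fun x => f x y) b a).
  - intros y; symmetry; apply (RI_swap (fun x => f x y)), cont2_slice1; auto.
  - apply cont_opp, W; lra.
Qed.

(** As functions of the upper limit [b], both sides vanish at [a] and have derivative
    [RI (fun y => f b y) c d], the right one by differentiation under the integral sign. *)
Lemma RI_Fubini f a b c d : cont2 f ->
  RI (fun x => RI (fun y => f x y) c d) a b = RI (fun y => RI (fun x => f x y) a b) c d.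
Proof.
  intros Hf.
  assert (Hd : forall t y, is_derive (fun t => RI (fun x => f x y) a t) t (f t y)).
  { intros t y; apply (is_derive_RI (fun x => f x y)). apply cont2_slice1; auto. }
  assert (Hp : forall t, is_derive (fun t => RI (fun y => RI (fun x => f x y) a t) c d) t (RI (fun y => f t y) c d)).
  { intros t.
    rewrite (RI_ext (fun y => f t y) (fun y => Derive (fun u => RI (fun x => f x y) a u) t)).
    - apply (is_derive_RInt_param (fun t y => RI (fun x => f x y) a t) c d t).
      + apply filter_forall; intros s y _; exists (f s y); auto.
      + intros y _. apply (continuity_2d_pt_ext f); auto.
        intros s z; symmetry; apply is_derive_unique; auto.
      + apply filter_forall; intros s. apply cont_ex_RInt, cont_RI_param; auto.
    - intros y; symmetry; apply is_derive_unique; auto. }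
  etransitivity; [apply (RI_FTC _ _ a b Hp)|].
  - apply (cont_RI_param (fun y x => f x y)), cont2_swap; auto.
  - rewrite (RI_ext (fun y => RI (fun x => f x y) a a) (fun _ => 0)).
    + rewrite (RI_const 0). ring.
    + intros y; apply RI_point.
Qed.

(* Discriminant of the nonnegative quadratic [c |-> int (f - c)^2]. *)
Lemma RI_sqr_le f a b : a <= b -> cont f -> (RI f a b) ^ 2 <= (b - a) * RI (fun x => f x ^ 2) a b.
Proof.
  intros ab Hf. set (I := RI f a b). set (J := RI (fun x => f x ^ 2) a b).
  assert (H : 0 <= RI (fun x => ((b - a) * f x - I) ^ 2) a b).
  { apply RI_ge0; auto. cont. intros; apply pow2_ge_0. }
  rewrite (RI_ext _ (fun x => (b - a) ^ 2 * f x ^ 2 - 2 * I * (b - a) * f x + I ^ 2)) in H by (intros; ring).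
  rewrite RI_plus, RI_minus, !RI_scal, RI_const in H; [|cont..].
  fold I J in H. destruct (Req_dec a b) as [->|nab].
  - unfold I; rewrite RI_point; lra.
  - apply Rmult_le_reg_l with (b - a); [lra|]. nra.
Qed.

(** * The sine integral *)

Definition snc (x : R) : R := if Req_EM_T x 0 then 1 else sin x / x.

Lemma snc_0 : snc 0 = 1.
Proof. unfold snc; destruct Req_EM_T; lra. Qed.

Lemma snc_mul x : x * snc x = sin x.
Proof.
  unfold snc; destruct Req_EM_T as [->|H]; [rewrite sin_0; ring|field; auto].
Qed.

Lemma snc_unique x y : x <> 0 -> x * y = sin x -> y = snc x.
Proof. intros Hx E; rewrite <- (snc_mul x) in E. apply Rmult_eq_reg_l with x; auto. Qed.

Lemma snc_even x : snc (- x) = snc x.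
Proof.
  destruct (Req_dec x 0) as [->|Hx]; [f_equal; ring|].
  apply snc_unique; auto. apply Ropp_eq_reg.
  rewrite <- sin_neg, <- (snc_mul (- x)); ring.
Qed.

Lemma snc_bound x : Rabs (snc x) <= 1.
Proof.
  assert (P : forall y, 0 < y -> Rabs (snc y) <= 1).
  { intros y Hy. unfold snc; destruct Req_EM_T; [lra|].
    unfold Rdiv; rewrite Rabs_mult, (Rabs_inv y), (Rabs_pos_eq y) by lra.
    apply Rle_div_l; auto. rewrite Rmult_1_l. apply Rabs_le; split.
    - destruct (Rle_dec y 1).
      + apply Rle_trans with 0; [lra|]. apply sin_ge_0; generalize PI2_1; lra.
      + generalize (SIN_bound y); lra.
    - apply Rlt_le, sin_lt_x, Hy. }
  destruct (total_order_T x 0) as [[H|H0]|H].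
  - rewrite <- snc_even; apply P; lra.
  - subst; rewrite snc_0, Rabs_R1; lra.
  - apply P; lra.
Qed.

Lemma cont_snc : cont snc.
Proof.
  intros x. destruct (Req_dec x 0) as [->|Hx].
  - apply continuity_pt_filterlim, continuity_pt_filterlim'.
    rewrite snc_0. change (is_lim snc 0 1). apply (is_lim_ext_loc (fun x => sin x / x)); [|exact is_lim_sinc_0].
    exists (mkposreal 1 Rlt_0_1); intros y _ Hy. unfold snc; destruct Req_EM_T; [contradiction|auto].
  - apply continuous_ext_loc with (fun x => sin x / x).
    + exists (mkposreal (Rabs x) (Rabs_pos_lt x Hx)); intros y Hy.
      unfold snc; destruct Req_EM_T as [->|]; auto.
      unfold ball in Hy; simpl in Hy; unfold AbsRing_ball, abs, minus, plus, opp in Hy; simpl in Hy.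
      rewrite Rplus_0_l, Rabs_Ropp in Hy; lra.
    + apply (ex_derive_continuous (fun x => sin x / x)). auto_derive; auto.
Qed.

Lemma wcont_snc x : wcont x = 1 - snc (2 * PI * x).
Proof.
  unfold wcont, snc. generalize PI_RGT_0; intros HP.
  destruct (Req_EM_T x 0) as [->|H]; destruct (Req_EM_T _ 0) as [E|E]; try ring.
  - contradict E; ring.
  - exfalso; apply H. apply Rmult_eq_reg_l with (2 * PI); lra.
Qed.

Definition Si (x : R) : R := RI snc 0 x.

Lemma is_derive_Si x : is_derive Si x (snc x).
Proof. apply is_derive_RI, cont_snc. Qed.

Lemma Si_odd x : Si (- x) = - Si x.
Proof.
  unfold Si. generalize (RI_neg snc 0 (- x) cont_snc); rewrite Ropp_involutive, Ropp_0.
  rewrite (RI_ext _ snc) by apply snc_even. rewrite (RI_swap snc 0 x) by apply cont_snc.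
  intros ->; ring.
Qed.

Lemma RI_exp_neg_le c X : 0 < c -> RI (fun x => exp (- c * x)) 0 X <= / c.
Proof.
  intros Hc. rewrite (RI_FTC (fun x => - exp (- c * x) / c)); [| |cont].
  - rewrite Rmult_0_r, exp_0. assert (0 < exp (- c * X) / c).
    { apply Rdiv_lt_0_compat; auto; apply exp_pos. }
    replace (- exp (- c * X) / c - -1 / c) with (/ c - exp (- c * X) / c) by (field; lra). lra.
  - intros x; auto_derive; auto. field; lra.
Qed.

Lemma atan_le x : 0 <= x -> atan x <= x.
Proof.
  intros Hx. destruct Hx as [Hx| <-]; [|rewrite atan_0; lra].
  destruct (MVT_gen atan 0 x (fun y => / (1 + y²))) as [c [Hc E]].
  - intros; apply is_derive_atan.
  - intros; apply continuity_pt_filterlim, (ex_derive_continuous atan).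
    exists (/ (1 + x0²)); apply is_derive_atan.
  - rewrite atan_0, !Rminus_0_r in E. rewrite E. rewrite <- (Rmult_1_l x) at 2.
    apply Rmult_le_compat_r; [lra|]. rewrite <- Rinv_1. apply Rinv_le_contravar; [lra|].
    generalize (Rle_0_sqr c); lra.
Qed.

Lemma cont_inv_1p_sqr c : cont (fun x => / (1 + (c * x) ^ 2)).
Proof. apply cont_inv; [|cont]. intros x; generalize (pow2_ge_0 (c * x)); lra. Qed.

Lemma RI_inv_1p_sqr c a b : 0 < c ->
  RI (fun x => / (1 + (c * x) ^ 2)) a b = (atan (c * b) - atan (c * a)) / c.
Proof.
  intros Hc. rewrite (RI_FTC (fun x => atan (c * x) / c)).
  - field; lra.
  - intros x. auto_derive; auto. field. split; [|lra]. generalize (Rle_0_sqr (c * x)); unfold Rsqr; nra.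
  - apply cont_inv_1p_sqr.
Qed.

(* Write [1/x] as the integral of [exp (- p x)] over [p] in [0, P] up to a small error. *)
Lemma Si_lim_aux X P : 0 < X -> 0 < P -> Rabs (Si X - atan P) <= 2 / X + / P.
Proof.
  intros HX HP.
  set (f := fun x p => sin x * exp (- (p * x))).
  assert (Hf : cont2 f) by (unfold f; cont2).
  (* Integrating first in [p] gives [Si X] up to a remainder with [exp (- P * x)]; integrating first
     in [x] gives [atan P] up to a remainder with [exp (- X * p)]. Both remainders are bounded by
     integrals of exponentials. *)
  assert (Hlaplace := RI_Fubini f 0 X 0 P Hf).
  assert (E1 : RI (fun x => RI (fun y => f x y) 0 P) 0 X = Si X - RI (fun x => snc x * exp (- P * x)) 0 X).
  { unfold Si; rewrite <- RI_minus; [| |apply cont_mult; [|cont]]; try apply cont_snc.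
    apply RI_ext; intros x; unfold f.
    destruct (Req_dec x 0) as [->|Hx].
    - rewrite (RI_ext _ (fun _ => 0)) by (intros; rewrite sin_0; ring).
      rewrite RI_const, (Rmult_0_r (- P)), exp_0; ring.
    - rewrite (RI_FTC (fun p => - snc x * exp (- (p * x)))).
      + rewrite Rmult_0_l, Ropp_0, exp_0. replace (- P * x) with (- (P * x)) by ring. ring.
      + intros p; auto_derive; auto. rewrite <- (snc_mul x) at 1. ring.
      + cont. }
  assert (D : forall p, 1 + (1 * p) ^ 2 <> 0) by (intros; nra).
  set (g := fun p => exp (- X * p) * (cos X + p * sin X) * / (1 + (1 * p) ^ 2)).
  assert (Hg : cont g) by (unfold g; cont; apply cont_inv_1p_sqr).
  assert (E2 : RI (fun p => RI (fun x => f x p) 0 X) 0 P = atan P - RI g 0 P).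
  { replace (atan P) with (RI (fun p => / (1 + (1 * p) ^ 2)) 0 P).
    2:{ rewrite RI_inv_1p_sqr by lra. rewrite Rmult_0_r, Rmult_1_l, atan_0; field. }
    rewrite <- RI_minus; auto using cont_inv_1p_sqr.
    apply RI_ext; intros p; unfold f, g. specialize (D p).
    assert (Ec : / (1 + (1 * p) ^ 2) * (1 + p * p) = 1) by (replace (1 + p * p) with (1 + (1 * p) ^ 2) by ring; apply Rinv_l; auto).
    set (c := / (1 + (1 * p) ^ 2)) in *. clearbody c.
    rewrite (RI_FTC (fun x => - (exp (- (p * x)) * (cos x + p * sin x)) * c)); [| |cont].
    - rewrite Rmult_0_r, Ropp_0, exp_0, cos_0, sin_0. replace (- X * p) with (- (p * X)) by ring.
      ring.
    - intros x; auto_derive; auto. transitivity (c * (1 + p * p) * (sin x * exp (- (p * x)))); [|rewrite Ec]; ring. }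
  rewrite E1, E2 in Hlaplace.
  replace (Si X - atan P) with (RI (fun x => snc x * exp (- P * x)) 0 X - RI g 0 P) by lra.
  eapply Rle_trans; [apply Rabs_triang|]. rewrite Rabs_Ropp, Rplus_comm.
  apply Rplus_le_compat.
  - apply Rle_trans with (RI (fun p => 2 * exp (- X * p)) 0 P).
    + apply RI_abs; [lra|auto|cont|]. intros p Hp; unfold g.
      rewrite !Rabs_mult, (Rabs_pos_eq (exp _)) by (apply Rlt_le, exp_pos).
      rewrite Rabs_inv, (Rabs_pos_eq (1 + _)) by nra.
      rewrite (Rmult_comm 2), Rmult_assoc.
      apply Rmult_le_compat_l; [apply Rlt_le, exp_pos|].
      apply Rle_div_l; [nra|].
      apply Rle_trans with (1 + p).
      * eapply Rle_trans; [apply Rabs_triang|].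
        rewrite Rabs_mult, (Rabs_pos_eq p) by lra.
        assert (Rabs (cos X) <= 1) by (apply Rabs_le, COS_bound).
        assert (Rabs (sin X) <= 1) by (apply Rabs_le, SIN_bound). nra.
      * nra.
    + rewrite RI_scal by cont. apply Rmult_le_compat_l; [lra|]. apply RI_exp_neg_le; auto.
  - apply Rle_trans with (RI (fun x => exp (- P * x)) 0 X); [|apply RI_exp_neg_le; auto].
    apply RI_abs; [lra|apply cont_mult; [apply cont_snc|cont]|cont|].
    intros x _. rewrite Rabs_mult, (Rabs_pos_eq (exp _)) by (apply Rlt_le, exp_pos).
    rewrite <- (Rmult_1_l (exp _)) at 2. apply Rmult_le_compat_r; [apply Rlt_le, exp_pos|apply snc_bound].
Qed.

(** A passage to the limit without limits: an error [c / P] valid for all [P >= 1] may be dropped.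
    Most limits below are taken in this quantitative way. *)
Lemma le_of_le_inv x y c : 0 <= c -> (forall P, 1 <= P -> x <= y + c / P) -> x <= y.
Proof.
  intros Hc H. apply le_epsilon; intros eps He.
  assert (H1 : 1 <= Rmax 1 (c / eps)) by apply Rmax_l.
  eapply Rle_trans; [apply (H _ H1)|]. apply Rplus_le_compat_l.
  apply Rle_div_l; [lra|]. apply Rle_trans with (eps * (c / eps)).
  - right; field; lra.
  - apply Rmult_le_compat_l; [lra|]. apply Rmax_r.
Qed.

(** Lets [P] tend to infinity in [Si_lim_aux], using [PI / 2 - atan P = atan (/ P) <= / P]. *)
Lemma Si_lim X : 0 < X -> Rabs (Si X - PI / 2) <= 2 / X.
Proof.
  intros HX. apply (le_of_le_inv _ _ 2); [lra|]. intros P HP.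
  replace (Si X - PI / 2) with ((Si X - atan P) + - (PI / 2 - atan P)) by ring.
  eapply Rle_trans; [apply Rabs_triang|].
  assert (H1 := Si_lim_aux X P HX ltac:(lra)).
  rewrite Rabs_Ropp, <- atan_inv by lra.
  assert (HiP : 0 < / P) by (apply Rinv_0_lt_compat; lra).
  assert (atan (/ P) <= / P) by (apply atan_le; lra).
  assert (0 < atan (/ P)) by (rewrite <- atan_0; apply atan_increasing; auto).
  rewrite (Rabs_pos_eq (atan _)) by lra. replace (2 / P) with (/ P + / P) by (field; lra). lra.
Qed.

(** The trivial bound 3 for [X <= 1] is merged with [Si_lim], so that one estimate can be integrated
    from 0 on. *)
Lemma Si_lim_bound X : 0 <= X -> Rabs (Si X - PI / 2) <= 6 / (1 + X).
Proof.
  intros HX. destruct (Rle_dec X 1) as [H|H].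
  - apply Rle_trans with 3.
    + eapply Rle_trans; [apply Rabs_triang|]. rewrite Rabs_Ropp, (Rabs_pos_eq (PI / 2)) by (generalize PI_RGT_0; lra).
      assert (Rabs (Si X) <= (X - 0) * 1).
      { apply RI_abs_const; auto using cont_snc, snc_bound. }
      generalize PI_4; lra.
    + apply Rle_div_r; lra.
  - eapply Rle_trans; [apply Si_lim; lra|].
    apply Rmult_le_reg_r with (X * (1 + X)); [nra|]. field_simplify; lra.
Qed.

(* [sg R v] is the integral of the Dirichlet kernel, tending to [sign v / 2]. *)
Definition sg (R0 v : R) : R := Si (2 * PI * R0 * v) / PI.

(** The Dirichlet kernel [sin (2 PI R0 v) / (PI v)], with its limit [2 R0] at [v = 0]. *)
Definition dk (R0 v : R) : R := 2 * R0 * snc (2 * PI * R0 * v).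

Lemma is_derive_sg R0 v : is_derive (sg R0) v (dk R0 v).
Proof.
  unfold sg, dk. generalize PI_RGT_0; intros HP.
  replace (2 * R0 * snc (2 * PI * R0 * v)) with (scal (/ PI) (scal (2 * PI * R0) (snc (2 * PI * R0 * v)))).
  2:{ unfold scal; simpl; unfold mult; simpl. field; lra. }
  apply is_derive_ext with (fun v => scal (/ PI) (Si (2 * PI * R0 * v))).
  { intros t; unfold scal; simpl; unfold mult; simpl. field; lra. }
  apply (is_derive_scal (fun v => Si (2 * PI * R0 * v)) v (/ PI)).
  apply (is_derive_comp Si (fun v => 2 * PI * R0 * v)).
  - apply is_derive_Si.
  - auto_derive; auto; ring.
Qed.

Lemma cont_sg R0 : cont (sg R0).
Proof. apply cont_derive with (dk R0), is_derive_sg. Qed.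

Lemma cont_dk R0 : cont (dk R0).
Proof. unfold dk. assert (H := cont_snc). cont. Qed.

Lemma sg_odd R0 v : sg R0 (- v) = - sg R0 v.
Proof.
  unfold sg. replace (2 * PI * R0 * - v) with (- (2 * PI * R0 * v)) by ring.
  rewrite Si_odd. field. apply PI_neq0.
Qed.

(** A majorant of [2 / (1 + R0 * v)] for [v >= 0] that is even and has an arctangent as primitive.
    Its two terms serve the ranges [R0 * v >= sqrt R0] and [R0 * v <= sqrt R0]; avoiding a logarithm
    costs the weaker rate [1 / sqrt R0]. *)
Definition sg_err (R0 v : R) : R := 2 / sqrt R0 + 2 * (1 + sqrt R0) * / (1 + (R0 * v) ^ 2).

Lemma cont_sg_err R0 : cont (sg_err R0).
Proof. unfold sg_err. cont. apply cont_inv_1p_sqr. Qed.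

Lemma sg_err_even R0 v : sg_err R0 (- v) = sg_err R0 v.
Proof. unfold sg_err. do 3 f_equal. ring. Qed.

Lemma sg_pos R0 v : 1 <= R0 -> 0 <= v -> Rabs (sg R0 v - 1 / 2) <= sg_err R0 v.
Proof.
  intros HR Hv. generalize PI2_1 PI_RGT_0; intros HP HP0.
  assert (Hx : 0 <= R0 * v) by nra.
  apply Rle_trans with (2 / (1 + R0 * v)).
  - replace (sg R0 v - 1 / 2) with ((Si (2 * PI * R0 * v) - PI / 2) * / PI) by (unfold sg; field; lra).
    rewrite Rabs_mult, Rabs_inv, (Rabs_pos_eq PI) by lra.
    apply Rle_div_l; auto.
    assert (H3 : 3 < PI) by (generalize PI2_3_2; lra).
    assert (Hb : R0 * v <= 2 * PI * R0 * v) by nra.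
    eapply Rle_trans; [apply Si_lim_bound; lra|].
    apply Rle_trans with (6 / (1 + R0 * v)).
    + apply Rmult_le_compat_l; [lra|]. apply Rinv_le_contravar; lra.
    + unfold Rdiv. rewrite (Rmult_comm 2), Rmult_assoc, (Rmult_comm 6). apply Rmult_le_compat_l; [|lra].
      apply Rlt_le, Rinv_0_lt_compat; lra.
  - unfold sg_err. set (x := R0 * v) in *. set (s := sqrt R0).
    assert (Hs : 1 <= s) by (rewrite <- sqrt_1; apply sqrt_le_1_alt; auto).
    replace (2 / s + 2 * (1 + s) * / (1 + x ^ 2)) with (2 * (/ s + (1 + s) / (1 + x ^ 2))) by (field; nra).
    unfold Rdiv at 1. apply Rmult_le_compat_l; [lra|].
    destruct (Rle_dec s x) as [H|H].
    + apply Rle_trans with (/ s).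
      * apply Rinv_le_contravar; lra.
      * assert (0 <= (1 + s) / (1 + x ^ 2)) by (apply Rdiv_le_0_compat; nra). lra.
    + apply Rle_trans with ((1 + s) / (1 + x ^ 2)).
      * apply Rmult_le_reg_r with ((1 + x) * (1 + x ^ 2)); [nra|]. field_simplify; nra.
      * assert (0 < / s) by (apply Rinv_0_lt_compat; lra). lra.
Qed.

Lemma sg_neg R0 v : 1 <= R0 -> v <= 0 -> Rabs (sg R0 v + 1 / 2) <= sg_err R0 v.
Proof.
  intros HR Hv. rewrite <- sg_err_even, <- (Ropp_involutive v), sg_odd, Ropp_involutive.
  rewrite <- Rabs_Ropp. replace (- (- sg R0 (- v) + 1 / 2)) with (sg R0 (- v) - 1 / 2) by ring.
  apply sg_pos; lra.
Qed.

Lemma RI_sg_err R0 a b : 1 <= R0 -> a <= b -> RI (sg_err R0) a b <= (2 * (b - a) + 16) / sqrt R0.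
Proof.
  intros HR Hab. unfold sg_err. generalize PI_RGT_0 PI_4; intros HP HP4.
  rewrite RI_plus, RI_const, RI_scal, RI_inv_1p_sqr by (try lra; cont; apply cont_inv_1p_sqr).
  set (s := sqrt R0).
  assert (Hs : 1 <= s) by (rewrite <- sqrt_1; apply sqrt_le_1_alt; auto).
  assert (E : R0 = s * s) by (symmetry; apply sqrt_sqrt; lra).
  assert (B1 := atan_bound (R0 * a)). assert (B2 := atan_bound (R0 * b)).
  set (d := atan (R0 * b) - atan (R0 * a)). assert (Hd : d <= 4) by (unfold d; lra).
  rewrite E. apply Rmult_le_reg_r with (s * s); [nra|].
  replace ((((b - a) * (2 / s)) + 2 * (1 + s) * (d / (s * s))) * (s * s))
    with (2 * (b - a) * s + 2 * (1 + s) * d) by (field; lra).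
  replace ((2 * (b - a) + 16) / s * (s * s)) with (2 * (b - a) * s + 16 * s) by (field; lra).
  nra.
Qed.

(* [c] is the point of [[a, b]] nearest to [w]. *)
Lemma RI_sg_lim h B R0 a b c w : cont h -> 1 <= R0 -> a <= c <= b -> 0 <= B ->
  (forall t, a <= t <= b -> Rabs (h t) <= B) -> (a < c -> c <= w) -> (c < b -> w <= c) ->
  Rabs (RI (fun t => h t * sg R0 (w - t)) a b - (RI h a c - RI h c b) / 2)
    <= B * ((2 * (b - a) + 32) / sqrt R0).
Proof.
  intros Hh HR Hc HB Hb H1 H2.
  assert (Cs := cont_sg R0). assert (Ce := cont_sg_err R0).
  assert (C1 : cont (fun t => h t * sg R0 (w - t))) by cont.
  rewrite <- (RI_Chasles _ a c b C1).
  assert (P1 : Rabs (RI (fun t => h t * sg R0 (w - t)) a c - RI h a c / 2) <= B * RI (sg_err R0) (w - c) (w - a)).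
  { destruct (Req_dec a c) as [->|nac].
    { rewrite !RI_point. right. unfold Rdiv. rewrite Rmult_0_l, Rminus_0_r, Rabs_R0; ring. }
    replace (RI h a c / 2) with (RI (fun t => / 2 * h t) a c) by (rewrite RI_scal by auto; field).
    rewrite <- RI_minus by cont.
    replace (RI (sg_err R0) (w - c) (w - a)) with (RI (fun t => sg_err R0 (w - t)) a c).
    2:{ rewrite (RI_ext _ (fun t => sg_err R0 (t + - w))).
        2:{ intros t; rewrite <- sg_err_even. f_equal; ring. }
        rewrite RI_shift by auto. rewrite <- (Ropp_involutive (c + - w)), <- (Ropp_involutive (a + - w)) at 1.
        replace (- (c + - w)) with (w - c) by ring. replace (- (a + - w)) with (w - a) by ring.
        rewrite <- RI_neg by auto. apply RI_ext, sg_err_even. }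
    rewrite <- RI_scal by cont. apply RI_abs; [lra|cont..|].
    intros t Ht. replace (h t * sg R0 (w - t) - / 2 * h t) with (h t * (sg R0 (w - t) - 1 / 2)) by field.
    rewrite Rabs_mult. apply Rmult_le_compat; try apply Rabs_pos; [apply Hb; lra|].
    apply sg_pos; auto. lra. }
  assert (P2 : Rabs (RI (fun t => h t * sg R0 (w - t)) c b + RI h c b / 2) <= B * RI (sg_err R0) (w - b) (w - c)).
  { destruct (Req_dec c b) as [->|nac].
    { rewrite !RI_point. right. unfold Rdiv. rewrite Rmult_0_l, Rplus_0_r, Rabs_R0; ring. }
    replace (RI h c b / 2) with (RI (fun t => / 2 * h t) c b) by (rewrite RI_scal by auto; field).
    rewrite <- RI_plus by cont.
    replace (RI (sg_err R0) (w - b) (w - c)) with (RI (fun t => sg_err R0 (w - t)) c b).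
    2:{ rewrite (RI_ext _ (fun t => sg_err R0 (t + - w))).
        2:{ intros t; rewrite <- sg_err_even. f_equal; ring. }
        rewrite RI_shift by auto. rewrite <- (Ropp_involutive (c + - w)), <- (Ropp_involutive (b + - w)) at 1.
        replace (- (c + - w)) with (w - c) by ring. replace (- (b + - w)) with (w - b) by ring.
        rewrite <- RI_neg by auto. apply RI_ext, sg_err_even. }
    rewrite <- RI_scal by cont. apply RI_abs; [lra|cont..|].
    intros t Ht. replace (h t * sg R0 (w - t) + / 2 * h t) with (h t * (sg R0 (w - t) + 1 / 2)) by field.
    rewrite Rabs_mult. apply Rmult_le_compat; try apply Rabs_pos; [apply Hb; lra|].
    apply sg_neg; auto. lra. }
  assert (Q1 := RI_sg_err R0 (w - c) (w - a) HR ltac:(lra)).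
  assert (Q2 := RI_sg_err R0 (w - b) (w - c) HR ltac:(lra)).
  replace (_ + _ - _) with
    ((RI (fun t => h t * sg R0 (w - t)) a c - RI h a c / 2) + (RI (fun t => h t * sg R0 (w - t)) c b + RI h c b / 2)) by field.
  eapply Rle_trans; [apply Rabs_triang|].
  apply Rle_trans with (B * ((2 * (w - a - (w - c)) + 16) / sqrt R0 + (2 * (w - c - (w - b)) + 16) / sqrt R0)).
  - rewrite Rmult_plus_distr_l. apply Rplus_le_compat; (eapply Rle_trans; [eassumption|]; apply Rmult_le_compat_l; auto).
  - right. unfold Rdiv; ring.
Qed.

(** * The quadratic form on the Fourier side *)

(** The projection onto [[-a, a]]. A primitive of [f] composed with it plays the role of the
    primitive of [f] extended by zero, so [f] itself can stay continuous. *)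
Definition clip (a x : R) : R := Rmax (- a) (Rmin a x).

Lemma cont_clip a : cont (clip a).
Proof. unfold clip. apply cont_Rmax; [|apply cont_Rmin]; cont. Qed.

Lemma clip_mid a x : - a <= x <= a -> clip a x = x.
Proof. intros H; unfold clip. rewrite Rmin_right, Rmax_right; lra. Qed.

Lemma clip_hi a x : 0 <= a -> a <= x -> clip a x = a.
Proof. intros H1 H; unfold clip. rewrite Rmin_left, Rmax_right; lra. Qed.

Lemma clip_lo a x : 0 <= a -> x <= - a -> clip a x = - a.
Proof. intros H1 H; unfold clip. rewrite Rmin_right, Rmax_left; lra. Qed.

(** The first square is [F(0)^2]. The second term is the integral of [F^2] against [snc (2 PI x)];
    its inner integral over the window [[s - 1, s + 1]] is a difference of two values of a
    primitive. *)
Definition qform (a : R) (f : R -> R) : R :=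
  (RI f (- a) a) ^ 2
  - RI (fun s => f s * (RI f (- a) (clip a (s + 1)) - RI f (- a) (clip a (s - 1)))) (- a) a / 2.

Lemma cont_RI_clip a f b c : cont f -> cont (fun s => RI f b (clip a (s + c))).
Proof.
  intros Hf. apply (cont_comp (fun x => RI f b x)); [apply cont_RI; auto|].
  apply cont_comp; [apply cont_clip|cont].
Qed.

(** For [a <= 1/2] the window [[s - 1, s + 1]] covers [[-a, a]] whatever [s] is. *)
Lemma qform_small a f : cont f -> 0 < a <= 1 / 2 -> qform a f = (RI f (- a) a) ^ 2 / 2.
Proof.
  intros Hf Ha. unfold qform.
  rewrite (RI_ext_le (fun s => f s * (_ - _)) (fun s => RI f (- a) a * f s)) by
    (try lra; intros s Hs; rewrite clip_hi, clip_lo, RI_point by lra; ring).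
  rewrite RI_scal by auto. field.
Qed.

(** The kernel is [1/2], plus another [1/2] where [|s - t| > 1]; by symmetry the latter amounts to 1
    on [s - t > 1]. The integration by parts realises this symmetry: it turns the overlap with
    [s + 1] into the one with [s - 1]. *)
Lemma qform_large_aux a f : cont f -> 1 / 2 < a <= 1 ->
  qform a f = (RI f (- a) a) ^ 2 / 2 + RI (fun s => f s * RI f (- a) (s - 1)) (1 - a) a.
Proof.
  intros Hf Ha. unfold qform. set (F := fun x => RI f (- a) x).
  assert (HF : forall x, is_derive F x (f x)) by (apply is_derive_RI; auto).
  assert (CF : cont F) by (apply cont_RI; auto).
  assert (C1 : cont (fun s => f s * F (clip a (s + 1)))).
  { apply cont_mult; auto. apply cont_RI_clip; auto. }
  assert (C2 : cont (fun s => f s * F (clip a (s - 1)))).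
  { apply cont_mult; auto. apply (cont_RI_clip a f (- a) (- 1)); auto. }
  rewrite (RI_ext _ (fun s => f s * F (clip a (s + 1)) - f s * F (clip a (s - 1)))) by (intros; unfold F; ring).
  rewrite RI_minus by auto.
  rewrite <- (RI_Chasles _ (- a) (a - 1) a C1), <- (RI_Chasles _ (- a) (1 - a) a C2).
  rewrite (RI_ext_le (fun s => f s * F (clip a (s + 1))) (fun s => F (s + 1) * f s) (- a) (a - 1)) by
    (try lra; intros s Hs; rewrite clip_mid by lra; ring).
  rewrite (RI_ext_le (fun s => f s * F (clip a (s + 1))) (fun s => F a * f s) (a - 1) a) by
    (try lra; intros s Hs; rewrite clip_hi by lra; ring).
  rewrite (RI_ext_le (fun s => f s * F (clip a (s - 1))) (fun s => 0) (- a) (1 - a)) by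
    (try lra; intros s Hs; rewrite clip_lo by lra; unfold F; rewrite RI_point; ring).
  rewrite (RI_ext_le (fun s => f s * F (clip a (s - 1))) (fun s => f s * F (s - 1)) (1 - a) a) by
    (try lra; intros s Hs; rewrite clip_mid by lra; ring).
  rewrite RI_scal, RI_const by auto.
  rewrite (RI_by_parts (fun s => F (s + 1)) F (fun s => f (s + 1)) f); auto; [| |cont].
  2:{ intros x. replace (f (x + 1)) with (scal 1 (f (x + 1))) by (unfold scal; simpl; unfold mult; simpl; ring).
      apply (is_derive_comp F (fun s => s + 1)); auto. auto_derive; auto. }
  rewrite (RI_ext (fun x => f (x + 1) * F x) (fun x => f (x + 1) * F ((x + 1) - 1))) by (intros; do 2 f_equal; ring).
  rewrite (RI_shift (fun s => f s * F (s - 1)) 1) by cont.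
  replace (- a + 1) with (1 - a) by ring. replace (a - 1 + 1) with a by ring.
  assert (E : RI f (a - 1) a = F a - F (a - 1)).
  { unfold F. rewrite <- (RI_Chasles f (- a) (a - 1) a) by auto. ring. }
  rewrite E. assert (E0 : F (- a) = 0) by apply RI_point. rewrite E0.
  change (RI f (- a) a) with (F a). field.
Qed.

(* Even and odd parts of [f], folded around [1/2] and split again into even and odd parts. *)
Definition evp f u := (f (1/2 + u) + f (1/2 - u) + f (-1/2 - u) + f (-1/2 + u)) / 4.
Definition evq f u := (f (1/2 + u) - f (1/2 - u) + f (-1/2 - u) - f (-1/2 + u)) / 4.
Definition odp f u := (f (1/2 + u) + f (1/2 - u) - f (-1/2 - u) - f (-1/2 + u)) / 4.
Definition odq f u := (f (1/2 + u) - f (1/2 - u) - f (-1/2 - u) + f (-1/2 + u)) / 4.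

Lemma cont_parts f : cont f -> cont (evp f) /\ cont (evq f) /\ cont (odp f) /\ cont (odq f).
Proof. intros Hf; unfold evp, evq, odp, odq; repeat split; cont. Qed.

(** The four translated and reflected copies of [[0, a - 1/2]] tile the two arms, each arm being
    folded at its midpoint [1/2] or [-1/2]. *)
Lemma RI_fold h a : cont h ->
  RI h (- a) a = RI h (- (1 - a)) (1 - a)
    + RI (fun u => h (1/2 + u) + h (1/2 - u) + h (-1/2 - u) + h (-1/2 + u)) 0 (a - 1/2).
Proof.
  intros Hh. rewrite !RI_plus by cont.
  assert (E1 : RI (fun u => h (1/2 + u)) 0 (a - 1/2) = RI h (1/2) a).
  { rewrite (RI_ext _ (fun u => h (u + 1/2))) by (intros; f_equal; ring). rewrite RI_shift by auto. f_equal; field. }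
  assert (E2 : RI (fun u => h (1/2 - u)) 0 (a - 1/2) = RI h (1 - a) (1/2)).
  { rewrite (RI_ext _ (fun u => (fun v => h (v + 1/2)) (- u))) by (intros; f_equal; ring).
    rewrite (RI_neg (fun v => h (v + 1/2))) by cont. rewrite RI_shift by auto. f_equal; field. }
  assert (E3 : RI (fun u => h (-1/2 + u)) 0 (a - 1/2) = RI h (-1/2) (- (1 - a))).
  { rewrite (RI_ext _ (fun u => h (u + -1/2))) by (intros; f_equal; ring). rewrite RI_shift by auto. f_equal; field. }
  assert (E4 : RI (fun u => h (-1/2 - u)) 0 (a - 1/2) = RI h (- a) (-1/2)).
  { rewrite (RI_ext _ (fun u => (fun v => h (v + -1/2)) (- u))) by (intros; f_equal; field).
    rewrite (RI_neg (fun v => h (v + -1/2))) by cont. rewrite RI_shift by auto. f_equal; field. }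
  rewrite E1, E2, E3, E4.
  rewrite <- (RI_Chasles h (- a) (-1/2) a), <- (RI_Chasles h (-1/2) (- (1 - a)) a),
    <- (RI_Chasles h (- (1 - a)) (1 - a) a), <- (RI_Chasles h (1 - a) (1/2) a) by auto. ring.
Qed.

Lemma RI_parts f a : cont f ->
  RI f (- a) a = RI f (- (1 - a)) (1 - a) + 4 * RI (evp f) 0 (a - 1/2).
Proof.
  intros Hf. destruct (cont_parts f Hf) as [C1 [C2 [C3 C4]]].
  rewrite RI_fold by auto. f_equal. rewrite <- RI_scal by auto. apply RI_ext; intros; unfold evp; field.
Qed.

Lemma RI_sqr_parts f a : cont f ->
  RI (fun s => f s ^ 2) (- a) a = RI (fun s => f s ^ 2) (- (1 - a)) (1 - a)
    + 4 * (RI (fun u => evp f u ^ 2 + evq f u ^ 2) 0 (a - 1/2) + RI (fun u => odp f u ^ 2 + odq f u ^ 2) 0 (a - 1/2)).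
Proof.
  intros Hf. destruct (cont_parts f Hf) as [C1 [C2 [C3 C4]]].
  rewrite (RI_fold (fun s => f s ^ 2)) by cont. f_equal. rewrite <- RI_plus by cont. rewrite <- RI_scal by cont.
  apply RI_ext; intros; unfold evp, evq, odp, odq; field.
Qed.

(** Only the arms interact, through [s = 1/2 + u] and [s - 1 = -1/2 + u]. With [g] the right arm and
    [k] the reversed left arm, the inner integral is that of [k] over [[-u, L]]. Parity in [u]
    removes half of the terms, and the sum and difference of [g] and [k] diagonalise the rest, with
    opposite signs for the even and the odd part of [f]. *)
Lemma RI_cross_parts f a : cont f ->
  RI (fun s => f s * RI f (- a) (s - 1)) (1 - a) a
  = 2 * RI (evp f) 0 (a - 1/2) ^ 2 + 4 * RI (fun u => evq f u * RI (evp f) 0 u) 0 (a - 1/2)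
    - 2 * RI (odp f) 0 (a - 1/2) ^ 2 - 4 * RI (fun u => odq f u * RI (odp f) 0 u) 0 (a - 1/2).
Proof.
  intros Hf. set (L := a - 1/2).
  destruct (cont_parts f Hf) as [Cep [Ceq [Cop Coq]]].
  set (g := fun u => f (1/2 + u)). set (k := fun u => f (-1/2 - u)).
  assert (Cg : cont g) by (unfold g; cont). assert (Ck : cont k) by (unfold k; cont).
  set (gp := fun u => (g u + g (- u)) / 2). set (gq := fun u => (g u - g (- u)) / 2).
  set (kp := fun u => (k u + k (- u)) / 2). set (kq := fun u => (k u - k (- u)) / 2).
  assert (Cgp : cont gp) by (unfold gp; cont). assert (Cgq : cont gq) by (unfold gq; cont).
  assert (Ckp : cont kp) by (unfold kp; cont). assert (Ckq : cont kq) by (unfold kq; cont).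
  set (GP := fun u => RI gp 0 u). set (KP := fun u => RI kp 0 u). set (KQ := fun u => RI kq 0 u).
  assert (CGP : cont GP) by (apply cont_RI; auto). assert (CKP : cont KP) by (apply cont_RI; auto).
  assert (CKQ : cont KQ) by (apply cont_RI; auto).
  assert (Epe : forall u, RI (evp f) 0 u = (GP u + KP u) / 2).
  { intros u; unfold GP, KP. rewrite <- RI_plus by auto. unfold Rdiv at 1. rewrite Rmult_comm, <- RI_scal by cont.
    apply RI_ext; intros x; unfold evp, gp, kp, g, k.
    replace (1/2 + - x) with (1/2 - x) by ring. replace (-1/2 - - x) with (-1/2 + x) by ring. field. }
  assert (Epo : forall u, RI (odp f) 0 u = (GP u - KP u) / 2).
  { intros u; unfold GP, KP. rewrite <- RI_minus by auto. unfold Rdiv at 1. rewrite Rmult_comm, <- RI_scal by cont.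
    apply RI_ext; intros x; unfold odp, gp, kp, g, k.
    replace (1/2 + - x) with (1/2 - x) by ring. replace (-1/2 - - x) with (-1/2 + x) by ring. field. }
  assert (Eqe : forall u, evq f u = (gq u + kq u) / 2).
  { intros x; unfold evq, gq, kq, g, k.
    replace (1/2 + - x) with (1/2 - x) by ring. replace (-1/2 - - x) with (-1/2 + x) by ring. field. }
  assert (Eqo : forall u, odq f u = (gq u - kq u) / 2).
  { intros x; unfold odq, gq, kq, g, k.
    replace (1/2 + - x) with (1/2 - x) by ring. replace (-1/2 - - x) with (-1/2 + x) by ring. field. }
  rewrite (RI_ext (fun u => evq f u * RI (evp f) 0 u) (fun u => (gq u + kq u) * (GP u + KP u) / 4)) by
    (intros; rewrite Epe, Eqe; field).
  rewrite (RI_ext (fun u => odq f u * RI (odp f) 0 u) (fun u => (gq u - kq u) * (GP u - KP u) / 4)) by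
    (intros; rewrite Epo, Eqo; field).
  assert (EK : forall u, RI k 0 u = KP u + KQ u).
  { intros u; unfold KP, KQ; rewrite <- RI_plus by auto. apply RI_ext; intros; unfold kp, kq; field. }
  assert (Eodd : forall u, KP (- u) = - KP u).
  { intros u; unfold KP. rewrite <- Ropp_0 at 1. rewrite <- (RI_neg kp) by auto.
    rewrite (RI_ext _ kp) by (intros; unfold kp; rewrite Ropp_involutive; field).
    apply RI_swap; auto. }
  assert (Eeven : forall u, KQ (- u) = KQ u).
  { intros u; unfold KQ. rewrite <- Ropp_0 at 1. rewrite <- (RI_neg kq) by auto.
    rewrite (RI_ext _ (fun u => - kq u)) by (intros; unfold kq; rewrite Ropp_involutive; field).
    rewrite RI_opp by auto. rewrite (RI_swap kq) by auto. ring. }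
  assert (EL : RI (fun s => f s * RI f (- a) (s - 1)) (1 - a) a
    = RI (fun u => g u * (RI k 0 L - (- KP u + KQ u))) (- L) L).
  { assert (ES := RI_shift (fun s => f s * RI f (- a) (s - 1)) (1/2) (- L) L
      ltac:(apply cont_mult; auto; apply (cont_comp (fun x => RI f (- a) x)); [apply cont_RI; auto|cont])).
    replace (- L + 1/2) with (1 - a) in ES by (unfold L; field).
    replace (L + 1/2) with a in ES by (unfold L; field). rewrite <- ES.
    apply RI_ext; intros u. unfold g. replace (u + 1/2) with (1/2 + u) by ring. f_equal.
    rewrite <- Eodd, <- Eeven, <- EK.
    replace (RI k 0 L - RI k 0 (- u)) with (RI k (- u) L) by (rewrite <- (RI_Chasles k 0 (- u) L) by auto; ring).
    unfold k. symmetry. rewrite (RI_ext _ (fun x => (fun y => f (y + -1/2)) (- x))) by (intros; f_equal; field).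
    rewrite (RI_neg (fun y => f (y + -1/2))) by cont. rewrite RI_shift by auto. f_equal; unfold L; field. }
  rewrite EL. clear EL. rewrite EK.
  assert (Cm : cont (fun u => g u * (KP L + KQ L - (- KP u + KQ u)))) by cont.
  rewrite <- (RI_Chasles _ (- L) 0 L Cm).
  assert (EN := RI_neg _ 0 L Cm). rewrite Ropp_0 in EN. rewrite <- EN. clear EN. rewrite <- RI_plus by cont.
  rewrite (RI_ext _ (fun u => 2 * (KP L + KQ L) * gp u - 2 * (gp u * KQ u) + 2 * (gq u * KP u))).
  2:{ intros u. rewrite Eodd, Eeven. unfold gp, gq. field. }
  rewrite RI_plus, RI_minus, !RI_scal by cont.
  rewrite (RI_ext (fun u => (gq u + kq u) * (GP u + KP u) / 4) (fun u => / 4 * (gq u * GP u + gq u * KP u + kq u * GP u + kq u * KP u))) by (intros; field).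
  rewrite (RI_ext (fun u => (gq u - kq u) * (GP u - KP u) / 4) (fun u => / 4 * (gq u * GP u - gq u * KP u - kq u * GP u + kq u * KP u))) by (intros; field).
  rewrite !RI_scal, !RI_plus, !RI_minus by cont.
  rewrite (RI_ext (fun u => gp u * KQ u) (fun u => KQ u * gp u)) by (intros; ring).
  (* The one term of the wrong shape pairs the [u]-even part of [g] with a primitive of the [u]-odd
     part of [k]; integration by parts exchanges the roles. *)
  rewrite (RI_by_parts KQ GP kq gp 0 L); [|apply is_derive_RI; auto|apply is_derive_RI; auto|auto|auto].
  replace (GP 0) with 0 by (symmetry; apply RI_point).
  rewrite Epe, Epo. fold (GP L). field.
Qed.

Lemma nonneg_derive_incr (f df : R -> R) a b : a <= b ->
  (forall x, a <= x <= b -> is_derive f x (df x)) -> (forall x, a <= x <= b -> 0 <= df x) -> f a <= f b.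
Proof.
  intros Hab Hd H0. destruct (MVT_gen f a b df) as [c [Hc E]].
  - intros x Hx; apply Hd. rewrite Rmin_left, Rmax_right in Hx; lra.
  - intros x Hx. rewrite Rmin_left, Rmax_right in Hx by lra.
    apply continuity_pt_filterlim, (ex_derive_continuous f). exists (df x); apply Hd; lra.
  - rewrite Rmin_left, Rmax_right in Hc by lra.
    assert (0 <= df c * (b - a)) by (apply Rmult_le_pos; [apply H0|]; lra). lra.
Qed.

(* With [c = k cot (k x + d)], [(p - c P)^2 = p^2 - k^2 P^2 - (c P^2)'];
   the shift [d] keeps the cotangent away from its pole at [x = 0]. *)
Lemma Wirtinger_shift p k L d : cont p -> 0 < k -> 0 < L -> 0 < d -> k * L + d < PI ->
  k * (cos (k * L + d) / sin (k * L + d)) * RI p 0 L ^ 2 <=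
  RI (fun x => p x ^ 2) 0 L - k ^ 2 * RI (fun x => RI p 0 x ^ 2) 0 L.
Proof.
  intros Hp Hk HL Hd HPI.
  set (P := fun x => RI p 0 x).
  assert (DP : forall x, is_derive P x (p x)) by (apply is_derive_RI; auto).
  assert (CP : cont P) by (apply cont_RI; auto).
  set (A := fun x => RI (fun x => p x ^ 2 - k ^ 2 * P x ^ 2) 0 x - k * (cos (k * x + d) / sin (k * x + d)) * P x ^ 2).
  assert (H : A 0 <= A L).
  { apply (nonneg_derive_incr A (fun x => (p x - k * (cos (k * x + d) / sin (k * x + d)) * P x) ^ 2)); [lra| |intros; apply pow2_ge_0].
    intros x Hx. assert (Hs : 0 < sin (k * x + d)) by (apply sin_gt_0; nra).
    assert (D1 := is_derive_RI (fun x => p x ^ 2 - k ^ 2 * P x ^ 2) 0 ltac:(cont) x).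
    assert (D2 : is_derive (fun x => k * (cos (k * x + d) / sin (k * x + d))) x
       (- k ^ 2 * (1 + (cos (k * x + d) / sin (k * x + d)) ^ 2))).
    { auto_derive; [lra|]. generalize (sin2_cos2 (k * x + d)); unfold Rsqr; intros E.
      field_simplify; [|lra|lra]. f_equal. }
    assert (D3 : is_derive (fun x => P x ^ 2) x (2 * p x * P x)).
    { assert (E := is_derive_pow P 2 x (p x) (DP x)). replace (2 * p x * P x) with (INR 2 * p x * P x ^ pred 2) by (simpl; ring). exact E. }
    assert (D4 := is_derive_mult _ _ _ _ _ D2 D3 Rmult_comm).
    assert (D5 := is_derive_minus _ _ _ _ _ D1 D4).
    eapply is_derive_ext; [|evar (z : R); replace (_ ^ 2) with z; [exact D5|]].
    - intros t; reflexivity.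
    - unfold z, minus, plus, opp, mult; simpl. field. lra. }
  assert (P0 : P 0 = 0) by apply RI_point.
  unfold A in H. rewrite P0, RI_point, RI_minus, RI_scal in H by cont.
  change (RI p 0 L) with (P L). change (fun x => RI p 0 x ^ 2) with (fun x => P x ^ 2). lra.
Qed.

(** The limit [d -> 0] of [Wirtinger_shift]: in that inequality [d] occurs only in the cotangent at
    [k * L + d], which is continuous because [0 < k * L < PI]. *)
Lemma Wirtinger p k L : cont p -> 0 < k -> 0 < L -> k * L < PI ->
  k * (cos (k * L) / sin (k * L)) * RI p 0 L ^ 2 <=
  RI (fun x => p x ^ 2) 0 L - k ^ 2 * RI (fun x => RI p 0 x ^ 2) 0 L.
Proof.
  intros Hp Hk HL HPI.
  set (X := RI (fun x => p x ^ 2) 0 L - k ^ 2 * RI (fun x => RI p 0 x ^ 2) 0 L).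
  set (Y := fun d => k * (cos (k * L + d) / sin (k * L + d)) * RI p 0 L ^ 2).
  replace (k * (cos (k * L) / sin (k * L)) * RI p 0 L ^ 2) with (Y 0) by (unfold Y; rewrite Rplus_0_r; auto).
  apply le_epsilon; intros eps He.
  assert (C : continuity_pt Y 0).
  { apply continuity_pt_filterlim, (ex_derive_continuous Y). unfold Y. auto_derive.
    rewrite Rplus_0_r. apply Rgt_not_eq, sin_gt_0; nra. }
  destruct (C eps He) as [d [Hd H]].
  set (t := Rmin (d / 2) ((PI - k * L) / 2)).
  assert (Ht : 0 < t) by (unfold t; apply Rmin_glb_lt; lra).
  assert (Ht1 : t <= d / 2) by apply Rmin_l. assert (Ht2 : t <= (PI - k * L) / 2) by apply Rmin_r.
  assert (W := Wirtinger_shift p k L t Hp Hk HL Ht ltac:(lra)). fold X in W. fold (Y t) in W.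
  assert (Ha : Rabs (Y t - Y 0) < eps).
  { apply H. split; [split; [exact I|lra]|]. simpl; unfold R_dist. rewrite Rminus_0_r, Rabs_pos_eq; lra. }
  apply Rabs_lt_between' in Ha. lra.
Qed.

Lemma half_form_bound p q L mu sigma : cont p -> cont q -> 0 < L -> 0 < mu -> L / (2 * mu) < PI -> sigma ^ 2 = 1 ->
  2 * (cos (L / (2 * mu)) / sin (L / (2 * mu))) * RI p 0 L ^ 2 <=
  4 * mu * RI (fun u => p u ^ 2 + q u ^ 2) 0 L + 4 * sigma * RI (fun u => q u * RI p 0 u) 0 L.
Proof.
  intros Hp Hq HL Hm Ht Hs.
  assert (CP : cont (fun x => RI p 0 x)) by (apply cont_RI; auto).
  (* Minimising over [q] leaves [4 mu (p^2 - P^2 / (2 mu)^2)], which dictates the frequency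
     [/ (2 * mu)]. *)
  assert (W := Wirtinger p (/ (2 * mu)) L Hp ltac:(apply Rinv_0_lt_compat; lra) HL ltac:(rewrite Rmult_comm; exact Ht)).
  rewrite (Rmult_comm _ L) in W. fold (L / (2 * mu)) in W.
  set (ct := cos (L / (2 * mu)) / sin (L / (2 * mu))) in *.
  apply Rmult_le_compat_l with (r := 4 * mu) in W; [|lra].
  replace (4 * mu * (/ (2 * mu) * ct * RI p 0 L ^ 2)) with (2 * ct * RI p 0 L ^ 2) in W by (field; lra).
  eapply Rle_trans; [exact W|].
  rewrite RI_plus by cont.
  assert (S : 0 <= RI (fun u => (2 * mu * q u + sigma * RI p 0 u) ^ 2) 0 L).
  { apply RI_ge0; [lra|cont|intros; apply pow2_ge_0]. }
  rewrite (RI_ext _ (fun u => 4 * mu ^ 2 * q u ^ 2 + 4 * mu * sigma * (q u * RI p 0 u) + sigma ^ 2 * RI p 0 u ^ 2)) in S by (intros; ring).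
  rewrite !RI_plus, !RI_scal in S by cont. rewrite Hs in S.
  apply Rmult_le_reg_r with mu; auto.
  set (A := RI (fun u => q u ^ 2) 0 L) in *. set (B := RI (fun u => q u * RI p 0 u) 0 L) in *.
  set (D := RI (fun u => RI p 0 u ^ 2) 0 L) in *. set (E := RI (fun x => p x ^ 2) 0 L) in *.
  replace (4 * mu * (E - (/ (2 * mu)) ^ 2 * D) * mu) with (4 * mu ^ 2 * E - D) by (field; lra).
  nra.
Qed.

Lemma qform_parts a f : cont f -> 1 / 2 < a <= 1 ->
  qform a f = (RI f (- (1 - a)) (1 - a) + 4 * RI (evp f) 0 (a - 1/2)) ^ 2 / 2
    + (2 * RI (evp f) 0 (a - 1/2) ^ 2 + 4 * RI (fun u => evq f u * RI (evp f) 0 u) 0 (a - 1/2)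
      - 2 * RI (odp f) 0 (a - 1/2) ^ 2 - 4 * RI (fun u => odq f u * RI (odp f) 0 u) 0 (a - 1/2)).
Proof.
  intros Hf Ha. rewrite qform_large_aux, RI_cross_parts, RI_parts by auto. reflexivity.
Qed.

(** The constant makes [L / (2 * mu)] equal to [PI / 4], where the cotangent is 1 and the bound for
    the odd part exactly absorbs [- 2 W^2]. This is the critical case; the even part leaves only
    squares. *)
Lemma qform_lower a f : cont f -> 1 / 2 < a <= 1 ->
  - ((2 * a - 1) / PI) * RI (fun s => f s ^ 2) (- a) a <= qform a f.
Proof.
  intros Hf Ha. destruct (cont_parts f Hf) as [C1 [C2 [C3 C4]]].
  rewrite qform_parts, RI_sqr_parts by auto.
  generalize PI_RGT_0; intros HPI.
  set (L := a - 1/2). set (mu := (2 * a - 1) / PI).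
  assert (Hm : 0 < mu) by (apply Rdiv_lt_0_compat; lra).
  assert (Et : L / (2 * mu) = PI / 4) by (unfold L, mu; field; lra).
  assert (B1 := half_form_bound (evp f) (evq f) L mu 1 C1 C2 ltac:(unfold L; lra) Hm ltac:(lra) ltac:(ring)).
  assert (B2 := half_form_bound (odp f) (odq f) L mu (-1) C3 C4 ltac:(unfold L; lra) Hm ltac:(lra) ltac:(ring)).
  rewrite Et in B1, B2.
  assert (Ect : cos (PI / 4) / sin (PI / 4) = 1).
  { rewrite cos_PI4, sin_PI4. field. apply Rgt_not_eq, Rlt_sqrt2_0. }
  rewrite Ect in B1, B2.
  assert (N : 0 <= RI (fun s => f s ^ 2) (- (1 - a)) (1 - a)).
  { apply RI_ge0; [lra|cont|intros; apply pow2_ge_0]. }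
  set (V := RI (evp f) 0 L) in *. set (W := RI (odp f) 0 L) in *.
  assert (0 <= V ^ 2) by apply pow2_ge_0.
  assert (0 <= (RI f (- (1 - a)) (1 - a) + 4 * V) ^ 2) by apply pow2_ge_0.
  nra.
Qed.

(** Here the even part is critical: through [(m + 4 V)^2 / 2] it is coupled to the integral [m] over
    the middle interval, which Cauchy-Schwarz controls. The odd part is harmless because the
    cotangent of [theta] is positive. *)
Lemma qform_upper a f theta : cont f -> 1 / 2 < a <= 1 -> 0 < theta < PI / 4 ->
  (1 - 4 * theta * (1 - a) / (2 * a - 1)) * (cos theta - sin theta) = 4 * sin theta ->
  qform a f <= (2 * a - 1) / (4 * theta) * RI (fun s => f s ^ 2) (- a) a.
Proof.
  intros Hf Ha Ht Heq. destruct (cont_parts f Hf) as [C1 [C2 [C3 C4]]].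
  rewrite qform_parts, RI_sqr_parts by auto.
  generalize PI_RGT_0; intros HPI.
  set (L := a - 1/2). set (eta := (2 * a - 1) / (4 * theta)).
  assert (Hm : 0 < eta) by (apply Rdiv_lt_0_compat; lra).
  assert (Et : L / (2 * eta) = theta) by (unfold L, eta; field; lra).
  assert (B1 := half_form_bound (evp f) (evq f) L eta (-1) C1 C2 ltac:(unfold L; lra) Hm ltac:(lra) ltac:(ring)).
  assert (B2 := half_form_bound (odp f) (odq f) L eta 1 C3 C4 ltac:(unfold L; lra) Hm ltac:(lra) ltac:(ring)).
  rewrite Et in B1, B2.
  assert (Hs : 0 < sin theta) by (apply sin_gt_0; lra).
  assert (Hcs : 0 < cos theta - sin theta).
  { assert (sin theta < cos (PI / 4)) by (rewrite cos_PI4, <- sin_PI4; apply sin_increasing_1; lra).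
    assert (cos (PI / 4) < cos theta) by (apply cos_decreasing_1; lra). lra. }
  set (c := cos theta) in *. set (s := sin theta) in *. set (ct := c / s) in *.
  assert (Ect : c = ct * s) by (unfold ct; field; lra).
  assert (CS := RI_sqr_le f (- (1 - a)) (1 - a) ltac:(lra) Hf).
  set (m := RI f (- (1 - a)) (1 - a)) in *. set (Nc := RI (fun s => f s ^ 2) (- (1 - a)) (1 - a)) in *.
  set (V := RI (evp f) 0 L) in *. set (W := RI (odp f) 0 L) in *.
  set (q := 4 * theta * (1 - a) / (2 * a - 1)) in *.
  assert (Eq : (1 - a) = q * eta) by (unfold q, eta; field; lra).
  assert (Hq1 : 0 < 1 - q).
  { apply Rmult_lt_reg_r with (c - s); auto. rewrite Rmult_0_l, Heq; lra. }
  assert (Hq0 : 0 <= q).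
  { unfold q. apply Rdiv_le_0_compat; nra. }
  assert (HW : 0 <= (2 * ct + 2) * W ^ 2).
  { apply Rmult_le_pos; [|apply pow2_ge_0]. assert (0 < ct) by (unfold ct; apply Rdiv_lt_0_compat; lra). lra. }
  (* The remaining form in [(m, V)] has zero determinant by the equation for [theta]. *)
  assert (Eqct : (1 - q) * (ct - 1) = 4).
  { apply Rmult_eq_reg_r with s; [|lra]. rewrite <- Heq, Ect. ring. }
  assert (K : (m + 4 * V) ^ 2 / 2 + 2 * V ^ 2 <= eta * Nc + 2 * ct * V ^ 2).
  { assert (CS' : m ^ 2 <= 2 * q * (eta * Nc)) by (replace (1 - a - - (1 - a)) with (2 * (1 - a)) in CS by ring; rewrite Eq in CS; lra).
    assert (Hn : 0 <= eta * Nc).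
    { apply Rmult_le_pos; [lra|]. apply RI_ge0; [lra|cont|intros; apply pow2_ge_0]. }
    set (n := eta * Nc) in *. 
    assert (Hsq : m ^ 2 * (1 - q) <= 2 * q * (1 - q) * n) by nra.
    (* [q = 0] means [a = 1]: the middle interval is a point and [m = 0]. Otherwise the degenerate
       form is a multiple of one square. *)
    destruct Hq0 as [Hq0|Hq0].
    - assert (S := pow2_ge_0 ((1 - q) * m - 4 * q * V)).
      apply Rmult_le_reg_l with (2 * q * (1 - q)); [nra|].
      assert (E2 : 2 * q * (1 - q) * (2 * ct * V ^ 2) = 4 * q * (5 - q) * V ^ 2).
      { transitivity (4 * q * V ^ 2 * ((1 - q) * (ct - 1) + (1 - q))); [ring|]. rewrite Eqct; ring. }
      replace (2 * q * (1 - q) * (n + 2 * ct * V ^ 2)) with (2 * q * (1 - q) * n + 4 * q * (5 - q) * V ^ 2) by (rewrite <- E2; ring). lra.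
    - rewrite <- Hq0 in *. assert (m = 0) by nra. nra. }
  lra.
Qed.

(** * The real (Hartley) form of the Fourier transform *)

(** Convergence at the rate that [RI_sg_err] provides. An explicit rate makes combinations of limits
    a matter of arithmetic. *)
Definition tends (I : R -> R) (l : R) : Prop :=
  exists C, 0 <= C /\ forall M, 1 <= M -> Rabs (I M - l) <= C / sqrt M.

Lemma tends_ext I J l : (forall M, 1 <= M -> I M = J M) -> tends I l -> tends J l.
Proof. intros E [C [HC H]]; exists C; split; auto. intros M HM; rewrite <- E; auto. Qed.

Lemma tends_plus I J l m : tends I l -> tends J m -> tends (fun M => I M + J M) (l + m).
Proof.
  intros [C [HC H]] [D [HD H']]; exists (C + D); split; [lra|]. intros M HM.
  replace (I M + J M - (l + m)) with ((I M - l) + (J M - m)) by ring.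
  eapply Rle_trans; [apply Rabs_triang|]. specialize (H M HM). specialize (H' M HM).
  unfold Rdiv in *. lra.
Qed.

Lemma sqrt_ge_1 M : 1 <= M -> 1 <= sqrt M.
Proof. intros H; rewrite <- sqrt_1; apply sqrt_le_1_alt; auto. Qed.

Lemma inv_le_inv_sqrt C M : 0 <= C -> 1 <= M -> C / M <= C / sqrt M.
Proof.
  intros HC HM. apply Rmult_le_compat_l; auto. assert (H := sqrt_ge_1 M HM).
  apply Rinv_le_contravar; [lra|]. rewrite <- (sqrt_sqrt M) at 2 by lra. nra.
Qed.

Lemma le_of_le_inv_sqrt x y c : 0 <= c -> (forall P, 1 <= P -> x <= y + c / sqrt P) -> x <= y.
Proof.
  intros Hc H. apply (le_of_le_inv x y c); auto. intros P HP.
  specialize (H (P * P) ltac:(nra)). rewrite sqrt_square in H by lra. auto.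
Qed.

(** The kernel of the Hartley transform. It is real and inverts itself, so the real and the
    imaginary part of [F] on the line each correspond to a real function and can be treated
    separately. *)
Definition cas (x : R) : R := cos x + sin x.

Lemma cont_cas : cont cas.
Proof. unfold cas; cont. Qed.

Lemma cas_bound x : Rabs (cas x) <= 2.
Proof.
  unfold cas. generalize (COS_bound x) (SIN_bound x); intros; apply Rabs_le; lra.
Qed.

Lemma cas_mul x y : cas x * cas y = cos (x - y) + sin (x + y).
Proof. unfold cas. rewrite cos_minus, sin_plus. ring. Qed.

Definition hart (a : R) (f : R -> R) (x : R) : R := RI (fun t => f t * cas (2 * PI * x * t)) (- a) a.

Lemma cont_hart a f : cont f -> cont (hart a f).
Proof.
  intros Hf. unfold hart. apply (cont_RI_param (fun t x => f t * cas (2 * PI * x * t))).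
  assert (H := cont_cas). cont2.
Qed.

Lemma hart_0 a f : hart a f 0 = RI f (- a) a.
Proof.
  apply RI_ext; intros t. unfold cas. rewrite Rmult_0_r, Rmult_0_l, cos_0, sin_0; ring.
Qed.

(** In the product formula for [cas] the term [sin (x + y)] is odd in the integration variable and
    drops out against an even weight; what survives is the same kernel as for the Fourier
    transform. *)
Lemma RI_cas_cas w M s t : cont w -> (forall x, w (- x) = w x) ->
  RI (fun x => w x * (cas (2 * PI * x * s) * cas (2 * PI * x * t))) (- M) M
  = RI (fun x => w x * cos (2 * PI * x * (s - t))) (- M) M.
Proof.
  intros Hw He.
  rewrite (RI_ext _ (fun x => w x * cos (2 * PI * x * (s - t)) + w x * sin (2 * PI * x * (s + t)))).
  - rewrite RI_plus by cont. rewrite (RI_odd (fun x => w x * sin (2 * PI * x * (s + t)))); [ring|cont|].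
    intros x. rewrite He. replace (2 * PI * - x * (s + t)) with (- (2 * PI * x * (s + t))) by ring.
    rewrite sin_neg; ring.
  - intros x. rewrite cas_mul, Rmult_plus_distr_l. do 3 f_equal; ring.
Qed.

Lemma RI_hart_sqr a f w M : cont f -> cont w -> (forall x, w (- x) = w x) ->
  RI (fun x => hart a f x ^ 2 * w x) (- M) M
  = RI (fun s => f s * RI (fun t => f t * RI (fun x => w x * cos (2 * PI * x * (s - t))) (- M) M) (- a) a) (- a) a.
Proof.
  intros Hf Hw He. assert (Hc := cont_cas). assert (Hh := cont_hart a f Hf).
  transitivity (RI (fun x => RI (fun s => hart a f x * w x * (f s * cas (2 * PI * x * s))) (- a) a) (- M) M).
  { apply RI_ext; intros x. rewrite RI_scal by cont. unfold hart; ring. }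
  rewrite (RI_Fubini (fun x s => hart a f x * w x * (f s * cas (2 * PI * x * s)))) by cont2.
  apply RI_ext; intros s.
  transitivity (RI (fun x => RI (fun t => f s * (w x * cas (2 * PI * x * s)) * (f t * cas (2 * PI * x * t))) (- a) a) (- M) M).
  { apply RI_ext; intros x. rewrite RI_scal by cont. unfold hart; ring. }
  rewrite (RI_Fubini (fun x t => f s * (w x * cas (2 * PI * x * s)) * (f t * cas (2 * PI * x * t)))) by cont2.
  transitivity (RI (fun t => f s * (f t * RI (fun x => w x * (cas (2 * PI * x * s) * cas (2 * PI * x * t))) (- M) M)) (- a) a).
  { apply RI_ext; intros t. rewrite <- !RI_scal by cont. apply RI_ext; intros x; ring. }
  rewrite RI_scal.
  - f_equal. apply RI_ext; intros t. rewrite RI_cas_cas; auto.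
  - apply cont_mult; auto.
    apply (cont_RI_param (fun x t => w x * (cas (2 * PI * x * s) * cas (2 * PI * x * t)))). cont2.
Qed.

Lemma RI_cos_dk M v : RI (fun x => cos (2 * PI * x * v)) (- M) M = dk M v.
Proof.
  generalize PI_RGT_0; intros HP. unfold dk. destruct (Req_dec v 0) as [->|Hv].
  - rewrite (RI_ext _ (fun _ => 1)) by (intros; rewrite Rmult_0_r, cos_0; auto).
    rewrite RI_const, Rmult_0_r, snc_0. ring.
  - rewrite (RI_FTC (fun x => sin (2 * PI * x * v) / (2 * PI * v))); [| |cont].
    + replace (2 * PI * - M * v) with (- (2 * PI * M * v)) by ring. rewrite sin_neg.
      replace (2 * PI * M * v) with (2 * PI * M * v) by ring. rewrite <- (snc_mul (2 * PI * M * v)). field. lra.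
    + intros x. auto_derive; auto. field. lra.
Qed.

(** Product to sum: the frequencies [1 + v] and [1 - v] each integrate to [Si]. As [M] grows, the
    right side tends to half the indicator of [|v| < 1], the source of the window in [qform]. *)
Lemma RI_snc_cos M v : RI (fun x => snc (2 * PI * x) * cos (2 * PI * x * v)) (- M) M
  = (sg M (1 + v) + sg M (1 - v)) / 2.
Proof.
  generalize PI_RGT_0; intros HP. assert (Hs := cont_snc).
  rewrite (RI_FTC (fun x => (Si (2 * PI * x * (1 + v)) + Si (2 * PI * x * (1 - v))) / (4 * PI))); [| |cont].
  - replace (2 * PI * - M * (1 + v)) with (- (2 * PI * M * (1 + v))) by ring.
    replace (2 * PI * - M * (1 - v)) with (- (2 * PI * M * (1 - v))) by ring.
    rewrite !Si_odd. unfold sg. field. lra.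
  - assert (D : forall w x, is_derive (fun x => Si (2 * PI * x * w)) x (2 * PI * w * snc (2 * PI * x * w))).
    { intros w x. apply (is_derive_comp Si (fun x => 2 * PI * x * w)); [apply is_derive_Si|]. auto_derive; auto; ring. }
    intros x.
    replace (snc (2 * PI * x) * cos (2 * PI * x * v)) with
      (/ (4 * PI) * (2 * PI * (1 + v) * snc (2 * PI * x * (1 + v)) + 2 * PI * (1 - v) * snc (2 * PI * x * (1 - v)))).
    + apply is_derive_ext with (fun x => / (4 * PI) * (Si (2 * PI * x * (1 + v)) + Si (2 * PI * x * (1 - v)))).
      { intros; apply Rmult_comm. }
      apply (is_derive_scal (fun x => Si (2 * PI * x * (1 + v)) + Si (2 * PI * x * (1 - v)))).
      apply (is_derive_plus (fun x => Si (2 * PI * x * (1 + v))) (fun x => Si (2 * PI * x * (1 - v)))); apply D.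
    + destruct (Req_dec x 0) as [->|Hx].
      * rewrite !Rmult_0_r, !Rmult_0_l, !snc_0, cos_0. field; lra.
      * apply Rmult_eq_reg_l with (2 * PI * x).
        2:{ intros E. apply Rmult_integral in E; destruct E; lra. }
        assert (E1 := snc_mul (2 * PI * x)). assert (E2 := snc_mul (2 * PI * x * (1 + v))). assert (E3 := snc_mul (2 * PI * x * (1 - v))).
        replace (2 * PI * x * (1 + v)) with (2 * PI * x + 2 * PI * x * v) in * by ring.
        replace (2 * PI * x * (1 - v)) with (2 * PI * x - 2 * PI * x * v) in * by ring.
        rewrite sin_plus in E2. rewrite sin_minus in E3.
        replace (2 * PI * x * (snc (2 * PI * x) * cos (2 * PI * x * v))) with (sin (2 * PI * x) * cos (2 * PI * x * v)) by (rewrite <- E1; ring).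
        transitivity ((1 / 2) * ((2 * PI * x + 2 * PI * x * v) * snc (2 * PI * x + 2 * PI * x * v)
           + (2 * PI * x - 2 * PI * x * v) * snc (2 * PI * x - 2 * PI * x * v))); [field; lra|].
        rewrite E2, E3. field.
Qed.

Lemma RI_sg_clip f a B M w : cont f -> 0 < a -> 0 <= B -> 1 <= M -> (forall t, - a <= t <= a -> Rabs (f t) <= B) ->
  Rabs (RI (fun t => f t * sg M (w - t)) (- a) a - (RI f (- a) (clip a w) - RI f (- a) a / 2)) <= B * ((4 * a + 32) / sqrt M).
Proof.
  intros Hf Ha HB HM Hb.
  assert (Hc : - a <= clip a w <= a).
  { unfold clip; split; [apply Rmax_l|]. apply Rmax_lub; [lra|apply Rmin_l]. }
  assert (K := RI_sg_lim f B M (- a) a (clip a w) w Hf HM Hc HB Hb).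
  replace (2 * (a - - a) + 32) with (4 * a + 32) in K by ring.
  replace (RI f (- a) (clip a w) - RI f (- a) a / 2) with ((RI f (- a) (clip a w) - RI f (clip a w) a) / 2).
  2:{ rewrite <- (RI_Chasles f (- a) (clip a w) a) by auto. field. }
  apply K; intros H; clear - H Ha; unfold clip in *;
    unfold Rmax, Rmin in *; repeat destruct Rle_dec; lra.
Qed.

(** Continuity of [f] is enough: the limit kernel appears through [sg], which converges in the mean
    in [t], uniformly in [s]. *)
Lemma hart_snc_lim a f B : cont f -> 0 < a -> 0 <= B -> (forall t, - a <= t <= a -> Rabs (f t) <= B) ->
  tends (fun M => RI (fun x => hart a f x ^ 2 * snc (2 * PI * x)) (- M) M)
    (RI (fun s => f s * (RI f (- a) (clip a (s + 1)) - RI f (- a) (clip a (s - 1)))) (- a) a / 2).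
Proof.
  intros Hf Ha HB Hb. assert (Hs := cont_snc).
  exists (2 * a * (B * (B * (4 * a + 32)))). split; [repeat apply Rmult_le_pos; lra|].
  intros M HM. assert (Hsg := cont_sg M).
  rewrite RI_hart_sqr; [|auto|cont|].
  2:{ intros x. rewrite <- snc_even. f_equal; ring. }
  assert (C2 : cont (fun s => f s * (RI f (- a) (clip a (s + 1)) - RI f (- a) (clip a (s - 1))))).
  { apply cont_mult; auto. apply cont_minus; [apply cont_RI_clip|apply (cont_RI_clip a f (- a) (-1))]; auto. }
  assert (CP : forall c, cont (fun s => RI (fun t => f t * sg M (s + c - t)) (- a) a)).
  { intros c. apply (cont_RI_param (fun t s => f t * sg M (s + c - t))). cont2. }
  assert (C3 := CP 1). assert (C4 := CP (-1)).
  rewrite (RI_ext _ (fun s => / 2 * (f s * (RI (fun t => f t * sg M (s + 1 - t)) (- a) a - RI (fun t => f t * sg M (s + -1 - t)) (- a) a)))).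
  2:{ intros s. rewrite <- RI_minus by cont.
      rewrite (RI_ext (fun t => f t * RI _ _ _) (fun t => / 2 * (f t * sg M (s + 1 - t) - f t * sg M (s + -1 - t)))).
      - rewrite RI_scal by cont. ring.
      - intros t. rewrite RI_snc_cos. replace (1 + (s - t)) with (s + 1 - t) by ring.
        replace (1 - (s - t)) with (- (s + -1 - t)) by ring. rewrite sg_odd. field. }
  rewrite RI_scal by cont. unfold Rdiv at 1. rewrite (Rmult_comm (/ 2)), <- Rmult_minus_distr_r, <- RI_minus by cont.
  rewrite Rabs_mult.
  replace (2 * a * (B * (B * (4 * a + 32))) / sqrt M) with ((a - - a) * (B * (2 * (B * ((4 * a + 32) / sqrt M)))) * / 2) by (unfold Rdiv; field; generalize (sqrt_ge_1 M HM); lra).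
  apply Rmult_le_compat; try apply Rabs_pos; [|rewrite Rabs_pos_eq; lra].
  apply RI_abs_const; [lra|cont|]. intros s Hss.
  rewrite <- Rmult_minus_distr_l, Rabs_mult. apply Rmult_le_compat; try apply Rabs_pos; [auto|].
  assert (K1 := RI_sg_clip f a B M (s + 1) Hf Ha HB HM Hb).
  assert (K2 := RI_sg_clip f a B M (s + -1) Hf Ha HB HM Hb).
  change (s - 1) with (s + -1).
  set (x1 := RI (fun t => f t * sg M (s + 1 - t)) (- a) a) in *. set (x2 := RI (fun t => f t * sg M (s + -1 - t)) (- a) a) in *.
  set (y1 := RI f (- a) (clip a (s + 1))) in *. set (y2 := RI f (- a) (clip a (s + -1))) in *.
  set (z := RI f (- a) a / 2) in *.
  replace (x1 - x2 - (y1 - y2)) with ((x1 - (y1 - z)) + - (x2 - (y2 - z))) by ring.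
  eapply Rle_trans; [apply Rabs_triang|]. rewrite Rabs_Ropp. lra.
Qed.

Lemma cont_bounded f a b : cont f -> a <= b -> exists B, 0 <= B /\ forall t, a <= t <= b -> Rabs (f t) <= B.
Proof.
  intros Hf Hab. assert (Ha : cont (fun t => Rabs (f t))) by cont.
  destruct (continuity_ab_maj (fun t => Rabs (f t)) a b Hab) as [m [Hm _]].
  - intros c _; apply cont_pt; auto.
  - exists (Rabs (f m)); split; [apply Rabs_pos|auto].
Qed.

(** The absolute integral of [dk] is not bounded as [M] grows. Where [f] coincides with a [C^1]
    function [g], integration by parts in [s] replaces [dk] by its primitive [sg], and [Psi]
    converges uniformly to [F]. The pieces allow for the corners of the extremal functions. *)
Lemma hart_sqr_piece a f al be g dg : cont f -> 0 < a -> - a <= al -> al <= be -> be <= a ->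
  (forall x, is_derive g x (dg x)) -> cont dg -> (forall x, al < x < be -> f x = g x) ->
  tends (fun M => RI (fun s => f s * RI (fun t => f t * dk M (s - t)) (- a) a) al be) (RI (fun s => f s ^ 2) al be).
Proof.
  intros Hf Ha H1 H2 H3 Hg Cdg Efg.
  assert (Cg := cont_derive _ _ Hg).
  destruct (cont_bounded f (- a) a Hf ltac:(lra)) as [B [HB Hb]].
  set (D := Rabs (g be) + Rabs (g al) + RI (fun x => Rabs (dg x)) al be).
  exists (D * (B * (4 * a + 32))).
  assert (HD0 : 0 <= RI (fun x => Rabs (dg x)) al be) by (apply RI_ge0; [lra|cont|intros; apply Rabs_pos]).
  assert (HD : 0 <= D) by (unfold D; generalize (Rabs_pos (g be)) (Rabs_pos (g al)); lra).
  split; [apply Rmult_le_pos; auto; apply Rmult_le_pos; lra|].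
  intros M HM. assert (Csg := cont_sg M). assert (Cdk := cont_dk M).
  set (Psi := fun s => RI (fun t => f t * sg M (s - t)) (- a) a).
  set (F := fun s => RI f (- a) s - RI f (- a) a / 2).
  assert (CPsi : cont Psi) by (apply (cont_RI_param (fun t s => f t * sg M (s - t))); cont2).
  assert (CdPsi : cont (fun s => RI (fun t => f t * dk M (s - t)) (- a) a)) by (apply (cont_RI_param (fun t s => f t * dk M (s - t))); cont2).
  assert (D1 : forall s t, is_derive (fun s => f t * sg M (s - t)) s (f t * dk M (s - t))).
  { intros s t. apply (is_derive_scal (fun s => sg M (s - t))).
    replace (dk M (s - t)) with (scal 1 (dk M (s - t))) by (unfold scal; simpl; unfold mult; simpl; ring).
    apply (is_derive_comp (sg M) (fun s => s - t)); [apply is_derive_sg|]. auto_derive; auto; ring. }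
  assert (DPsi : forall s, is_derive Psi s (RI (fun t => f t * dk M (s - t)) (- a) a)).
  { intros s. unfold Psi.
    rewrite (RI_ext (fun t => f t * dk M (s - t)) (fun t => Derive (fun s => f t * sg M (s - t)) s)) by
      (intros; symmetry; apply is_derive_unique, D1).
    apply (is_derive_RInt_param (fun s t => f t * sg M (s - t)) (- a) a s).
    - apply filter_forall; intros x t _. eexists; apply D1.
    - intros t _. apply (continuity_2d_pt_ext (fun x t => f t * dk M (x - t))).
      + intros x y; symmetry; apply is_derive_unique, D1.
      + assert (K : cont2 (fun x t => f t * dk M (x - t))) by cont2. apply K.
    - apply filter_forall; intros x. apply cont_ex_RInt. cont. }
  assert (CF : cont F) by (unfold F; apply cont_minus; [apply cont_RI; auto|cont]).
  assert (DF : forall s, is_derive F s (f s)).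
  { intros s. unfold F. replace (f s) with (minus (f s) 0) by (unfold minus, plus, opp; simpl; ring).
    apply (is_derive_minus (fun s => RI f (- a) s) (fun _ => RI f (- a) a / 2)); [apply is_derive_RI; auto|apply (is_derive_const (RI f (- a) a / 2) s)]. }
  rewrite (RI_ext_le (fun s => f s * RI _ _ _) (fun s => g s * RI (fun t => f t * dk M (s - t)) (- a) a) al be) by
    (try lra; intros; rewrite Efg by lra; auto).
  rewrite (RI_ext_le (fun s => f s ^ 2) (fun s => g s * f s) al be) by
    (try lra; intros; rewrite <- Efg by lra; ring).
  rewrite (RI_by_parts g Psi dg), (RI_by_parts g F dg f) by auto.
  assert (K : forall s, - a <= s <= a -> Rabs (Psi s - F s) <= B * ((4 * a + 32) / sqrt M)).
  { intros s Hs. assert (K := RI_sg_clip f a B M s Hf Ha HB HM Hb). rewrite clip_mid in K by auto. exact K. }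
  set (E := B * ((4 * a + 32) / sqrt M)) in *.
  replace (D * (B * (4 * a + 32)) / sqrt M) with (D * E) by (unfold E, Rdiv; ring).
  replace (_ - _ - _ - _) with (g be * (Psi be - F be) + - (g al * (Psi al - F al)) + - (RI (fun x => dg x * Psi x) al be - RI (fun x => dg x * F x) al be)) by ring.
  rewrite <- RI_minus by cont.
  eapply Rle_trans; [apply Rabs_triang|]. unfold D. rewrite 2!Rmult_plus_distr_r. apply Rplus_le_compat.
  - eapply Rle_trans; [apply Rabs_triang|]. rewrite Rabs_Ropp, !Rabs_mult.
    apply Rplus_le_compat; (apply Rmult_le_compat_l; [apply Rabs_pos|apply K; lra]).
  - rewrite Rabs_Ropp, Rmult_comm, <- RI_scal by cont. apply RI_abs; [lra|cont|cont|].
    intros x Hx. rewrite <- Rmult_minus_distr_l, Rabs_mult, Rmult_comm. apply Rmult_le_compat_r; [apply Rabs_pos|apply K; lra].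
Qed.

Lemma hart_sqr_dk a f M : cont f ->
  RI (fun x => hart a f x ^ 2) (- M) M = RI (fun s => f s * RI (fun t => f t * dk M (s - t)) (- a) a) (- a) a.
Proof.
  intros Hf. rewrite (RI_ext _ (fun x => hart a f x ^ 2 * 1)) by (intros; ring).
  rewrite (RI_hart_sqr a f (fun _ => 1)); auto using cont_const.
  apply RI_ext; intros s; f_equal; apply RI_ext; intros t; f_equal.
  rewrite <- RI_cos_dk. apply RI_ext; intros; ring.
Qed.

(** * Inversion *)

(* The factor [1] makes [rb] an instance of [RI_inv_1p_sqr]. *)
Definition rb (x : R) : R := / (1 + (1 * x) ^ 2).

Lemma cont_rb : cont rb.
Proof. apply cont_inv_1p_sqr. Qed.

Lemma rb_pos x : 0 < rb x <= 1.
Proof.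
  unfold rb. assert (0 <= (1 * x) ^ 2) by apply pow2_ge_0. split; [apply Rinv_0_lt_compat; lra|].
  rewrite <- Rinv_1. apply Rinv_le_contravar; lra.
Qed.

Lemma RI_rb_tail M0 M : 0 < M0 <= M -> RI rb M0 M <= / M0.
Proof.
  intros H. unfold rb; rewrite RI_inv_1p_sqr by lra. rewrite !Rmult_1_l.
  assert (0 < / M0) by (apply Rinv_0_lt_compat; lra).
  assert (K := atan_le (/ M0) ltac:(lra)). rewrite atan_inv in K by lra.
  generalize (atan_bound M); lra.
Qed.

Lemma RI_tail phi C M0 M : cont phi -> 0 < M0 <= M -> (forall x, M0 <= Rabs x -> Rabs (phi x) <= C * rb x) -> 0 <= C ->
  Rabs (RI phi (- M) M - RI phi (- M0) M0) <= 2 * C / M0.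
Proof.
  intros Hp HM Hb HC. assert (Hr := cont_rb).
  rewrite <- (RI_Chasles phi (- M) (- M0) M), <- (RI_Chasles phi (- M0) M0 M) by auto.
  replace (_ + _ - _) with (RI phi (- M) (- M0) + RI phi M0 M) by ring.
  rewrite <- RI_neg by auto.
  assert (T := RI_rb_tail M0 M HM). apply Rmult_le_compat_l with (r := C) in T; auto. rewrite <- RI_scal in T by auto.
  assert (K1 : Rabs (RI (fun x => phi (- x)) M0 M) <= RI (fun x => C * rb x) M0 M).
  { apply RI_abs; [lra|cont|cont|]. intros x Hx.
    replace (rb x) with (rb (- x)) by (unfold rb; do 2 f_equal; ring).
    apply Hb. rewrite Rabs_Ropp, Rabs_pos_eq; lra. }
  assert (K2 : Rabs (RI phi M0 M) <= RI (fun x => C * rb x) M0 M).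
  { apply RI_abs; [lra|cont|cont|]. intros x Hx. apply Hb. rewrite Rabs_pos_eq; lra. }
  eapply Rle_trans; [apply Rabs_triang|]. unfold Rdiv. lra.
Qed.

(** The truncated transform. It converges uniformly in [t] as [M] grows when [u] is dominated by a
    multiple of [rb]. *)
Definition ctr (u : R -> R) (M t : R) : R := RI (fun x => u x * cas (2 * PI * x * t)) (- M) M.

Lemma cont_ctr u M : cont u -> cont (ctr u M).
Proof.
  intros Hu. assert (H := cont_cas). unfold ctr. apply (cont_RI_param (fun x t => u x * cas (2 * PI * x * t))). cont2.
Qed.

Lemma mul_cas_bound u C x y : Rabs (u x) <= C * rb x -> Rabs (u x * cas y) <= 2 * C * rb x.
Proof.
  intros H. rewrite Rabs_mult. assert (K := cas_bound y). assert (K2 := Rabs_pos (u x)). assert (K3 := Rabs_pos (cas y)). nra.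
Qed.

Lemma ctr_cauchy u C t M0 M : cont u -> 0 <= C -> (forall x, Rabs (u x) <= C * rb x) -> 0 < M0 <= M ->
  Rabs (ctr u M t - ctr u M0 t) <= 4 * C / M0.
Proof.
  intros Hu HC Hb HM. assert (H := cont_cas). replace (4 * C) with (2 * (2 * C)) by ring.
  apply (RI_tail (fun x => u x * cas (2 * PI * x * t)) (2 * C)); auto; [cont| |lra].
  intros x _; apply mul_cas_bound; auto.
Qed.

(** The limit runs along integers and [real] discards infinite values; that it exists and controls
    every real cut-off is the content of [htr_spec]. *)
Definition htr (u : R -> R) (t : R) : R := real (Lim_seq (fun n => ctr u (INR n) t)).

Lemma htr_spec u C t M : cont u -> 0 <= C -> (forall x, Rabs (u x) <= C * rb x) -> 0 < M ->
  Rabs (htr u t - ctr u M t) <= 4 * C / M.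
Proof.
  intros Hu HC Hb HM.
  assert (Hex : ex_finite_lim_seq (fun n => ctr u (INR n) t)).
  { apply ex_lim_seq_cauchy_corr. intros eps.
    destruct (nfloor_ex (8 * C / eps)) as [N [_ HN]].
    { apply Rdiv_le_0_compat; [lra|apply cond_pos]. }
    exists (S N).
    assert (W : forall n m, (S N <= n)%nat -> (n <= m)%nat -> Rabs (ctr u (INR m) t - ctr u (INR n) t) < eps).
    { intros n m Hn Hm. apply le_INR in Hn. apply le_INR in Hm. rewrite S_INR in Hn.
      assert (Hp := pos_INR N).
      eapply Rle_lt_trans; [apply ctr_cauchy with (C := C); auto; lra|].
      apply Rlt_div_l; [lra|]. assert (8 * C < INR n * eps).
      { apply Rlt_div_l; [apply cond_pos|]. lra. }
      assert (0 < eps * INR n) by (apply Rmult_lt_0_compat; [apply cond_pos|lra]).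
      lra. }
    intros n m Hn Hm. destruct (Nat.le_ge_cases n m).
    - rewrite Rabs_minus_sym; apply W; auto.
    - apply W; auto. }
  assert (Hl := Lim_seq_correct' _ Hex). fold (htr u t) in Hl.
  apply le_epsilon; intros eps He.
  apply is_lim_seq_spec in Hl. destruct (Hl (mkposreal eps He)) as [N HN].
  destruct (nfloor_ex M ltac:(lra)) as [K [_ HK]].
  set (n := Nat.max N (S K)). specialize (HN n ltac:(unfold n; lia)). simpl in HN.
  assert (Hn : M <= INR n).
  { apply Rle_trans with (INR (S K)); [rewrite S_INR; lra|apply le_INR; unfold n; lia]. }
  assert (Hc := ctr_cauchy u C t M (INR n) Hu HC Hb ltac:(lra)).
  replace (htr u t - ctr u M t) with (- (ctr u (INR n) t - htr u t) + (ctr u (INR n) t - ctr u M t)) by ring.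
  eapply Rle_trans; [apply Rabs_triang|]. rewrite Rabs_Ropp. lra.
Qed.

(** The error [4 * C / M] in [htr_spec] does not depend on [t], so this is a uniform limit of
    continuous functions. It is the reason for seeking decay [O(1/x^2)] on the line. *)
Lemma cont_htr u C : cont u -> 0 <= C -> (forall x, Rabs (u x) <= C * rb x) -> cont (htr u).
Proof.
  intros Hu HC Hb. apply cont_of_pt; intros t eps He.
  set (M := 16 * C / eps + 1). assert (HM : 0 < M).
  { unfold M. assert (0 <= 16 * C / eps) by (apply Rdiv_le_0_compat; lra). lra. }
  assert (HM2 : 4 * C / M <= eps / 4).
  { apply Rle_div_l; auto. unfold M. replace (eps / 4 * (16 * C / eps + 1)) with (4 * C + eps / 4) by (field; lra). lra. }
  destruct (cont_pt _ (cont_ctr u M Hu) t (eps / 4) ltac:(lra)) as [d [Hd H]].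
  exists d; split; auto. intros x Hx. specialize (H x Hx). simpl in *; unfold R_dist in *.
  assert (H1 := htr_spec u C t M Hu HC Hb HM). assert (H2 := htr_spec u C x M Hu HC Hb HM).
  apply Rabs_def2 in H. apply Rabs_le_between in H1. apply Rabs_le_between in H2. apply Rabs_def1; lra.
Qed.

Lemma dk_bound R0 v : 1 <= Rabs v -> Rabs (dk R0 v) <= 1.
Proof.
  intros Hv. assert (HP : 1 < PI) by (generalize PI2_3_2; lra).
  assert (E : PI * v * dk R0 v = sin (2 * PI * R0 * v)) by (rewrite <- snc_mul; unfold dk; ring).
  assert (Hs : Rabs (PI * v * dk R0 v) <= 1) by (rewrite E; apply Rabs_le, SIN_bound).
  rewrite !Rabs_mult, (Rabs_pos_eq PI) in Hs by lra.
  assert (H := Rabs_pos (dk R0 v)). assert (1 <= PI * Rabs v) by nra. nra.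
Qed.

Lemma sg_err_far R0 v : 1 <= R0 -> 1 <= Rabs v -> sg_err R0 v <= 6 / sqrt R0.
Proof.
  intros HR Hv. unfold sg_err. assert (Hs := sqrt_ge_1 R0 HR). set (s := sqrt R0) in *.
  assert (E : R0 = s * s) by (symmetry; apply sqrt_sqrt; lra).
  assert (Hv2 : 1 <= v ^ 2) by (rewrite <- (pow2_abs v); nra).
  assert (Hd : s * s * s * s <= 1 + (R0 * v) ^ 2).
  { rewrite E. replace ((s * s * v) ^ 2) with (s * s * s * s * v ^ 2) by ring.
    assert (0 <= s * s * s * s) by nra. nra. }
  assert (Hss : 1 <= s * s) by nra. assert (Hd1 : 1 <= s * s * s * s) by nra.
  assert (K : (1 + s) * / (1 + (R0 * v) ^ 2) <= 2 / s).
  { apply Rle_div_l; [lra|]. unfold Rdiv. rewrite Rmult_assoc, (Rmult_comm (/ s)), <- Rmult_assoc.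
    apply Rle_div_r; [lra|]. nra. }
  unfold Rdiv in *. lra.
Qed.

(** Integration by parts turns the kernel into [sg]. The boundary terms tend to
    [(u M + u (- M)) / 2], since both ends are at distance at least 1 from [y]; the integral
    contributes half the increments on the two sides of [y], and together they give [u y]. *)
Lemma RI_dk_lim u du y M : cont du -> (forall x, is_derive u x (du x)) -> Rabs y + 1 <= M ->
  exists C, 0 <= C /\ forall R0, 1 <= R0 -> Rabs (RI (fun x => u x * dk R0 (x - y)) (- M) M - u y) <= C / sqrt R0.
Proof.
  intros Hdu Hu Hy. assert (Cu := cont_derive _ _ Hu).
  assert (Hy1 := Rle_abs y). assert (Hy2 := Rle_abs (- y)). rewrite Rabs_Ropp in Hy2.
  assert (Hy3 := Rabs_pos y).
  destruct (cont_bounded du (- M) M Hdu ltac:(lra)) as [B [HB Hb]].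
  exists (6 * Rabs (u M) + 6 * Rabs (u (- M)) + B * (4 * M + 32)). split.
  { generalize (Rabs_pos (u M)) (Rabs_pos (u (- M))); intros. assert (0 <= B * (4 * M + 32)) by (apply Rmult_le_pos; lra). lra. }
  intros R0 HR. assert (Cs := cont_sg R0). assert (Ck := cont_dk R0).
  rewrite (RI_by_parts u (fun x => sg R0 (x - y)) du (fun x => dk R0 (x - y))); [|auto| |auto|cont].
  2:{ intros x. replace (dk R0 (x - y)) with (scal 1 (dk R0 (x - y))) by (unfold scal; simpl; unfold mult; simpl; ring).
      apply (is_derive_comp (sg R0) (fun s => s - y)); [apply is_derive_sg|]. auto_derive; auto; ring. }
  rewrite (RI_ext (fun x => du x * sg R0 (x - y)) (fun x => - (du x * sg R0 (y - x)))).
  2:{ intros x. replace (x - y) with (- (y - x)) by ring. rewrite sg_odd; ring. }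
  rewrite RI_opp by cont.
  assert (K := RI_sg_lim du B R0 (- M) M y y Hdu HR ltac:(lra) HB Hb ltac:(lra) ltac:(lra)).
  rewrite (RI_FTC u du (- M) y), (RI_FTC u du y M) in K by auto.
  assert (K1 := sg_pos R0 (M - y) HR ltac:(lra)). assert (K2 := sg_neg R0 (- M - y) HR ltac:(lra)).
  assert (S1 := sg_err_far R0 (M - y) HR ltac:(rewrite Rabs_pos_eq; lra)).
  assert (S2 := sg_err_far R0 (- M - y) HR ltac:(rewrite <- Rabs_Ropp, Rabs_pos_eq; lra)).
  set (I := RI (fun x => du x * sg R0 (y - x)) (- M) M) in *.
  replace (u M * sg R0 (M - y) - u (- M) * sg R0 (- M - y) - - I - u y) with
    (u M * (sg R0 (M - y) - 1 / 2) + - (u (- M) * (sg R0 (- M - y) + 1 / 2))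
     + (I - (u y - u (- M) - (u M - u y)) / 2)) by field.
  eapply Rle_trans; [apply Rabs_triang|].
  replace ((6 * Rabs (u M) + 6 * Rabs (u (- M)) + B * (4 * M + 32)) / sqrt R0) with
    (Rabs (u M) * (6 / sqrt R0) + Rabs (u (- M)) * (6 / sqrt R0) + B * ((2 * (M - - M) + 32) / sqrt R0)) by (unfold Rdiv; ring).
  apply Rplus_le_compat; [|exact K].
  eapply Rle_trans; [apply Rabs_triang|]. rewrite Rabs_Ropp, !Rabs_mult.
  apply Rplus_le_compat; (apply Rmult_le_compat_l; [apply Rabs_pos|lra]).
Qed.

Lemma RI_ctr_cas u R0 M y : cont u ->
  RI (fun t => ctr u M t * cas (2 * PI * y * t)) (- R0) R0 = RI (fun x => u x * dk R0 (x - y)) (- M) M.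
Proof.
  intros Hu. assert (Hc := cont_cas).
  transitivity (RI (fun t => RI (fun x => u x * cas (2 * PI * x * t) * cas (2 * PI * y * t)) (- M) M) (- R0) R0).
  { apply RI_ext; intros t. unfold ctr. rewrite Rmult_comm, <- RI_scal by cont. apply RI_ext; intros; ring. }
  rewrite (RI_Fubini (fun t x => u x * cas (2 * PI * x * t) * cas (2 * PI * y * t))) by cont2.
  apply RI_ext; intros x.
  rewrite (RI_ext _ (fun t => u x * (1 * (cas (2 * PI * t * x) * cas (2 * PI * t * y))))).
  2:{ intros t. replace (2 * PI * x * t) with (2 * PI * t * x) by ring. replace (2 * PI * y * t) with (2 * PI * t * y) by ring. ring. }
  rewrite RI_scal by cont. f_equal.
  rewrite (RI_cas_cas (fun _ => 1)) by (auto; cont). rewrite <- RI_cos_dk. apply RI_ext; intros; ring.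
Qed.

(** Three limits in this order: the truncation [M] at fixed [R0], where the tail beyond [M0] is
    uniform in [R0] because [dk] is bounded by 1 away from [y]; then [R0] at fixed [M0]; finally
    [M0]. The integral over [[-R0, R0]] equals the one over [[-a, a]] since the transform vanishes
    beyond [a]. *)
Lemma htr_inversion u du a C : cont du -> (forall x, is_derive u x (du x)) -> 0 < a -> 0 <= C ->
  (forall x, Rabs (u x) <= C * rb x) -> (forall t, a < Rabs t -> htr u t = 0) ->
  forall y, hart a (htr u) y = u y.
Proof.
  intros Hdu Hu Ha HC Hb Hv y. assert (Cu := cont_derive _ _ Hu).
  assert (Cf := cont_htr u C Cu HC Hb). assert (Cc := cont_cas).
  set (f := htr u) in *.
  assert (Hy := Rabs_pos y).
  assert (Ext : forall R0, a <= R0 -> RI (fun t => f t * cas (2 * PI * y * t)) (- R0) R0 = hart a f y).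
  { intros R0 HR. unfold hart.
    assert (Cg : cont (fun t => f t * cas (2 * PI * y * t))) by cont.
    rewrite <- (RI_Chasles _ (- R0) (- a) R0), <- (RI_Chasles _ (- a) a R0) by auto.
    rewrite (RI_ext_le _ (fun _ => 0) (- R0) (- a)); [|lra|].
    2:{ intros t Ht. rewrite Hv; [ring|]. rewrite <- Rabs_Ropp, Rabs_pos_eq; lra. }
    rewrite (RI_ext_le _ (fun _ => 0) a R0); [|lra|].
    2:{ intros t Ht. rewrite Hv; [ring|]. rewrite Rabs_pos_eq; lra. }
    rewrite !RI_const. ring. }
  assert (Step : forall M0 R0, Rabs y + 1 <= M0 -> a <= R0 ->
    Rabs (hart a f y - RI (fun x => u x * dk R0 (x - y)) (- M0) M0) <= 2 * C / M0).
  { intros M0 R0 HM0 HR. assert (Ck := cont_dk R0).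
    apply (le_of_le_inv _ _ (2 * R0 * (4 * C * 2))); [repeat apply Rmult_le_pos; lra|].
    intros P HP. set (M := Rmax P M0).
    assert (HM : P <= M) by apply Rmax_l. assert (HM' : M0 <= M) by apply Rmax_r.
    rewrite <- (Ext R0 HR).
    assert (T := RI_tail (fun x => u x * dk R0 (x - y)) C M0 M ltac:(cont) ltac:(lra)).
    rewrite <- (RI_ctr_cas u R0 M y Cu) in T.
    assert (Cct := cont_ctr u M Cu).
    assert (Q : Rabs (RI (fun t => f t * cas (2 * PI * y * t)) (- R0) R0 - RI (fun t => ctr u M t * cas (2 * PI * y * t)) (- R0) R0)
       <= (R0 - - R0) * (4 * C / M * 2)).
    { rewrite <- RI_minus by cont. apply RI_abs_const; [lra|cont|]. intros t _.
      rewrite <- Rmult_minus_distr_r, Rabs_mult. apply Rmult_le_compat; try apply Rabs_pos; [|apply cas_bound].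
      apply htr_spec; auto. lra. }
    assert (Q2 : (R0 - - R0) * (4 * C / M * 2) <= 2 * R0 * (4 * C * 2) / P).
    { replace ((R0 - - R0) * (4 * C / M * 2)) with (2 * R0 * (4 * C * 2) / M) by (unfold Rdiv; ring).
      apply Rmult_le_compat_l; [repeat apply Rmult_le_pos; lra|]. apply Rinv_le_contravar; lra. }
    assert (T' := T ltac:(intros x Hx; rewrite Rabs_mult; apply Rle_trans with (Rabs (u x) * 1);
      [apply Rmult_le_compat_l; [apply Rabs_pos|apply dk_bound]|rewrite Rmult_1_r; auto];
      assert (Ht := Rabs_triang_inv x y); lra) HC).
    set (X := RI (fun t => f t * cas (2 * PI * y * t)) (- R0) R0) in *.
    set (Y := RI (fun t => ctr u M t * cas (2 * PI * y * t)) (- R0) R0) in *.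
    set (Z := RI (fun x => u x * dk R0 (x - y)) (- M0) M0) in *.
    replace (X - Z) with ((X - Y) + (Y - Z)) by ring.
    eapply Rle_trans; [apply Rabs_triang|]. lra. }
  assert (Z : Rabs (hart a f y - u y) <= 0).
  { apply (le_of_le_inv _ _ (2 * C)); [lra|]. intros P HP. rewrite Rplus_0_l.
    set (M0 := Rmax P (Rabs y + 1)). assert (HM : P <= M0) by apply Rmax_l. assert (HM' : Rabs y + 1 <= M0) by apply Rmax_r.
    apply Rle_trans with (2 * C / M0).
    2:{ apply Rmult_le_compat_l; [lra|]. apply Rinv_le_contravar; lra. }
    destruct (RI_dk_lim u du y M0 Hdu Hu HM') as [D [HD Hlim]].
    apply (le_of_le_inv_sqrt _ _ D); auto. intros Q HQ.
    set (R0 := Rmax Q a). assert (HR : Q <= R0) by apply Rmax_l. assert (HR' : a <= R0) by apply Rmax_r.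
    specialize (Hlim R0 ltac:(lra)). specialize (Step M0 R0 HM' HR').
    assert (D / sqrt R0 <= D / sqrt Q).
    { apply Rmult_le_compat_l; auto. apply Rinv_le_contravar; [apply sqrt_lt_R0; lra|apply sqrt_le_1_alt; auto]. }
    replace (hart a f y - u y) with ((hart a f y - RI (fun x => u x * dk R0 (x - y)) (- M0) M0)
       + (RI (fun x => u x * dk R0 (x - y)) (- M0) M0 - u y)) by ring.
    eapply Rle_trans; [apply Rabs_triang|]. lra. }
  assert (Z' := Rabs_pos (hart a f y - u y)).
  destruct (Req_dec (hart a f y - u y) 0) as [E|E]; [lra|]. apply Rabs_pos_lt in E. lra.
Qed.

(** With [f = htr u], Parseval costs only Fubini: the integral of [u^2] over [[-M, M]] is that of
    [f] times [ctr u M], which converges uniformly to [f]. The second limit is [hart_snc_lim] read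
    through the inversion formula. *)
Lemma htr_parseval u du a C : cont du -> (forall x, is_derive u x (du x)) -> 0 < a -> 0 <= C ->
  (forall x, Rabs (u x) <= C * rb x) -> (forall t, a < Rabs t -> htr u t = 0) ->
  exists f, cont f /\ u 0 = RI f (- a) a
    /\ tends (fun M => RI (fun x => u x ^ 2) (- M) M) (RI (fun t => f t ^ 2) (- a) a)
    /\ tends (fun M => RI (fun x => u x ^ 2 * snc (2 * PI * x)) (- M) M) (u 0 ^ 2 - qform a f).
Proof.
  intros Hdu Hu Ha HC Hb Hv. assert (Cu := cont_derive _ _ Hu).
  assert (Cf := cont_htr u C Cu HC Hb). assert (Cc := cont_cas).
  assert (Hinv := htr_inversion u du a C Hdu Hu Ha HC Hb Hv).
  set (f := htr u) in *.
  destruct (cont_bounded f (- a) a Cf ltac:(lra)) as [B [HB HBf]].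
  assert (E0 : u 0 = RI f (- a) a) by (rewrite <- hart_0; auto).
  exists f; split; [auto|split; [auto|split]].
  - exists ((a - - a) * (B * (4 * C))). split; [repeat apply Rmult_le_pos; lra|]. intros M HM.
    assert (Cct := cont_ctr u M Cu).
    replace (RI (fun x => u x ^ 2) (- M) M) with (RI (fun t => f t * ctr u M t) (- a) a).
    + rewrite <- RI_minus by cont.
      apply Rle_trans with ((a - - a) * (B * (4 * C / M))).
      * apply RI_abs_const; [lra|cont|]. intros t Ht.
        replace (f t * ctr u M t - f t ^ 2) with (f t * - (f t - ctr u M t)) by ring.
        rewrite Rabs_mult, Rabs_Ropp. apply Rmult_le_compat; try apply Rabs_pos; auto. apply htr_spec; auto; lra.
      * replace ((a - - a) * (B * (4 * C / M))) with ((a - - a) * (B * (4 * C)) / M) by (unfold Rdiv; ring).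
        apply inv_le_inv_sqrt; auto. repeat apply Rmult_le_pos; lra.
    + transitivity (RI (fun t => RI (fun x => u x * (f t * cas (2 * PI * x * t))) (- M) M) (- a) a).
      { apply RI_ext; intros t. unfold ctr. rewrite <- RI_scal by cont. apply RI_ext; intros; ring. }
      rewrite (RI_Fubini (fun t x => u x * (f t * cas (2 * PI * x * t)))) by cont2.
      apply RI_ext; intros x. rewrite RI_scal by cont. fold (hart a f x). rewrite Hinv; ring.
  - unfold qform. rewrite E0.
    replace (_ - (_ - _)) with (RI (fun s => f s * (RI f (- a) (clip a (s + 1)) - RI f (- a) (clip a (s - 1)))) (- a) a / 2) by ring.
    eapply tends_ext; [|apply (hart_snc_lim a f B); auto].
    intros M _. apply RI_ext; intros x. cbv beta. rewrite Hinv; auto.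
Qed.

(** * Goursat's theorem and primitives *)

(* The pair [(U, V)] is complex differentiable at [(x, y)] with derivative [p + i q]. *)
Definition cdiff2 (U V : R -> R -> R) (x y p q : R) : Prop :=
  forall eps, 0 < eps -> exists d, 0 < d /\ forall h k, Rabs h < d -> Rabs k < d ->
    Rabs (U (x + h) (y + k) - U x y - (p * h - q * k)) <= eps * (Rabs h + Rabs k) /\
    Rabs (V (x + h) (y + k) - V x y - (q * h + p * k)) <= eps * (Rabs h + Rabs k).

Definition hol (U V : R -> R -> R) : Prop := forall x y, exists p q, cdiff2 U V x y p q.

(** Multiplication by [-i]. Every statement about the first component then yields one about the
    second. *)
Lemma hol_rot U V : hol U V -> hol V (fun x y => - U x y).
Proof.
  intros H x y. destruct (H x y) as [p [q K]]. exists q, (- p). intros eps He.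
  destruct (K eps He) as [d [Hd Kd]]. exists d; split; auto. intros h k Hh Hk.
  destruct (Kd h k Hh Hk) as [K1 K2]; split.
  - replace (q * h - - p * k) with (q * h + p * k) by ring; auto.
  - rewrite <- Rabs_Ropp. replace (- (- U (x + h) (y + k) - - U x y - (- p * h + q * k)))
      with (U (x + h) (y + k) - U x y - (p * h - q * k)) by ring; auto.
Qed.

Lemma hol_cont2 U V : hol U V -> cont2 U.
Proof.
  intros H x y eps. destruct (H x y) as [p [q K]]. destruct (K 1 Rlt_0_1) as [d [Hd Kd]].
  set (m := Rabs p + Rabs q + 2).
  assert (Hm : 0 < m) by (unfold m; generalize (Rabs_pos p) (Rabs_pos q); lra).
  assert (Hem : 0 < eps / (2 * m)) by (apply Rdiv_lt_0_compat; [apply cond_pos|lra]).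
  assert (Hmin : 0 < Rmin d (eps / (2 * m))) by (apply Rmin_glb_lt; auto).
  exists (mkposreal _ Hmin). intros u v Hu Hv. simpl in Hu, Hv.
  assert (Hu1 := Rlt_le_trans _ _ _ Hu (Rmin_l _ _)). assert (Hu2 := Rlt_le_trans _ _ _ Hu (Rmin_r _ _)).
  assert (Hv1 := Rlt_le_trans _ _ _ Hv (Rmin_l _ _)). assert (Hv2 := Rlt_le_trans _ _ _ Hv (Rmin_r _ _)).
  destruct (Kd (u - x) (v - y) Hu1 Hv1) as [K1 _].
  replace (x + (u - x)) with u in K1 by ring. replace (y + (v - y)) with v in K1 by ring.
  replace (U u v - U x y) with ((U u v - U x y - (p * (u - x) - q * (v - y))) + p * (u - x) + - (q * (v - y))) by ring.
  eapply Rle_lt_trans; [apply Rabs_triang|]. eapply Rle_lt_trans; [apply Rplus_le_compat_r, Rabs_triang|].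
  rewrite Rabs_Ropp, !Rabs_mult.
  set (a := Rabs (u - x)) in *. set (b := Rabs (v - y)) in *.
  assert (Ha : a * (2 * m) < eps) by (apply Rlt_div_r in Hu2; auto; lra).
  assert (Hb : b * (2 * m) < eps) by (apply Rlt_div_r in Hv2; auto; lra).
  assert (0 <= a) by apply Rabs_pos. assert (0 <= b) by apply Rabs_pos.
  assert (0 <= Rabs p) by apply Rabs_pos. assert (0 <= Rabs q) by apply Rabs_pos.
  unfold m in *. nra.
Qed.

(** The real part of the counterclockwise contour integral of [U + i V]; the imaginary part is the
    same expression for the pair of [hol_rot]. *)
Definition rect (U V : R -> R -> R) (x1 x2 y1 y2 : R) : R :=
  RI (fun x => U x y1 - U x y2) x1 x2 - RI (fun y => V x2 y - V x1 y) y1 y2.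

Lemma rect_split U V x y w h : cont2 U -> cont2 V ->
  rect U V x (x + w) y (y + h) =
    rect U V x (x + w / 2) y (y + h / 2) + rect U V (x + w / 2) (x + w / 2 + w / 2) y (y + h / 2)
    + rect U V x (x + w / 2) (y + h / 2) (y + h / 2 + h / 2)
    + rect U V (x + w / 2) (x + w / 2 + w / 2) (y + h / 2) (y + h / 2 + h / 2).
Proof.
  intros HU HV. unfold rect.
  assert (CU : forall y, cont (fun x => U x y)) by (intros; apply cont2_slice1; auto).
  assert (CV : forall x, cont (fun y => V x y)) by (intros; apply cont2_slice2; auto).
  rewrite !RI_minus by auto.
  replace (x + w / 2 + w / 2) with (x + w) by field. replace (y + h / 2 + h / 2) with (y + h) by field.
  rewrite <- (RI_Chasles (fun s => U s y) x (x + w / 2) (x + w)), <- (RI_Chasles (fun s => U s (y + h)) x (x + w / 2) (x + w)) by auto.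
  rewrite <- (RI_Chasles (V x) y (y + h / 2) (y + h)), <- (RI_Chasles (V (x + w)) y (y + h / 2) (y + h)) by auto.
  ring.
Qed.

(** Bisection for an arbitrary property, used both for Goursat's theorem and to find maxima on
    rectangles. *)
Lemma quarter_nest (Bad : R -> R -> R -> R -> Prop) x0 y0 w0 h0 : 0 <= w0 -> 0 <= h0 ->
  (forall x y w h, Bad x y w h -> Bad x y (w / 2) (h / 2) \/ Bad (x + w / 2) y (w / 2) (h / 2)
     \/ Bad x (y + h / 2) (w / 2) (h / 2) \/ Bad (x + w / 2) (y + h / 2) (w / 2) (h / 2)) ->
  Bad x0 y0 w0 h0 ->
  exists u v, forall n, exists x y, Bad x y (w0 / 2 ^ n) (h0 / 2 ^ n)
     /\ x <= u <= x + w0 / 2 ^ n /\ y <= v <= y + h0 / 2 ^ n.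
Proof.
  intros Hw Hh Hstep H0.
  assert (Epow : forall c n, c / 2 ^ S n = c / 2 ^ n / 2) by (intros; simpl; field; apply pow_nonzero; lra).
  assert (Pos : forall c n, 0 <= c -> 0 <= c / 2 ^ n) by (intros; apply Rdiv_le_0_compat; auto; apply pow_lt; lra).
  set (Nx := fun n (s t : R * R) => Bad (fst t) (snd t) (w0 / 2 ^ S n) (h0 / 2 ^ S n)
     /\ fst s <= fst t <= fst s + w0 / 2 ^ S n /\ snd s <= snd t <= snd s + h0 / 2 ^ S n).
  (* The next quarter is picked by choice. The coordinates of its lower left corner only grow, so
     they converge, and the limit lies in all the rectangles. *)
  set (z := fix z (n : nat) : R * R := match n with O => (x0, y0) | S m => epsilon (inhabits (0, 0)) (Nx m (z m)) end).
  assert (Hz : forall n, Bad (fst (z n)) (snd (z n)) (w0 / 2 ^ n) (h0 / 2 ^ n) /\ Nx n (z n) (z (S n))).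
  { assert (S1 : forall n, Bad (fst (z n)) (snd (z n)) (w0 / 2 ^ n) (h0 / 2 ^ n) -> Nx n (z n) (z (S n))).
    { intros n Hn. unfold z; fold z. apply epsilon_spec. unfold Nx. rewrite !Epow.
      assert (Pw := Pos w0 n Hw). assert (Ph := Pos h0 n Hh).
      destruct (z n) as [x y]; simpl in *.
      destruct (Hstep _ _ _ _ Hn) as [K|[K|[K|K]]];
      [exists (x, y)|exists (x + w0 / 2 ^ n / 2, y)|exists (x, y + h0 / 2 ^ n / 2)|exists (x + w0 / 2 ^ n / 2, y + h0 / 2 ^ n / 2)];
      simpl; (split; [exact K|lra]). }
    induction n as [|n [IH1 IH2]].
    - assert (B0 : Bad (fst (z 0%nat)) (snd (z 0%nat)) (w0 / 2 ^ 0) (h0 / 2 ^ 0)).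
      { simpl. rewrite !Rdiv_1_r. auto. }
      split; auto.
    - assert (B1 := proj1 IH2). split; auto. }
  assert (Lim : forall (g : nat -> R) w, 0 <= w -> (forall n, g n <= g (S n) <= g n + w / 2 ^ S n) ->
     exists u, forall n, g n <= u <= g n + w / 2 ^ n).
  { intros g w Hw0 Hg.
    assert (Gr : Un_growing g) by (intros n; apply Hg).
    assert (Up : forall n m, g (n + m)%nat <= g n + w / 2 ^ n - w / 2 ^ (n + m)).
    { intros n; induction m as [|m IH]; [rewrite Nat.add_0_r; lra|].
      rewrite <- plus_n_Sm. generalize (Hg (n + m)%nat) (Epow w (n + m)%nat); lra. }
    assert (Up' : forall n m, g (n + m)%nat <= g n + w / 2 ^ n).
    { intros n m. generalize (Up n m) (Pos w (n + m)%nat Hw0); lra. }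
    destruct (growing_cv g Gr) as [u Hu].
    { exists (g 0%nat + w / 2 ^ 0). intros x [n ->]. apply (Up' 0%nat n). }
    exists u; intros n; split; [apply (growing_ineq g u Gr Hu)|].
    destruct (Rle_dec u (g n + w / 2 ^ n)) as [|K]; auto. exfalso.
    destruct (Hu (u - (g n + w / 2 ^ n)) ltac:(lra)) as [N HN].
    specialize (HN (n + N)%nat ltac:(lia)). unfold R_dist in HN.
    assert (K2 := Up' n N). rewrite <- Rabs_Ropp, Rabs_pos_eq in HN; lra. }
  destruct (Lim (fun n => fst (z n)) w0 Hw) as [u Hu].
  { intros n; destruct (Hz n) as [_ [_ [K _]]]; exact K. }
  destruct (Lim (fun n => snd (z n)) h0 Hh) as [v Hv].
  { intros n; destruct (Hz n) as [_ [_ [_ K]]]; exact K. }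
  exists u, v; intros n. exists (fst (z n)), (snd (z n)). split; [apply Hz|split; auto].
Qed.

(** The affine part contributes nothing to the contour integral; the remainder is at most
    [eps * (w + h)] on a boundary of length [2 * (w + h)]. *)
Lemma rect_local U V x y w h u v p q eps d : cont2 U -> cont2 V -> 0 <= w -> 0 <= h -> 0 < eps ->
  x <= u <= x + w -> y <= v <= y + h -> w < d -> h < d ->
  (forall h k, Rabs h < d -> Rabs k < d ->
    Rabs (U (u + h) (v + k) - U u v - (p * h - q * k)) <= eps * (Rabs h + Rabs k) /\
    Rabs (V (u + h) (v + k) - V u v - (q * h + p * k)) <= eps * (Rabs h + Rabs k)) ->
  Rabs (rect U V x (x + w) y (y + h)) <= 2 * eps * (w + h) ^ 2.
Proof.
  intros HU HV Hw Hh He Hu Hv Hwd Hhd K.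
  assert (CU : forall y, cont (fun x => U x y)) by (intros; apply cont2_slice1; auto).
  assert (CV : forall x, cont (fun y => V x y)) by (intros; apply cont2_slice2; auto).
  assert (EU : forall s t, x <= s <= x + w -> y <= t <= y + h ->
    Rabs (U s t - (U u v + p * (s - u) - q * (t - v))) <= eps * (w + h)
    /\ Rabs (V s t - (V u v + q * (s - u) + p * (t - v))) <= eps * (w + h)).
  { intros s t Hs Ht.
    assert (A1 : Rabs (s - u) <= w) by (apply Rabs_le; lra). assert (A2 : Rabs (t - v) <= h) by (apply Rabs_le; lra).
    destruct (K (s - u) (t - v) ltac:(lra) ltac:(lra)) as [K1 K2].
    replace (u + (s - u)) with s in * by ring. replace (v + (t - v)) with t in * by ring.
    assert (A3 : eps * (Rabs (s - u) + Rabs (t - v)) <= eps * (w + h)) by (apply Rmult_le_compat_l; lra).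
    split; eapply Rle_trans; try apply A3.
    - replace (U s t - (U u v + p * (s - u) - q * (t - v))) with (U s t - U u v - (p * (s - u) - q * (t - v))) by ring. auto.
    - replace (V s t - (V u v + q * (s - u) + p * (t - v))) with (V s t - V u v - (q * (s - u) + p * (t - v))) by ring. auto. }
  unfold rect.
  (* The constants [q * h] and [q * w] are the contributions of the affine part on the two pairs of
     sides; their integrals cancel. *)
  replace (_ - _) with (RI (fun s => U s y - U s (y + h) - q * h) x (x + w) - RI (fun t => V (x + w) t - V x t - q * w) y (y + h)).
  2:{ rewrite !(RI_minus (fun _ => _ - _)) by (cont; auto). rewrite !RI_const. ring. }
  eapply Rle_trans; [apply Rabs_triang|]. rewrite Rabs_Ropp.
  replace (2 * eps * (w + h) ^ 2) with ((x + w - x) * (2 * (eps * (w + h))) + (y + h - y) * (2 * (eps * (w + h)))) by ring.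
  apply Rplus_le_compat; (apply RI_abs_const; [lra|cont; auto|]).
  - intros s Hs. destruct (EU s y Hs ltac:(lra)) as [K1 _]. destruct (EU s (y + h) Hs ltac:(lra)) as [K2 _].
    apply Rabs_le_between in K1. apply Rabs_le_between in K2. apply Rabs_le; lra.
  - intros t Ht. destruct (EU x t ltac:(lra) Ht) as [_ K1]. destruct (EU (x + w) t ltac:(lra) Ht) as [_ K2].
    apply Rabs_le_between in K1. apply Rabs_le_between in K2. apply Rabs_le; lra.
Qed.

Lemma goursat_le U V x y w h : hol U V -> 0 <= w -> 0 <= h -> rect U V x (x + w) y (y + h) = 0.
Proof.
  intros H Hw Hh. assert (HU := hol_cont2 _ _ H). assert (HV := hol_cont2 _ _ (hol_rot _ _ H)).
  assert (W : forall eps, 0 < eps -> Rabs (rect U V x (x + w) y (y + h)) <= 2 * eps * (w + h) ^ 2).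
  { intros eps He. apply Rnot_lt_le; intros Hbad.
    (* The bound is quadratic in the size, so it divides evenly among four quarters: if it fails on
       a rectangle, it fails on a quarter. At the limit point [rect_local] contradicts this. *)
    destruct (quarter_nest (fun x y w h => 2 * eps * (w + h) ^ 2 < Rabs (rect U V x (x + w) y (y + h))) x y w h Hw Hh) as [u [v Huv]]; auto.
    - intros x' y' w' h' K. apply NNPP; intros N.
      apply not_or_and in N; destruct N as [N1 N]. apply not_or_and in N; destruct N as [N2 N]. apply not_or_and in N; destruct N as [N3 N4].
      apply Rnot_lt_le in N1, N2, N3, N4. apply (Rlt_not_le _ _ K). rewrite rect_split by auto.
      eapply Rle_trans; [apply Rabs_triang|]. eapply Rle_trans; [apply Rplus_le_compat_r, Rabs_triang|].
      eapply Rle_trans; [apply Rplus_le_compat_r, Rplus_le_compat_r, Rabs_triang|].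
      replace (2 * eps * (w' + h') ^ 2) with (4 * (2 * eps * (w' / 2 + h' / 2) ^ 2)) by field. lra.
    - destruct (H u v) as [p [q Hpq]]. destruct (Hpq eps He) as [d [Hd K]].
      destruct (nfloor_ex ((w + h) / d)) as [N [_ HN]]; [apply Rdiv_le_0_compat; lra|].
      destruct (Huv (S N)) as [x' [y' [B [Hu Hv]]]].
      assert (Hp : INR N + 1 <= 2 ^ S N).
      { clear. induction N as [|N IH]; [simpl; lra|]. rewrite S_INR. assert (1 <= 2 ^ S N) by (apply pow_R1_Rle; lra).
        change (2 ^ S (S N)) with (2 * 2 ^ S N). lra. }
      assert (Hlt : w + h < d * 2 ^ S N).
      { apply Rlt_le_trans with (d * (INR N + 1)); [|apply Rmult_le_compat_l; lra].
        apply Rlt_div_l in HN; auto. lra. }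
      assert (P2 : 0 < 2 ^ S N) by (apply pow_lt; lra).
      apply (Rlt_not_le _ _ B). apply (rect_local U V x' y' _ _ u v p q eps d); auto; try (apply Rdiv_le_0_compat; auto);
      apply Rlt_div_l; auto; lra. }
  destruct (Req_dec (rect U V x (x + w) y (y + h)) 0) as [|N]; auto. exfalso.
  apply Rabs_pos_lt in N. set (r := Rabs (rect U V x (x + w) y (y + h))) in *.
  assert (Hs := pow2_ge_0 (w + h)).
  specialize (W (r / (4 * ((w + h) ^ 2 + 1))) ltac:(apply Rdiv_lt_0_compat; lra)).
  replace (2 * (r / (4 * ((w + h) ^ 2 + 1))) * (w + h) ^ 2) with (r / 2 * ((w + h) ^ 2 / ((w + h) ^ 2 + 1))) in W by (field; lra).
  assert ((w + h) ^ 2 / ((w + h) ^ 2 + 1) <= 1) by (apply Rle_div_l; lra). nra.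
Qed.

Lemma goursat U V x1 x2 y1 y2 : hol U V -> rect U V x1 x2 y1 y2 = 0.
Proof.
  intros H. assert (HU := hol_cont2 _ _ H). assert (HV := hol_cont2 _ _ (hol_rot _ _ H)).
  assert (CU : forall y, cont (fun x => U x y)) by (intros; apply cont2_slice1; auto).
  assert (CV : forall x, cont (fun y => V x y)) by (intros; apply cont2_slice2; auto).
  assert (Q : forall x1 x2 y1 y2, x1 <= x2 -> y1 <= y2 -> rect U V x1 x2 y1 y2 = 0).
  { clear x1 x2 y1 y2; intros x1 x2 y1 y2 Hx Hy.
    replace x2 with (x1 + (x2 - x1)) by ring. replace y2 with (y1 + (y2 - y1)) by ring. apply goursat_le; auto; lra. }
  assert (Sx : rect U V x1 x2 y1 y2 = - rect U V x2 x1 y1 y2).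
  { unfold rect. rewrite (RI_swap _ x1 x2) by (cont; auto). rewrite !RI_minus by auto. ring. }
  assert (Sy : forall x1 x2, rect U V x1 x2 y1 y2 = - rect U V x1 x2 y2 y1).
  { intros. unfold rect. rewrite (RI_swap _ y1 y2) by (cont; auto). rewrite !RI_minus by auto. ring. }
  destruct (Rle_dec x1 x2); destruct (Rle_dec y1 y2).
  - apply Q; auto.
  - rewrite Sy, Q; lra.
  - rewrite Sx, Q; lra.
  - rewrite Sx, Sy, Q; lra.
Qed.

Lemma RI_near phi x h c eps : cont phi -> (forall s, Rabs (s - x) <= Rabs h -> Rabs (phi s - c) <= eps) ->
  Rabs (RI phi x (x + h) - c * h) <= eps * Rabs h.
Proof.
  intros Hp H.
  assert (P : forall a b, a <= b -> (forall s, a <= s <= b -> Rabs (phi s - c) <= eps) -> Rabs (RI phi a b - c * (b - a)) <= eps * (b - a)).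
  { intros a b Hab K. replace (c * (b - a)) with (RI (fun _ => c) a b) by (rewrite RI_const; ring).
    rewrite <- RI_minus by cont. rewrite Rmult_comm. apply RI_abs_const; auto. cont. }
  destruct (Rle_dec 0 h) as [Hh|Hh].
  - rewrite (Rabs_pos_eq h) in * by lra.
    assert (K := P x (x + h) ltac:(lra)). replace (x + h - x) with h in K by ring. apply K.
    intros s Hs; apply H. rewrite Rabs_pos_eq; lra.
  - rewrite (Rabs_left h) in * by lra. rewrite (RI_swap phi) by auto.
    assert (K := P (x + h) x ltac:(lra)). replace (x - (x + h)) with (- h) in K by ring.
    rewrite <- Rabs_Ropp. replace (- (- RI phi (x + h) x - c * h)) with (RI phi (x + h) x - c * - h) by ring. apply K.
    intros s Hs; apply H. apply Rabs_le; lra.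
Qed.

(** The real part of the integral of [U + i V] from 0 along the real axis to [x], then
    vertically. *)
Definition prim (U V : R -> R -> R) (x y : R) : R := RI (fun s => U s 0) 0 x - RI (fun t => V x t) 0 y.

(** By [goursat] on the rectangle over [[x, x + h]] between heights 0 and [y], the increment is an
    integral along the short path from [(x, y)] to [(x + h, y)] to [(x + h, y + k)], where
    continuity bounds the integrands. *)
Lemma prim_incr U V x y eps : hol U V -> 0 < eps -> exists d, 0 < d /\ forall h k, Rabs h < d -> Rabs k < d ->
  Rabs (prim U V (x + h) (y + k) - prim U V x y - (U x y * h - V x y * k)) <= eps * (Rabs h + Rabs k).
Proof.
  intros H He. assert (HU := hol_cont2 _ _ H). assert (HV := hol_cont2 _ _ (hol_rot _ _ H)).
  assert (CU : forall y, cont (fun x => U x y)) by (intros; apply cont2_slice1; auto).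
  assert (CV : forall x, cont (V x)) by (intros; apply (cont2_slice2 V); auto).
  destruct (HU x y (mkposreal eps He)) as [d1 K1]. destruct (HV x y (mkposreal eps He)) as [d2 K2]. simpl in K1, K2.
  exists (Rmin d1 d2). split; [apply Rmin_glb_lt; apply cond_pos|]. intros h k Hh Hk.
  assert (Hh1 := Rlt_le_trans _ _ _ Hh (Rmin_l _ _)). assert (Hh2 := Rlt_le_trans _ _ _ Hh (Rmin_r _ _)).
  assert (Hk1 := Rlt_le_trans _ _ _ Hk (Rmin_l _ _)). assert (Hk2 := Rlt_le_trans _ _ _ Hk (Rmin_r _ _)).
  assert (Z : forall e : posreal, forall z, Rabs (z - z) < e) by (intros e z; rewrite Rminus_diag, Rabs_R0; apply cond_pos).
  assert (E : prim U V (x + h) (y + k) - prim U V x y = RI (fun s => U s y) x (x + h) - RI (V (x + h)) y (y + k)).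
  { unfold prim. assert (G := goursat U V x (x + h) 0 y H). unfold rect in G. rewrite !RI_minus in G by auto.
    change (fun t => V (x + h) t) with (V (x + h)). change (fun t => V x t) with (V x).
    rewrite <- (RI_Chasles (fun s => U s 0) 0 x (x + h)), <- (RI_Chasles (V (x + h)) 0 y (y + k)) by auto. lra. }
  rewrite E.
  assert (B1 := RI_near (fun s => U s y) x h (U x y) eps (CU y)).
  assert (B2 := RI_near (V (x + h)) y k (V x y) eps (CV _)).
  replace (_ - _ - _) with ((RI (fun s => U s y) x (x + h) - U x y * h) + - (RI (V (x + h)) y (y + k) - V x y * k)) by ring.
  eapply Rle_trans; [apply Rabs_triang|]. rewrite Rabs_Ropp, Rmult_plus_distr_l. apply Rplus_le_compat.
  - apply B1. intros s Hs. apply Rlt_le, K1; [lra|apply Z].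
  - apply B2. intros t Ht. apply Rlt_le, K2; [replace (x + h - x) with h by ring; lra|lra].
Qed.

Lemma prim_cdiff2 U V x y : hol U V ->
  cdiff2 (prim U V) (prim V (fun x y => - U x y)) x y (U x y) (V x y).
Proof.
  intros H eps He. destruct (prim_incr U V x y eps H He) as [d1 [Hd1 K1]].
  destruct (prim_incr _ _ x y eps (hol_rot _ _ H) He) as [d2 [Hd2 K2]].
  exists (Rmin d1 d2). split; [apply Rmin_glb_lt; auto|]. intros h k Hh Hk.
  split; [apply K1|replace (V x y * h + U x y * k) with (V x y * h - - U x y * k) by ring; apply K2];
  (eapply Rlt_le_trans; [eassumption|]); try apply Rmin_l; apply Rmin_r.
Qed.

(** * Complex derivatives *)

(** An explicit form of the derivative that mediates between two normed module structures on [C]: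
    the one used in [entire], and the one in which the product and chain rules are stated. *)
Definition cder (F : C -> C) (z l : C) : Prop :=
  forall eps, 0 < eps -> exists d, 0 < d /\ forall w, Cmod (w - z) < d ->
    Cmod (F w - F z - l * (w - z)) <= eps * Cmod (w - z).

Lemma is_derive_cder F z l : @is_derive C_AbsRing C_NormedModule F z l <-> cder F z l.
Proof.
  split.
  - intros [_ H] eps He.
    destruct (H z (fun P HP => HP) (mkposreal eps He)) as [d Hd].
    exists d; split; [apply cond_pos|]. intros w Hw. specialize (Hd w Hw).
    replace (F w - F z - l * (w - z))%C with (F w - F z - (w - z) * l)%C by ring. exact Hd.
  - intros H. split; [apply is_linear_scal_l|].
    intros x Hx eps. apply (is_filter_lim_locally_unique z x) in Hx. subst x.
    destruct (H eps (cond_pos eps)) as [d [Hd K]]. exists (mkposreal d Hd). intros w Hw. specialize (K w Hw).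
    replace (F w - F z - l * (w - z))%C with (F w - F z - (w - z) * l)%C in K by ring. exact K.
Qed.

Lemma is_derive_cder' F z l : @is_derive C_AbsRing (AbsRing_NormedModule C_AbsRing) F z l <-> cder F z l.
Proof.
  split.
  - intros [_ H] eps He.
    destruct (H z (fun P HP => HP) (mkposreal eps He)) as [d Hd].
    exists d; split; [apply cond_pos|]. intros w Hw. specialize (Hd w Hw).
    replace (F w - F z - l * (w - z))%C with (F w - F z - (w - z) * l)%C by ring. exact Hd.
  - intros H. split; [apply is_linear_scal_l|].
    intros x Hx eps. apply (is_filter_lim_locally_unique z x) in Hx. subst x.
    destruct (H eps (cond_pos eps)) as [d [Hd K]]. exists (mkposreal d Hd). intros w Hw. specialize (K w Hw).
    replace (F w - F z - l * (w - z))%C with (F w - F z - (w - z) * l)%C in K by ring. exact K.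
Qed.

Lemma cder_eq F z l l' : l = l' -> cder F z l -> cder F z l'.
Proof. intros <-; auto. Qed.

Lemma cder_ext F G z l : (forall w, F w = G w) -> cder F z l -> cder G z l.
Proof.
  intros E H eps He. destruct (H eps He) as [d [Hd K]]. exists d; split; auto. intros w Hw.
  rewrite <- !E; auto.
Qed.

Lemma cder_const c z : cder (fun _ => c) z 0.
Proof. apply is_derive_cder', (is_derive_const (V := AbsRing_NormedModule C_AbsRing) c z). Qed.

Lemma cder_id z : cder (fun w => w) z 1.
Proof. apply is_derive_cder', (is_derive_id (K := C_AbsRing) z). Qed.

Lemma cder_plus F G z l m : cder F z l -> cder G z m -> cder (fun w => F w + G w)%C z (l + m).
Proof. rewrite <- !is_derive_cder. intros H K. apply (is_derive_plus F G z l m H K). Qed.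

Lemma cder_minus F G z l m : cder F z l -> cder G z m -> cder (fun w => F w - G w)%C z (l - m).
Proof. rewrite <- !is_derive_cder. intros H K. apply (is_derive_minus F G z l m H K). Qed.

Lemma cder_mult F G z l m : cder F z l -> cder G z m -> cder (fun w => F w * G w)%C z (l * G z + F z * m).
Proof. rewrite <- !is_derive_cder'. intros H K. apply (is_derive_mult (K := C_AbsRing) F G z l m H K Cmult_comm). Qed.

Lemma cder_comp F G z l m : cder F (G z) l -> cder G z m -> cder (fun w => F (G w)) z (m * l).
Proof.
  rewrite <- (is_derive_cder' G), <- !is_derive_cder. intros H K. apply (is_derive_comp (K := C_AbsRing) F G z l m H K).
Qed.

Lemma cder_scal c F z l : cder F z l -> cder (fun w => c * F w)%C z (c * l).
Proof. intros H. eapply cder_eq; [|apply cder_mult; [apply cder_const|exact H]]. cbv beta. ring. Qed.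

Lemma cder_lin c F z l : cder F (c * z)%C l -> cder (fun w => F (c * w)%C) z (c * l).
Proof.
  intros H. apply (cder_comp F (fun w => c * w)%C); auto.
  eapply cder_eq; [|apply cder_scal, cder_id]. ring.
Qed.

Lemma cder_shift c F z l : cder F (z + c)%C l -> cder (fun w => F (w + c)%C) z l.
Proof.
  intros H. eapply cder_eq; [|apply (cder_comp F (fun w => w + c)%C); [exact H|apply cder_plus; [apply cder_id|apply cder_const]]]. ring.
Qed.

Lemma Cmod_le_add (x y : R) : Cmod (x, y) <= Rabs x + Rabs y.
Proof.
  unfold Cmod; simpl. apply Rsqr_incr_0_var; [|generalize (Rabs_pos x) (Rabs_pos y); lra].
  rewrite Rsqr_sqrt by nra. unfold Rsqr. rewrite <- (Rabs_pos_eq (x * (x * 1))), <- (Rabs_pos_eq (y * (y * 1))) by nra.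
  rewrite !Rabs_mult, Rabs_R1. generalize (Rabs_pos x) (Rabs_pos y); nra.
Qed.

Lemma Cmod_fst (z : C) : Rabs (fst z) <= Cmod z.
Proof. eapply Rle_trans; [|apply Rmax_Cmod]; apply Rmax_l. Qed.

Lemma Cmod_snd (z : C) : Rabs (snd z) <= Cmod z.
Proof. eapply Rle_trans; [|apply Rmax_Cmod]; apply Rmax_r. Qed.

Definition reP (F : C -> C) (x y : R) : R := fst (F (x, y)).
Definition imP (F : C -> C) (x y : R) : R := snd (F (x, y)).

Lemma cder_cdiff2 F x y p q : cder F (x, y) (p, q) <-> cdiff2 (reP F) (imP F) x y p q.
Proof.
  split; intros H eps He.
  - destruct (H eps He) as [d [Hd K]]. exists (d / 2); split; [lra|]. intros h k Hh Hk.
    specialize (K (x + h, y + k)).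
    assert (E : ((((x + h)%R, (y + k)%R) : C) - (x, y))%C = (h, k)) by (unfold Cminus, Cplus, Copp; simpl; f_equal; ring).
    rewrite E in K.
    assert (B := Cmod_le_add h k). specialize (K ltac:(lra)).
    assert (K' : eps * Cmod (h, k) <= eps * (Rabs h + Rabs k)) by (apply Rmult_le_compat_l; lra).
    unfold reP, imP. destruct (F (x + h, y + k)) as [u v]. destruct (F (x, y)) as [u' v'].
    assert (K1 := Cmod_fst ((u, v) - (u', v') - (p, q) * (h, k))).
    assert (K2 := Cmod_snd ((u, v) - (u', v') - (p, q) * (h, k))).
    simpl in K1, K2. simpl. split.
    + replace (_ - _ - _) with (u + - u' + - (p * h - q * k)) by ring. lra.
    + replace (_ - _ - _) with (v + - v' + - (p * k + q * h)) by ring. lra.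
  - destruct (H (eps / 4) ltac:(lra)) as [d [Hd K]]. exists d; split; auto. intros w Hw.
    assert (H1 := Cmod_fst (w - (x, y))). assert (H2 := Cmod_snd (w - (x, y))).
    destruct w as [a b]. simpl in H1, H2.
    destruct (K (a + - x) (b + - y) ltac:(lra) ltac:(lra)) as [K1 K2]. unfold reP, imP in *.
    replace (x + (a + - x)) with a in * by ring. replace (y + (b + - y)) with b in * by ring.
    set (c := Cmod ((a, b) - (x, y))) in *.
    destruct (F (a, b)) as [u v]. destruct (F (x, y)) as [u' v']. simpl in *.
    eapply Rle_trans; [apply Cmod_le_add|]. simpl.
    replace (u + - u' + - (p * (a + - x) - q * (b + - y))) with (u - u' - (p * (a + - x) - q * (b + - y))) by ring.
    replace (v + - v' + - (p * (b + - y) + q * (a + - x))) with (v - v' - (q * (a + - x) + p * (b + - y))) by ring.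
    assert (Hm : eps / 4 * (Rabs (a + - x) + Rabs (b + - y)) <= eps / 4 * (2 * c)) by (apply Rmult_le_compat_l; lra). lra.
Qed.

Definition hasder (F F' : C -> C) : Prop := forall z, cder F z (F' z).

Lemma entire_cder F : entire F -> forall z, exists l, cder F z l.
Proof. intros H z. destruct (H z) as [l Hl]. exists l. apply is_derive_cder, Hl. Qed.

Lemma hasder_entire F F' : hasder F F' -> entire F.
Proof. intros H z. exists (F' z). apply is_derive_cder, H. Qed.

Lemma entire_hol F : entire F -> hol (reP F) (imP F).
Proof.
  intros H x y. destruct (entire_cder F H (x, y)) as [[p q] Hl]. exists p, q. apply cder_cdiff2, Hl.
Qed.

Lemma entire_primitive F : entire F -> exists G, hasder G F.
Proof.
  intros H. assert (Hh := entire_hol F H).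
  exists (fun z => (prim (reP F) (imP F) (fst z) (snd z), prim (imP F) (fun x y => - reP F x y) (fst z) (snd z))).
  intros [x y]. rewrite (surjective_pairing (F (x, y))). apply cder_cdiff2.
  exact (prim_cdiff2 _ _ x y Hh).
Qed.

Lemma entire_cont F : entire F -> cont2 (reP F) /\ cont2 (imP F).
Proof.
  intros H. assert (Hh := entire_hol F H). split; [apply (hol_cont2 _ _ Hh)|apply (hol_cont2 _ _ (hol_rot _ _ Hh))].
Qed.

Lemma cder_path F z0 d (t : R) l : cder F (z0 + t * d)%C l ->
  is_derive (fun t : R => fst (F (z0 + t * d)%C)) t (fst (l * d)%C) /\
  is_derive (fun t : R => snd (F (z0 + t * d)%C)) t (snd (l * d)%C).
Proof.
  intros H.
  assert (W : forall eps, 0 < eps -> exists e, 0 < e /\ forall h, h <> 0 -> Rabs h < e ->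
     Cmod (F (z0 + RtoC (t + h) * d)%C - F (z0 + t * d)%C - l * (h * d)) < eps * Rabs h).
  { intros eps He. assert (Hc := Cmod_ge_0 d).
    destruct (H (eps / (2 * (Cmod d + 1))) ltac:(apply Rdiv_lt_0_compat; lra)) as [e [Hee K]].
    exists (e / (Cmod d + 1)); split; [apply Rdiv_lt_0_compat; lra|]. intros h Hh0 Hh.
    specialize (K (z0 + RtoC (t + h) * d)%C).
    replace (z0 + RtoC (t + h) * d - (z0 + t * d))%C with (h * d)%C in K by (rewrite RtoC_plus; ring).
    rewrite Cmod_mult, Cmod_R in K.
    apply Rabs_pos_lt in Hh0.
    assert (Hlt : Rabs h * (Cmod d + 1) < e) by (apply Rlt_div_r in Hh; lra).
    specialize (K ltac:(nra)). eapply Rle_lt_trans; [exact K|].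
    apply Rle_lt_trans with (eps / 2 * Rabs h); [|nra].
    replace (eps / (2 * (Cmod d + 1)) * (Rabs h * Cmod d)) with (eps / 2 * Rabs h * (Cmod d / (Cmod d + 1))) by (field; lra).
    rewrite <- (Rmult_1_r (eps / 2 * Rabs h)) at 2. apply Rmult_le_compat_l; [nra|]. apply Rle_div_l; lra. }
  split; apply is_derive_Reals; intros eps He; destruct (W eps He) as [e [Hee K]]; exists (mkposreal e Hee); intros h Hh Hhe;
    specialize (K h Hh Hhe); simpl in Hhe.
  - set (A := F (z0 + RtoC (t + h) * d)%C) in *. set (B := F (z0 + t * d)%C) in *.
    replace ((fst A - fst B) / h - fst (l * d)%C) with (fst (A - B - l * (h * d))%C / h).
    + unfold Rdiv; rewrite Rabs_mult, Rabs_inv. apply Rlt_div_l; [apply Rabs_pos_lt; auto|].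
      eapply Rle_lt_trans; [apply Cmod_fst|exact K].
    + destruct A, B, l, d; simpl. field; auto.
  - set (A := F (z0 + RtoC (t + h) * d)%C) in *. set (B := F (z0 + t * d)%C) in *.
    replace ((snd A - snd B) / h - snd (l * d)%C) with (snd (A - B - l * (h * d))%C / h).
    + unfold Rdiv; rewrite Rabs_mult, Rabs_inv. apply Rlt_div_l; [apply Rabs_pos_lt; auto|].
      eapply Rle_lt_trans; [apply Cmod_snd|exact K].
    + destruct A, B, l, d; simpl. field; auto.
Qed.

Lemma derive_dominated (f df M m : R -> R) X : 0 <= X -> (forall t, is_derive f t (df t)) -> (forall t, is_derive M t (m t)) ->
  (forall t, 0 <= t <= X -> Rabs (df t) <= m t) -> Rabs (f X - f 0) <= M X - M 0.
Proof.
  intros HX Hf HM Hb. apply Rabs_le; split.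
  - cut (M 0 + f 0 <= M X + f X); [lra|].
    apply (nonneg_derive_incr (fun t => M t + f t) (fun t => m t + df t)); auto.
    + intros t _. apply (is_derive_plus M f); auto.
    + intros t Ht. specialize (Hb t Ht). apply Rabs_le_between in Hb. lra.
  - cut (M 0 - f 0 <= M X - f X); [lra|].
    apply (nonneg_derive_incr (fun t => M t - f t) (fun t => m t - df t)); auto.
    + intros t _. apply (is_derive_minus M f); auto.
    + intros t Ht. specialize (Hb t Ht). apply Rabs_le_between in Hb. lra.
Qed.

(** A mean value inequality with a variable majorant [m] along a ray. The factor 2 comes from
    bounding the real and the imaginary part separately. *)
Lemma path_dominated F F' (z0 d : C) (M m : R -> R) (X : R) : hasder F F' -> 0 <= X -> (forall t, is_derive M t (m t)) ->
  (forall t : R, 0 <= t <= X -> Cmod (F' (z0 + t * d)%C * d) <= m t) -> Cmod (F (z0 + X * d)%C - F z0) <= 2 * (M X - M 0).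
Proof.
  intros HF HX HM Hb.
  assert (E0 : (z0 + RtoC 0 * d)%C = z0) by ring.
  assert (P1 := derive_dominated (fun t : R => fst (F (z0 + t * d)%C)) (fun t : R => fst (F' (z0 + t * d) * d)%C) M m X HX
    (fun t => proj1 (cder_path F z0 d t _ (HF _))) HM).
  assert (P2 := derive_dominated (fun t : R => snd (F (z0 + t * d)%C)) (fun t : R => snd (F' (z0 + t * d) * d)%C) M m X HX
    (fun t => proj2 (cder_path F z0 d t _ (HF _))) HM).
  cbv beta in P1, P2. rewrite E0 in P1, P2.
  specialize (P1 (fun t Ht => Rle_trans _ _ _ (Cmod_fst _) (Hb t Ht))).
  specialize (P2 (fun t Ht => Rle_trans _ _ _ (Cmod_snd _) (Hb t Ht))).
  rewrite (surjective_pairing (F (z0 + X * d) - F z0)%C). eapply Rle_trans; [apply Cmod_le_add|].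
  simpl. unfold Rminus in P1, P2. lra.
Qed.

Lemma segment_bound F F' (z w : C) (B : R) : hasder F F' -> (forall t : R, 0 <= t <= 1 -> Cmod (F' (z + t * (w - z))%C) <= B) ->
  Cmod (F w - F z) <= 2 * (B * Cmod (w - z)).
Proof.
  intros HF Hb. replace w with (z + RtoC 1 * (w - z))%C at 1 by ring.
  replace (2 * (B * Cmod (w - z))) with (2 * (B * Cmod (w - z) * 1 - B * Cmod (w - z) * 0)) by ring.
  apply (path_dominated F F' z (w - z)%C (fun t => B * Cmod (w - z) * t) (fun t => B * Cmod (w - z))); auto; [lra| |].
  - intros t. auto_derive; auto; ring.
  - intros t Ht. rewrite Cmod_mult. apply Rmult_le_compat_r; [apply Cmod_ge_0|auto].
Qed.

(** * The complex exponential *)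

Definition Cexp (z : C) : C := (exp (fst z) * cos (snd z), exp (fst z) * sin (snd z)).

Lemma Cexp_plus (z w : C) : Cexp (z + w) = (Cexp z * Cexp w)%C.
Proof.
  destruct z as [x y], w as [x' y']. unfold Cexp, Cplus, Cmult; simpl.
  rewrite exp_plus, cos_plus, sin_plus. f_equal; ring.
Qed.

Lemma Cmod_Cexp z : Cmod (Cexp z) = exp (fst z).
Proof.
  unfold Cmod, Cexp; simpl. rewrite <- (sqrt_square (exp (fst z))) at 5 by (apply Rlt_le, exp_pos).
  f_equal. assert (E := sin2_cos2 (snd z)). unfold Rsqr in E.
  transitivity (exp (fst z) * exp (fst z) * (sin (snd z) * sin (snd z) + cos (snd z) * cos (snd z))); [ring|].
  rewrite E; ring.
Qed.

Lemma Cexp_0 : Cexp 0 = 1.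
Proof. unfold Cexp; simpl. rewrite exp_0, cos_0, sin_0. unfold RtoC; f_equal; ring. Qed.

Lemma derive_at_0 (f : R -> R) l eps : is_derive f 0 l -> 0 < eps ->
  exists d, 0 < d /\ forall h, Rabs h < d -> Rabs (f h - f 0 - l * h) <= eps * Rabs h.
Proof.
  intros H He. apply is_derive_Reals in H. destruct (H eps He) as [d Hd]. exists d; split; [apply cond_pos|].
  intros h Hh. destruct (Req_dec h 0) as [->|Hh0].
  - rewrite Rmult_0_r, !Rminus_0_r, Rminus_diag, Rabs_R0. lra.
  - specialize (Hd h Hh0 Hh). rewrite Rplus_0_l in Hd.
    replace (f h - f 0 - l * h) with (((f h - f 0) / h - l) * h) by (field; auto).
    rewrite Rabs_mult. apply Rmult_le_compat_r; [apply Rabs_pos|lra].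
Qed.

Lemma cder_Cexp_0 : cder Cexp 0 1.
Proof.
  apply (cder_cdiff2 Cexp 0 0 1 0). intros eps He.
  (* The imaginary part collects the errors [3 e |k| + e |k| + e |k|], whence the 5; the 3 bounds
     [exp h], which uses [|h| < 1]. *)
  set (e := Rmin (eps / 5) 1).
  assert (He0 : 0 < e) by (apply Rmin_glb_lt; lra). assert (He1 : e <= 1) by apply Rmin_r. assert (He5 : e <= eps / 5) by apply Rmin_l.
  destruct (derive_at_0 exp 1 e) as [d1 [Hd1 K1]]; auto.
  { auto_derive; [exact I|rewrite exp_0; ring]. }
  destruct (derive_at_0 cos 0 e) as [d2 [Hd2 K2]]; auto.
  { auto_derive; [exact I|rewrite sin_0; ring]. }
  destruct (derive_at_0 sin 1 e) as [d3 [Hd3 K3]]; auto.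
  { auto_derive; [exact I|rewrite cos_0; ring]. }
  set (d := Rmin (Rmin d1 d2) (Rmin d3 e)).
  assert (D1 : d <= d1) by (eapply Rle_trans; [apply Rmin_l|apply Rmin_l]).
  assert (D2 : d <= d2) by (eapply Rle_trans; [apply Rmin_l|apply Rmin_r]).
  assert (D3 : d <= d3) by (eapply Rle_trans; [apply Rmin_r|apply Rmin_l]).
  assert (D4 : d <= e) by (eapply Rle_trans; [apply Rmin_r|apply Rmin_r]).
  exists d; split; [unfold d; repeat apply Rmin_glb_lt; lra|]. intros h k Hh Hk.
  unfold reP, imP, Cexp; simpl. rewrite !Rplus_0_l, exp_0, cos_0, sin_0.
  specialize (K1 h (Rlt_le_trans _ _ _ Hh D1)). specialize (K2 k (Rlt_le_trans _ _ _ Hk D2)). specialize (K3 k (Rlt_le_trans _ _ _ Hk D3)).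
  rewrite exp_0 in K1. rewrite cos_0 in K2. rewrite sin_0 in K3.
  assert (Hp := Rabs_pos h). assert (Hq := Rabs_pos k).
  assert (Ex : exp h <= 3).
  { eapply Rle_trans; [|apply exp_le_3]. assert (h < 1) by (apply Rle_lt_trans with (Rabs h); [apply Rle_abs|lra]).
    apply Rlt_le, exp_increasing; auto. }
  assert (Ep := exp_pos h).
  split.
  - replace (exp h * cos k - 1 * 1 - (1 * h - 0 * k)) with ((exp h - 1 - 1 * h) + exp h * (cos k - 1 - 0 * k)) by ring.
    eapply Rle_trans; [apply Rabs_triang|]. rewrite Rabs_mult, (Rabs_pos_eq (exp h)) by lra.
    assert (exp h * Rabs (cos k - 1 - 0 * k) <= 3 * (e * Rabs k)) by (apply Rmult_le_compat; try lra; apply Rabs_pos).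
    assert (e * Rabs h <= eps / 5 * Rabs h) by (apply Rmult_le_compat_r; lra).
    assert (e * Rabs k <= eps / 5 * Rabs k) by (apply Rmult_le_compat_r; lra).
    assert (0 <= eps * Rabs h) by nra. assert (0 <= eps * Rabs k) by nra. lra.
  - replace (exp h * sin k - 1 * 0 - (0 * h + 1 * k)) with (exp h * (sin k - 0 - 1 * k) + (exp h - 1 - 1 * h) * k + h * k) by ring.
    eapply Rle_trans; [apply Rabs_triang|]. eapply Rle_trans; [apply Rplus_le_compat_r, Rabs_triang|].
    rewrite !Rabs_mult, (Rabs_pos_eq (exp h)) by lra.
    assert (exp h * Rabs (sin k - 0 - 1 * k) <= 3 * (e * Rabs k)) by (apply Rmult_le_compat; try lra; apply Rabs_pos).
    assert (Rabs (exp h - 1 - 1 * h) * Rabs k <= e * Rabs k).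
    { apply Rmult_le_compat_r; auto. eapply Rle_trans; [exact K1|]. nra. }
    assert (Rabs h * Rabs k <= e * Rabs k) by (apply Rmult_le_compat_r; lra).
    assert (e * Rabs k <= eps / 5 * Rabs k) by (apply Rmult_le_compat_r; lra).
    assert (0 <= eps * Rabs h) by nra. assert (0 <= eps * Rabs k) by nra. lra.
Qed.

(** The functional equation transports the derivative at 0 to every point. *)
Lemma hasder_Cexp : hasder Cexp Cexp.
Proof.
  intros z. apply cder_ext with (fun w => Cexp z * Cexp (w + - z))%C.
  - intros w. rewrite <- Cexp_plus. f_equal; ring.
  - eapply cder_eq; [|apply cder_scal, (cder_shift (- z) Cexp z 1)].
    + ring.
    + replace (z + - z)%C with (RtoC 0) by ring. apply cder_Cexp_0.
Qed.

Lemma cder_Cexp_comp F z l : cder F z l -> cder (fun w => Cexp (F w)) z (l * Cexp (F z)).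
Proof. intros H. apply (cder_comp Cexp F); auto. apply hasder_Cexp. Qed.

Lemma exp_le x y : x <= y -> exp x <= exp y.
Proof. intros [H| ->]; [apply Rlt_le, exp_increasing; auto|lra]. Qed.

Lemma Cexp_m1_bound (w : C) : 0 <= fst w -> Cmod (1 - Cexp (- w)) <= 2 * Cmod w.
Proof.
  intros Hw. rewrite <- Cexp_0.
  assert (K := segment_bound Cexp Cexp (- w)%C 0 1 hasder_Cexp).
  replace (0 - - w)%C with w in K by ring. rewrite Rmult_1_l in K. apply K.
  intros t Ht. rewrite Cmod_Cexp. simpl. rewrite <- exp_0. apply exp_le. simpl. nra.
Qed.

(** * Vanishing of the Fourier transform beyond the exponential type *)

Lemma exp_rb s r : 0 < s -> 0 <= r -> exp (- s * r) <= (1 + 4 / s ^ 2) * rb r.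
Proof.
  intros Hs Hr. unfold rb. rewrite Rmult_1_l.
  replace (- s * r) with (- (s * r)) by ring. rewrite exp_Ropp.
  assert (E : exp (s * r) = exp (s * r / 2) * exp (s * r / 2)) by (rewrite <- exp_plus; f_equal; field).
  assert (K := exp_ineq1_le (s * r / 2)). assert (Hsr : 0 <= s * r) by nra.
  assert (K2 : 1 + (s * r) ^ 2 / 4 <= exp (s * r)) by (rewrite E; nra).
  assert (Hd : 0 < 1 + r ^ 2) by nra.
  apply Rle_div_r; auto. rewrite Rmult_comm. apply Rle_div_l; [apply exp_pos|].
  assert (Hs2 : 0 < s ^ 2) by nra.
  assert (H4 : 0 < 4 / s ^ 2) by (apply Rdiv_lt_0_compat; lra).
  apply Rle_trans with ((1 + 4 / s ^ 2) * (1 + (s * r) ^ 2 / 4)); [|apply Rmult_le_compat_l; lra].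
  replace ((1 + 4 / s ^ 2) * (1 + (s * r) ^ 2 / 4)) with (1 + r ^ 2 + (4 / s ^ 2 + (s * r) ^ 2 / 4)) by (field; lra). nra.
Qed.

(** With [u = dl * r^2], the distance of the Gaussian from 1 is at most [min (2, 2 u)], hence at
    most [4 u / (1 + u)], and the decay [rb r] absorbs [r^2]. The resulting bound has an arctangent
    as primitive, with total mass of order [sqrt dl]. *)
Lemma gauss_diff_bound (Phi : C) m dl r (c : C) : 0 <= m -> 0 < dl -> Cmod Phi <= m * rb r -> 0 <= fst c -> Cmod c = 1 ->
  Cmod (Phi * (1 - Cexp (- (RtoC (dl * r ^ 2) * c)))) <= 4 * m * dl * / (1 + (sqrt dl * r) ^ 2).
Proof.
  intros Hm Hd HP Hc Hc1.
  assert (Hr2 := pow2_ge_0 r). set (u := dl * r ^ 2).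
  assert (Hu : 0 <= u) by (unfold u; nra).
  assert (Eu : (sqrt dl * r) ^ 2 = u).
  { unfold u. replace ((sqrt dl * r) ^ 2) with (sqrt dl * sqrt dl * r ^ 2) by ring. rewrite sqrt_sqrt; lra. }
  rewrite Eu, Cmod_mult.
  assert (Hre : 0 <= fst (RtoC u * c)%C) by (simpl; rewrite Rmult_0_l, Rminus_0_r; nra).
  assert (B1 := Cexp_m1_bound (RtoC u * c)%C Hre). rewrite Cmod_mult, Cmod_R, Hc1, Rabs_pos_eq, Rmult_1_r in B1 by auto.
  assert (B2 : Cmod (1 - Cexp (- (RtoC u * c))) <= 2).
  { eapply Rle_trans; [apply Cmod_triangle|]. rewrite Cmod_opp, Cmod_1, Cmod_Cexp.
    assert (exp (fst (- (RtoC u * c))%C) <= 1); [|lra]. rewrite <- exp_0. apply exp_le.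
    change (fst (- (RtoC u * c))%C) with (- fst (RtoC u * c)%C). lra. }
  set (b := Cmod (1 - Cexp (- (RtoC u * c)))) in *.
  assert (Hb : b <= 4 * u / (1 + u)).
  { apply Rle_div_r; [lra|]. destruct (Rle_dec u 1); nra. }
  assert (Hb0 : 0 <= b) by apply Cmod_ge_0.
  apply Rle_trans with ((m * rb r) * (4 * u / (1 + u))).
  { apply Rmult_le_compat; auto. apply Cmod_ge_0. }
  unfold rb. rewrite Rmult_1_l.
  replace (m * / (1 + r ^ 2) * (4 * u / (1 + u))) with (4 * m * dl * / (1 + u) * (r ^ 2 / (1 + r ^ 2))) by (unfold u; field; unfold u in Hu; split; lra).
  rewrite <- (Rmult_1_r (4 * m * dl * / (1 + u))) at 2. apply Rmult_le_compat_l.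
  - apply Rmult_le_pos; [nra|]. apply Rlt_le, Rinv_0_lt_compat; lra.
  - apply Rle_div_l; lra.
Qed.

(* Rotation of the half line [e R_+] ([e = 1] or [-1]) to the ray through [b], the growth in
   between being killed by the Gaussian [exp (- dl e conj(b) z^2)], which decays in the whole sector. *)
Lemma rotate_ray K G0 (e p q A kap om m X dl : R) : entire K -> hasder G0 (fun z => K z * Cexp (Ci * om * z))%C ->
  e ^ 2 = 1 -> 0 < p -> 0 < q -> p ^ 2 + q ^ 2 = 1 -> 0 < om -> kap < om * q -> 0 <= kap -> 0 <= A ->
  (forall z, Cmod (K z) <= A * exp (kap * Cmod z)) -> 0 <= m ->
  (forall r, 0 <= r -> Cmod (K (RtoC (e * r))) <= m * rb r) -> A * (1 + 4 / (om * q - kap) ^ 2) <= m ->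
  0 < X -> 0 < dl ->
  Cmod (G0 (RtoC (e * X)) - G0 (RtoC X * (e * p, q)%R)%C) <= 32 * m * sqrt dl + 4 * A * X * exp (kap * X - dl * p * X ^ 2).
Proof.
  intros HK HG He Hp Hq Hpq Hom Hkq Hkap HA Hgr Hm Hline HmA HX Hdl.
  set (b := ((e * p, q)%R : C)). set (c := ((p, - (e * q))%R : C)).
  assert (Hb1 : Cmod b = 1).
  { unfold b, Cmod; simpl. transitivity (sqrt 1); [f_equal|apply sqrt_1]. transitivity (e ^ 2 * p ^ 2 + q ^ 2); [ring|rewrite He; lra]. }
  assert (Hc1 : Cmod c = 1).
  { unfold c, Cmod; simpl. transitivity (sqrt 1); [f_equal|apply sqrt_1]. transitivity (p ^ 2 + e ^ 2 * q ^ 2); [ring|rewrite He; lra]. }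
  set (Phi := fun z => (K z * Cexp (Ci * om * z))%C) in *.
  set (ga := fun z => Cexp (- (RtoC dl * c * (z * z)))%C).
  assert (EPd : entire (fun z => Phi z * ga z)%C).
  { intros z. destruct (entire_cder K HK z) as [l Hl]. eexists. apply is_derive_cder.
    apply cder_mult; [apply cder_mult; [exact Hl|apply cder_Cexp_comp, cder_scal, cder_id]|].
    unfold ga. apply (cder_Cexp_comp (fun z => - (RtoC dl * c * (z * z)))%C).
    apply cder_ext with (fun z => (- (RtoC dl * c)) * (z * z))%C; [intros; ring|].
    apply cder_scal, cder_mult; apply cder_id. }
  destruct (entire_primitive _ EPd) as [Gd HGd].
  assert (HD : hasder (fun z => G0 z - Gd z)%C (fun z => Phi z * (1 - ga z))%C).
  { intros z. eapply cder_eq; [|apply cder_minus; [apply HG|apply HGd]]. fold Phi. unfold Phi. ring. }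
  assert (Hsd : 0 < sqrt dl) by (apply sqrt_lt_R0; auto).
  assert (Gmod : forall z : C, Cmod (Phi z) <= A * exp (kap * Cmod z - om * snd z)).
  { intros z. unfold Phi. rewrite Cmod_mult, Cmod_Cexp.
    replace (fst (Ci * om * z)%C) with (- (om * snd z)) by (destruct z; simpl; ring).
    unfold Rminus. rewrite exp_plus, <- Rmult_assoc. apply Rmult_le_compat_r; [apply Rlt_le, exp_pos|auto]. }
  (* On a ray where [Phi] is dominated by [rb] and the Gaussian does not grow, damping changes the
     integral from 0 by at most [O(sqrt dl)]. This applies to both sides of the sector: [c * d^2] is
     [c] for [d = e] and [e * b] for [d = b], each with real part [p]. *)
  assert (Dom : forall d : C, Cmod d = 1 -> (forall r, 0 <= r -> Cmod (Phi (RtoC r * d)%C) <= m * rb r) ->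
     0 <= fst (c * (d * d))%C -> Cmod ((G0 (RtoC X * d)%C - Gd (RtoC X * d)%C) - (G0 0%C - Gd 0%C))%C <= 16 * m * sqrt dl).
  { intros d Hd1 Hd Hcd.
    assert (P := path_dominated _ _ 0%C d (fun r => 4 * m * sqrt dl * atan (sqrt dl * r)) (fun r => 4 * m * dl * / (1 + (sqrt dl * r) ^ 2)) X HD ltac:(lra)).
    replace (0 + X * d)%C with (RtoC X * d)%C in P by ring.
    rewrite Rmult_0_r, atan_0, Rmult_0_r, Rminus_0_r in P.
    eapply Rle_trans; [apply P|].
    - intros r. auto_derive; auto. rewrite <- (sqrt_sqrt dl) at 5 by lra. field. generalize (pow2_ge_0 (sqrt dl * r)); simpl; nra.
    - intros r Hr. replace (0 + r * d)%C with (RtoC r * d)%C by ring.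
      rewrite Cmod_mult, Hd1, Rmult_1_r. unfold ga.
      replace (- (RtoC dl * c * (RtoC r * d * (RtoC r * d))))%C with (- (RtoC (dl * r ^ 2) * (c * (d * d))))%C.
      2:{ rewrite RtoC_mult, RtoC_pow. ring. }
      apply gauss_diff_bound; auto. apply Hd; lra. rewrite !Cmod_mult, Hc1, Hd1; ring.
    - assert (B := atan_bound (sqrt dl * X)). assert (HP := PI_4).
      assert (0 <= m * sqrt dl) by nra. nra. }
  assert (Dom1 := Dom (RtoC e)). assert (Dom2 := Dom b).
  replace (RtoC (e * X)) with (RtoC X * RtoC e)%C by (rewrite <- RtoC_mult; f_equal; ring).
  assert (T1 : Cmod ((G0 (RtoC X * RtoC e)%C - Gd (RtoC X * RtoC e)%C) - (G0 0%C - Gd 0%C))%C <= 16 * m * sqrt dl).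
  { apply Dom1.
    - rewrite Cmod_R. apply Rsqr_inj; [apply Rabs_pos|lra|]. rewrite <- Rsqr_abs. unfold Rsqr. lra.
    - intros r Hr. rewrite <- RtoC_mult. unfold Phi. rewrite Cmod_mult, Cmod_Cexp.
      replace (fst (Ci * om * RtoC (r * e))%C) with 0 by (simpl; ring). rewrite exp_0, Rmult_1_r, (Rmult_comm r). auto.
    - unfold c; simpl. nra. }
  assert (T2 : Cmod ((G0 (RtoC X * b)%C - Gd (RtoC X * b)%C) - (G0 0%C - Gd 0%C))%C <= 16 * m * sqrt dl).
  { apply Dom2; auto.
    - intros r Hr. eapply Rle_trans; [apply Gmod|].
      rewrite Cmod_mult, Cmod_R, Hb1, Rabs_pos_eq, Rmult_1_r by auto.
      replace (snd (RtoC r * b)%C) with (r * q) by (unfold b; simpl; ring).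
      replace (kap * r - om * (r * q)) with (- (om * q - kap) * r) by ring.
      apply Rle_trans with (A * ((1 + 4 / (om * q - kap) ^ 2) * rb r)).
      + apply Rmult_le_compat_l; auto. apply exp_rb; lra.
      + rewrite <- Rmult_assoc. apply Rmult_le_compat_r; auto. apply Rlt_le, rb_pos.
    - unfold c, b; simpl.
      replace (p * (e * p * (e * p) - q * q) - - (e * q) * (e * p * q + q * (e * p)))
        with (e ^ 2 * (p * (p ^ 2 + q ^ 2)) + (e ^ 2 - 1) * (p * q ^ 2)) by ring.
      rewrite He, Hpq. lra. }
  (* The ends of the two rays are joined by a segment, on all of which the Gaussian is at most
     [exp (- dl p X^2)]. *)
  assert (T3 : Cmod (Gd (RtoC X * b)%C - Gd (RtoC X * RtoC e)%C) <= 4 * A * X * exp (kap * X - dl * p * X ^ 2)).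
  { eapply Rle_trans; [apply (segment_bound Gd _ _ _ (A * exp (kap * X - dl * p * X ^ 2)) HGd)|].
    - intros t Ht.
      replace (RtoC X * RtoC e + t * (RtoC X * b - RtoC X * RtoC e))%C with (RtoC X * (RtoC e * RtoC (1 - t) + t * b))%C
        by (rewrite RtoC_minus; ring).
      set (y := (RtoC e * RtoC (1 - t) + t * b)%C).
      assert (Hy : Cmod y <= 1).
      { unfold y. eapply Rle_trans; [apply Cmod_triangle|]. rewrite !Cmod_mult, !Cmod_R, Hb1.
        rewrite (Rabs_pos_eq t), (Rabs_pos_eq (1 - t)) by lra.
        assert (Rabs e = 1). { apply Rsqr_inj; [apply Rabs_pos|lra|]. rewrite <- Rsqr_abs. unfold Rsqr. lra. }
        rewrite H. lra. }
      rewrite Cmod_mult. unfold ga. rewrite Cmod_Cexp.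
      unfold Rminus. rewrite exp_plus, <- Rmult_assoc.
      apply Rmult_le_compat; [apply Cmod_ge_0|apply Rlt_le, exp_pos| |].
      + eapply Rle_trans; [apply Gmod|]. apply Rmult_le_compat_l; auto. apply exp_le.
        rewrite Cmod_mult, Cmod_R, Rabs_pos_eq by lra.
        replace (snd (RtoC X * y)%C) with (X * (t * q)) by (unfold y, b; simpl; ring).
        assert (0 <= om * (X * (t * q))) by (repeat apply Rmult_le_pos; lra).
        assert (X * Cmod y <= X) by nra. assert (kap * (X * Cmod y) <= kap * X) by (apply Rmult_le_compat_l; lra). lra.
      + apply exp_le.
        replace (fst (- (RtoC dl * c * (RtoC X * y * (RtoC X * y))))%C) with
          (- (dl * X ^ 2 * (p * ((1 - t) ^ 2 + t ^ 2) + 2 * t * (1 - t)))).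
        * assert (p <= 1) by nra.
          assert (p <= p * ((1 - t) ^ 2 + t ^ 2) + 2 * t * (1 - t)).
          { assert (0 <= t * (1 - t) * (1 - p)) by (repeat apply Rmult_le_pos; lra). nra. }
          assert (0 <= dl * X ^ 2) by (apply Rmult_le_pos; [lra|apply pow2_ge_0]). nra.
        * unfold y, c, b. simpl.
          transitivity (- (dl * X ^ 2 * (e ^ 2 * (p * ((1 - t) ^ 2 + p ^ 2 * t ^ 2 + 2 * (1 - t) * t * p) + 2 * q ^ 2 * t * ((1 - t) + p * t)) - p * q ^ 2 * t ^ 2))); [|ring].
          rewrite He. replace (q ^ 2) with (1 - p ^ 2) by lra. ring.
    - replace (RtoC X * b - RtoC X * RtoC e)%C with (RtoC X * (b - RtoC e))%C by ring.
      rewrite Cmod_mult, Cmod_R, (Rabs_pos_eq X) by lra.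
      assert (Cmod (b - RtoC e) <= 2).
      { eapply Rle_trans; [apply Cmod_triangle|]. rewrite Cmod_opp, Hb1, Cmod_R.
        assert (Rabs e = 1). { apply Rsqr_inj; [apply Rabs_pos|lra|]. rewrite <- Rsqr_abs. unfold Rsqr. lra. } lra. }
      assert (0 <= A * exp (kap * X - dl * p * X ^ 2)) by (apply Rmult_le_pos; [auto|apply Rlt_le, exp_pos]).
      set (E := A * exp (kap * X - dl * p * X ^ 2)) in *.
      replace (4 * A * X * exp (kap * X - dl * p * X ^ 2)) with (2 * (E * (X * 2))) by (unfold E; ring).
      apply Rmult_le_compat_l; [lra|]. apply Rmult_le_compat_l; auto. apply Rmult_le_compat_l; lra. }
  set (g1 := G0 (RtoC X * RtoC e)%C) in *. set (d1 := Gd (RtoC X * RtoC e)%C) in *.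
  set (g2 := G0 (RtoC X * b)%C) in *. set (d2 := Gd (RtoC X * b)%C) in *.
  set (o := (G0 0%C - Gd 0%C)%C) in *.
  replace (g1 - g2)%C with ((g1 - d1 - o) + - (g2 - d2 - o) + - (d2 - d1))%C by ring.
  eapply Rle_trans; [apply Cmod_triangle|]. eapply Rle_trans; [apply Rplus_le_compat_r, Cmod_triangle|].
  rewrite !Cmod_opp. lra.
Qed.

Lemma hasder_real G g : hasder G g -> forall x : R,
  is_derive (fun x : R => fst (G (RtoC x))) x (fst (g (RtoC x))) /\
  is_derive (fun x : R => snd (G (RtoC x))) x (snd (g (RtoC x))).
Proof.
  intros H x. assert (P := cder_path G 0 1 x (g (RtoC x))).
  assert (E : forall t : R, (0 + t * 1)%C = RtoC t) by (intros; ring).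
  rewrite E in P. destruct (P (H _)) as [P1 P2]. replace (g (RtoC x) * 1)%C with (g (RtoC x)) in * by ring.
  split; [apply is_derive_ext with (2 := P1)|apply is_derive_ext with (2 := P2)]; intros t; rewrite E; auto.
Qed.

Lemma entire_real_cont F : entire F -> cont (fun x => fst (F (RtoC x))) /\ cont (fun x => snd (F (RtoC x))).
Proof.
  intros H. destruct (entire_cont F H) as [C1 C2]. split.
  - exact (cont2_slice1 _ 0 C1).
  - exact (cont2_slice1 _ 0 C2).
Qed.

Lemma rb_le_inv X : 0 < X -> rb X * X <= / X.
Proof.
  intros HX. unfold rb. rewrite Rmult_1_l, Rmult_comm. apply Rle_div_l; [nra|].
  rewrite Rmult_comm. apply Rle_div_r; [lra|]. nra.
Qed.

Lemma growth_const_pos K A kap : (forall z, Cmod (K z) <= A * exp (kap * Cmod z)) -> 0 <= A.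
Proof.
  intros H. specialize (H 0%C). rewrite Cmod_0, Rmult_0_r, exp_0, Rmult_1_r in H. generalize (Cmod_ge_0 (K 0%C)); lra.
Qed.

(** [kap] lies midway between the type and [om], and [q] midway between [kap / om] and 1, so that
    [om * q > kap] and [K z * Cexp (Ci * om * z)] decays along the two rays. The choices [X = Y^4]
    and [dl = / Y^2] make [sqrt dl] tend to 0 while [dl * X = Y^2] tends to infinity, so the
    Gaussian beats [exp (kap * X)]. *)
Lemma ft_vanish K kap0 c om : entire K -> exp_type_le K kap0 -> 0 <= kap0 -> 0 <= c ->
  (forall x, Cmod (K (RtoC x)) <= c * rb x) -> kap0 < om ->
  exists D Y0, 1 <= Y0 /\ forall Y, Y0 <= Y ->
    Rabs (RI (fun x => fst (K (RtoC x) * Cexp (Ci * om * x))%C) (- Y ^ 4) (Y ^ 4)) <= D / Y /\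
    Rabs (RI (fun x => snd (K (RtoC x) * Cexp (Ci * om * x))%C) (- Y ^ 4) (Y ^ 4)) <= D / Y.
Proof.
  intros HK Hty Hk0 Hc Hline Hom.
  destruct (Hty ((om - kap0) / 2) ltac:(lra)) as [A HA].
  replace (kap0 + (om - kap0) / 2) with ((kap0 + om) / 2) in HA by field.
  set (kap := (kap0 + om) / 2) in *.
  assert (HA0 := growth_const_pos _ _ _ HA).
  assert (Hom0 : 0 < om) by lra. assert (Hkap : 0 <= kap < om) by (unfold kap; lra).
  set (q := (1 + kap / om) / 2).
  assert (Hko : 0 <= kap / om < 1) by (split; [apply Rdiv_le_0_compat; lra|apply Rlt_div_l; lra]).
  assert (Hq : 0 < q < 1) by (unfold q; lra).
  assert (Hoq : kap < om * q) by (unfold q; replace (om * ((1 + kap / om) / 2)) with ((om + kap) / 2) by (field; lra); lra).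
  set (p := sqrt (1 - q ^ 2)).
  assert (Hp : 0 < p) by (apply sqrt_lt_R0; nra).
  assert (Hpq : p ^ 2 + q ^ 2 = 1) by (unfold p; rewrite pow2_sqrt; nra).
  set (sg := om * q - kap). set (m := c + A * (1 + 4 / sg ^ 2)).
  assert (Hsg : 0 < sg) by (unfold sg; lra).
  assert (Hs2 : 0 < 4 / sg ^ 2) by (apply Rdiv_lt_0_compat; nra).
  assert (HmA : 0 <= A * (1 + 4 / sg ^ 2)) by nra.
  assert (Hm : 0 <= m) by (unfold m; lra).
  assert (EP : entire (fun z => K z * Cexp (Ci * om * z))%C).
  { intros z. destruct (entire_cder K HK z) as [l Hl]. eexists. apply is_derive_cder.
    apply cder_mult; [exact Hl|apply cder_Cexp_comp, cder_scal, cder_id]. }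
  destruct (entire_primitive _ EP) as [G HG].
  set (Y0 := 1 + (kap + 2) / p).
  assert (Hkp : 0 < (kap + 2) / p) by (apply Rdiv_lt_0_compat; lra).
  exists (68 * m + 8 * A), Y0. split; [unfold Y0; lra|]. intros Y HY.
  assert (HY1 : 1 <= Y) by (unfold Y0 in HY; lra).
  set (X := Y ^ 4). assert (HY2 : 1 <= Y ^ 2) by nra.
  assert (HX : Y <= X). { unfold X. replace (Y ^ 4) with (Y * (Y ^ 2 * Y)) by ring. assert (1 <= Y ^ 2 * Y) by nra. nra. }
  set (dl := / Y ^ 2). assert (Hdl : 0 < dl) by (apply Rinv_0_lt_compat; lra).
  assert (Esd : sqrt dl = / Y).
  { unfold dl. replace (Y ^ 2) with (Y * Y) by ring. rewrite Rinv_mult. apply sqrt_square. apply Rlt_le, Rinv_0_lt_compat; lra. }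
  assert (Hexp : X * exp (kap * X - dl * p * X ^ 2) <= / Y).
  { assert (E : dl * p * X ^ 2 = p * Y ^ 2 * X) by (unfold dl, X; field; lra). rewrite E.
    assert (Hb : kap + 2 <= p * Y ^ 2).
    { assert ((kap + 2) / p <= Y ^ 2) by (unfold Y0 in HY; nra). apply (Rle_div_l (kap + 2) (Y ^ 2) p) in H; [lra|auto]. }
    apply Rle_trans with (X * exp (- X + - X)).
    - apply Rmult_le_compat_l; [lra|]. apply exp_le. nra.
    - rewrite exp_plus, !exp_Ropp. assert (Ex := exp_ineq1_le X).
      apply Rle_trans with (/ exp X).
      + rewrite <- Rmult_assoc. apply Rle_trans with (1 * / exp X); [|lra].
        apply Rmult_le_compat_r; [apply Rlt_le, Rinv_0_lt_compat, exp_pos|]. apply Rle_div_l; [apply exp_pos|lra].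
      + apply Rinv_le_contravar; lra. }
  assert (R1 := rotate_ray K G 1 p q A kap om m X dl HK HG ltac:(ring) Hp ltac:(lra) Hpq Hom0 Hoq ltac:(lra) HA0 HA Hm
    ltac:(intros r _; rewrite Rmult_1_l; eapply Rle_trans; [apply Hline|]; apply Rmult_le_compat_r; [apply Rlt_le, rb_pos|unfold m; lra])
    ltac:(unfold m, sg; unfold sg in *; lra) ltac:(lra) Hdl).
  assert (Erb : forall r, rb (-1 * r) = rb r) by (intros; unfold rb; do 2 f_equal; ring).
  assert (R2 := rotate_ray K G (-1) p q A kap om m X dl HK HG ltac:(ring) Hp ltac:(lra) Hpq Hom0 Hoq ltac:(lra) HA0 HA Hm
    ltac:(intros r _; rewrite <- Erb; eapply Rle_trans; [apply Hline|]; apply Rmult_le_compat_r; [apply Rlt_le, rb_pos|unfold m; lra])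
    ltac:(unfold m, sg; unfold sg in *; lra) ltac:(lra) Hdl).
  rewrite Esd in R1, R2.
  set (bp := ((1 * p, q)%R : C)) in *. set (bm := ((-1 * p, q)%R : C)) in *.
  assert (Hb1 : forall t, 0 <= t <= 1 -> Cmod ((-1 * p + t * (2 * p), q)%R : C) <= 1).
  { intros t Ht. unfold Cmod; simpl. apply Rle_trans with (sqrt 1); [apply sqrt_le_1_alt|rewrite sqrt_1; lra].
    assert (0 <= t * (1 - t) * p ^ 2) by (repeat apply Rmult_le_pos; try lra; nra). nra. }
  (* The ends of the two rays lie at the same height [X * q]; along the horizontal segment between
     them the integrand is already exponentially small. *)
  assert (R3 : Cmod (G (RtoC X * bp)%C - G (RtoC X * bm)%C) <= 4 * m * / Y).
  { eapply Rle_trans; [apply (segment_bound G _ _ _ (m * rb X) HG)|].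
    - intros t Ht. rewrite Cmod_mult, Cmod_Cexp.
      replace (RtoC X * bm + t * (RtoC X * bp - RtoC X * bm))%C with (RtoC X * ((-1 * p + t * (2 * p), q)%R : C))%C.
      2:{ unfold bm, bp. apply injective_projections; simpl; ring. }
      set (y := ((-1 * p + t * (2 * p), q)%R : C)).
      replace (fst (Ci * om * (RtoC X * y))%C) with (- (om * q) * X) by (unfold y; simpl; ring).
      apply Rle_trans with (A * exp (kap * X) * exp (- (om * q) * X)).
      + apply Rmult_le_compat_r; [apply Rlt_le, exp_pos|]. eapply Rle_trans; [apply HA|].
        apply Rmult_le_compat_l; auto. apply exp_le. rewrite Cmod_mult, Cmod_R, Rabs_pos_eq by lra.
        specialize (Hb1 t Ht). fold y in Hb1. apply Rmult_le_compat_l; [lra|]. nra.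
      + rewrite Rmult_assoc, <- exp_plus. replace (kap * X + - (om * q) * X) with (- sg * X) by (unfold sg; ring).
        apply Rle_trans with (A * ((1 + 4 / sg ^ 2) * rb X)).
        * apply Rmult_le_compat_l; auto. apply exp_rb; lra.
        * rewrite <- Rmult_assoc. apply Rmult_le_compat_r; [apply Rlt_le, rb_pos|unfold m; lra].
    - replace (RtoC X * bp - RtoC X * bm)%C with (RtoC (X * (2 * p))).
      2:{ unfold bm, bp. apply injective_projections; simpl; ring. }
      rewrite Cmod_R, Rabs_pos_eq by nra. assert (p <= 1) by nra.
      assert (Hrb := rb_le_inv X ltac:(lra)). assert (/ X <= / Y) by (apply Rinv_le_contravar; lra).
      assert (0 < rb X) by apply rb_pos.
      replace (2 * (m * rb X * (X * (2 * p)))) with (4 * m * ((rb X * X) * p)) by ring.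
      apply Rmult_le_compat_l; [lra|]. assert (0 <= rb X * X) by nra. nra. }
  assert (HYi : 0 < / Y) by (apply Rinv_0_lt_compat; lra).
  assert (Tot : Cmod (G (RtoC X) - G (RtoC (- X)))%C <= (68 * m + 8 * A) / Y).
  { rewrite Rmult_1_l in R1. replace (-1 * X) with (- X) in R2 by ring.
    replace (G (RtoC X) - G (RtoC (- X)))%C with ((G (RtoC X) - G (RtoC X * bp)) + (G (RtoC X * bp) - G (RtoC X * bm)) + - (G (RtoC (- X)) - G (RtoC X * bm)))%C by ring.
    eapply Rle_trans; [apply Cmod_triangle|]. eapply Rle_trans; [apply Rplus_le_compat_r, Cmod_triangle|]. rewrite Cmod_opp.
    assert (4 * A * X * exp (kap * X - dl * p * X ^ 2) <= 4 * A * / Y).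
    { rewrite (Rmult_assoc (4 * A)). apply Rmult_le_compat_l; lra. }
    unfold Rdiv. lra. }
  assert (HR := hasder_real G _ HG). destruct (entire_real_cont _ EP) as [C1 C2].
  split.
  - rewrite (RI_FTC (fun x => fst (G (RtoC x)))); [|intros x; apply HR|exact C1].
    eapply Rle_trans; [|exact Tot]. exact (Cmod_fst (G (RtoC X) - G (RtoC (- X)))%C).
  - rewrite (RI_FTC (fun x => snd (G (RtoC x)))); [|intros x; apply HR|exact C2].
    eapply Rle_trans; [|exact Tot]. exact (Cmod_snd (G (RtoC X) - G (RtoC (- X)))%C).
Qed.

Lemma entire_neg K : entire K -> entire (fun z => K (- z)%C).
Proof.
  intros HK z. destruct (entire_cder K HK (- (1) * z)%C) as [l Hl]. eexists. apply is_derive_cder.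
  apply cder_ext with (fun w => K (- (1) * w)%C); [intros w; f_equal; ring|]. apply cder_lin, Hl.
Qed.

Lemma exp_type_neg K kap : exp_type_le K kap -> exp_type_le (fun z => K (- z)%C) kap.
Proof.
  intros H eps He. destruct (H eps He) as [A HA]. exists A; intros z. rewrite <- (Cmod_opp z). apply HA.
Qed.

(** [ft_vanish] for [K z] and for [K (- z)] controls the combinations [u cos - v sin],
    [u sin + v cos] and the same with the other signs; sums and differences isolate the four
    integrals from which the transforms of [u] and [v] are made, for either sign of [t]. *)
Lemma htr_vanish K a c : entire K -> exp_type_le K (2 * PI * a) -> 0 < a -> 0 <= c ->
  (forall x, Cmod (K (RtoC x)) <= c * rb x) -> forall t, a < Rabs t ->
  htr (fun x => fst (K (RtoC x))) t = 0 /\ htr (fun x => snd (K (RtoC x))) t = 0.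
Proof.
  intros HK Hty Ha Hc Hline t Ht. generalize PI_RGT_0; intros HPI.
  destruct (entire_real_cont K HK) as [C1 C2].
  set (u := fun x => fst (K (RtoC x))) in *. set (v := fun x => snd (K (RtoC x))) in *.
  set (om := 2 * PI * Rabs t). assert (Hom : 2 * PI * a < om) by (unfold om; nra).
  assert (Hk0 : 0 <= 2 * PI * a) by nra.
  assert (Hu : forall x, Rabs (u x) <= c * rb x) by (intros x; eapply Rle_trans; [apply Cmod_fst|apply Hline]).
  assert (Hv : forall x, Rabs (v x) <= c * rb x) by (intros x; eapply Rle_trans; [apply Cmod_snd|apply Hline]).
  destruct (ft_vanish K _ c om HK Hty Hk0 Hc Hline Hom) as [D1 [Y1 [HY1 K1]]].
  assert (Hline' : forall x, Cmod (K (- RtoC x)%C) <= c * rb x).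
  { intros x. rewrite <- RtoC_opp. replace (rb x) with (rb (- x)) by (unfold rb; do 2 f_equal; ring). apply Hline. }
  destruct (ft_vanish _ _ c om (entire_neg K HK) (exp_type_neg K _ Hty) Hk0 Hc Hline' Hom) as [D2 [Y2 [HY2 K2]]].
  set (Y0 := Rmax Y1 Y2). assert (HYa : Y1 <= Y0) by apply Rmax_l. assert (HYb : Y2 <= Y0) by apply Rmax_r.
  assert (W : forall Y, Y0 <= Y ->
    Rabs (RI (fun x => u x * cos (om * x)) (- Y ^ 4) (Y ^ 4)) <= (D1 + D2) / Y /\
    Rabs (RI (fun x => u x * sin (om * x)) (- Y ^ 4) (Y ^ 4)) <= (D1 + D2) / Y /\
    Rabs (RI (fun x => v x * cos (om * x)) (- Y ^ 4) (Y ^ 4)) <= (D1 + D2) / Y /\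
    Rabs (RI (fun x => v x * sin (om * x)) (- Y ^ 4) (Y ^ 4)) <= (D1 + D2) / Y).
  { intros Y HY. destruct (K1 Y ltac:(lra)) as [A1 A2]. destruct (K2 Y ltac:(lra)) as [A3 A4]. set (X := Y ^ 4) in *.
    assert (Ex : forall x : R, Cexp (Ci * om * x) = (cos (om * x), sin (om * x))).
    { intros x. unfold Cexp. replace (fst (Ci * om * x)%C) with 0 by (simpl; ring).
      replace (snd (Ci * om * x)%C) with (om * x) by (simpl; ring). rewrite exp_0. f_equal; ring. }
    rewrite (RI_ext _ (fun x => u x * cos (om * x) - v x * sin (om * x))) in A1 by (intros; rewrite Ex; reflexivity).
    rewrite (RI_ext _ (fun x => u x * sin (om * x) + v x * cos (om * x))) in A2 by (intros; rewrite Ex; reflexivity).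
    rewrite (RI_ext _ (fun x => (fun y => u y * cos (om * y) + v y * sin (om * y)) (- x))) in A3.
    2:{ intros x. rewrite Ex. cbv beta. replace (om * - x) with (- (om * x)) by ring. rewrite cos_neg, sin_neg.
        unfold u, v. rewrite RtoC_opp. simpl. ring. }
    rewrite (RI_ext _ (fun x => (fun y => - (u y * sin (om * y)) + v y * cos (om * y)) (- x))) in A4.
    2:{ intros x. rewrite Ex. cbv beta. replace (om * - x) with (- (om * x)) by ring. rewrite cos_neg, sin_neg.
        unfold u, v. rewrite RtoC_opp. simpl. ring. }
    rewrite (RI_neg (fun y => u y * cos (om * y) + v y * sin (om * y))), Ropp_involutive in A3 by cont.
    rewrite (RI_neg (fun y => - (u y * sin (om * y)) + v y * cos (om * y))), Ropp_involutive in A4 by cont.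
    rewrite RI_minus in A1 by cont. rewrite RI_plus in A2, A3, A4 by cont. rewrite RI_opp in A4 by cont.
    replace ((D1 + D2) / Y) with (D1 / Y + D2 / Y) by (unfold Rdiv; ring).
    apply Rabs_le_between in A1, A2, A3, A4.
    split; [|split; [|split]]; apply Rabs_le; lra. }
  assert (Hfin : forall w, cont w -> (forall x, Rabs (w x) <= c * rb x) -> (forall Y, Y0 <= Y ->
    Rabs (RI (fun x => w x * cos (om * x)) (- Y ^ 4) (Y ^ 4)) <= (D1 + D2) / Y /\
    Rabs (RI (fun x => w x * sin (om * x)) (- Y ^ 4) (Y ^ 4)) <= (D1 + D2) / Y) -> htr w t = 0).
  { intros w Cw Hw Kw.
    assert (HD : 0 <= D1 + D2).
    { destruct (Kw Y0 ltac:(lra)) as [Q _]. assert (Q' := Rabs_pos (RI (fun x => w x * cos (om * x)) (- Y0 ^ 4) (Y0 ^ 4))).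
      assert (Q2 : 0 <= (D1 + D2) / Y0) by lra. apply Rmult_le_compat_r with (r := Y0) in Q2; [|lra].
      replace ((D1 + D2) / Y0 * Y0) with (D1 + D2) in Q2 by (field; lra). lra. }
    assert (Z : Rabs (htr w t) <= 0).
    { apply (le_of_le_inv _ _ (4 * c + 2 * (D1 + D2))); [lra|]. intros P HP. rewrite Rplus_0_l.
      set (Y := Rmax P Y0). assert (HYP : P <= Y) by apply Rmax_l. assert (HYY : Y0 <= Y) by apply Rmax_r.
      destruct (Kw Y HYY) as [B1 B2].
      assert (HX : Y <= Y ^ 4). { replace (Y ^ 4) with (Y * (Y ^ 2 * Y)) by ring. assert (1 <= Y ^ 2) by nra. assert (1 <= Y ^ 2 * Y) by nra. nra. }
      assert (S := htr_spec w c t (Y ^ 4) Cw Hc Hw ltac:(lra)).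
      assert (E : Rabs (ctr w (Y ^ 4) t) <= 2 * ((D1 + D2) / Y)).
      { unfold ctr, cas. destruct (Rle_dec 0 t) as [Ht0|Ht0].
        - rewrite (RI_ext _ (fun x => w x * cos (om * x) + w x * sin (om * x))).
          2:{ intros x. unfold om. rewrite Rabs_pos_eq by auto. replace (2 * PI * x * t) with (2 * PI * t * x) by ring. ring. }
          rewrite RI_plus by cont. eapply Rle_trans; [apply Rabs_triang|]. lra.
        - rewrite (RI_ext _ (fun x => w x * cos (om * x) - w x * sin (om * x))).
          2:{ intros x. unfold om. rewrite Rabs_left by lra. replace (2 * PI * x * t) with (- (2 * PI * - t * x)) by ring. rewrite cos_neg, sin_neg. ring. }
          rewrite RI_minus by cont. eapply Rle_trans; [apply Rabs_triang|]. rewrite Rabs_Ropp. lra. }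
      assert (I1 : / Y ^ 4 <= / P) by (apply Rinv_le_contravar; lra). assert (I2 : / Y <= / P) by (apply Rinv_le_contravar; lra).
      replace (htr w t) with ((htr w t - ctr w (Y ^ 4) t) + ctr w (Y ^ 4) t) by ring.
      eapply Rle_trans; [apply Rabs_triang|].
      apply Rle_trans with (4 * c * / Y ^ 4 + 2 * (D1 + D2) * / Y); [unfold Rdiv in *; lra|].
      unfold Rdiv. rewrite Rmult_plus_distr_r. apply Rplus_le_compat; apply Rmult_le_compat_l; lra. }
    destruct (Req_dec (htr w t) 0) as [|N]; auto. apply Rabs_pos_lt in N. lra. }
  split; apply Hfin; auto; intros Y HY; destruct (W Y HY) as [W1 [W2 [W3 W4]]]; auto.
Qed.

(** * Band-limited functions given by their transform *)

Definition CI (g : R -> C) (a b : R) : C := (RI (fun t => fst (g t)) a b, RI (fun t => snd (g t)) a b).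

Definition ccont (g : R -> C) : Prop := cont (fun t => fst (g t)) /\ cont (fun t => snd (g t)).

Lemma CI_minus g h a b : ccont g -> ccont h -> CI (fun t => g t - h t)%C a b = (CI g a b - CI h a b)%C.
Proof.
  intros [H1 H2] [H3 H4]. apply injective_projections; simpl.
  - exact (RI_minus _ _ a b H1 H3).
  - exact (RI_minus _ _ a b H2 H4).
Qed.

Lemma CI_scal c g a b : ccont g -> CI (fun t => c * g t)%C a b = (c * CI g a b)%C.
Proof.
  intros [H1 H2]. apply injective_projections; simpl.
  - rewrite RI_minus, !RI_scal by cont. auto.
  - rewrite RI_plus, !RI_scal by cont. auto.
Qed.

Lemma CI_bound g B a b : a <= b -> ccont g -> (forall t, a <= t <= b -> Cmod (g t) <= B) -> Cmod (CI g a b) <= 2 * ((b - a) * B).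
Proof.
  intros Hab [H1 H2] Hb. eapply Rle_trans; [apply Cmod_le_add|].
  assert (K1 : Rabs (RI (fun t => fst (g t)) a b) <= (b - a) * B).
  { apply RI_abs_const; auto. intros t Ht. eapply Rle_trans; [apply Cmod_fst|auto]. }
  assert (K2 : Rabs (RI (fun t => snd (g t)) a b) <= (b - a) * B).
  { apply RI_abs_const; auto. intros t Ht. eapply Rle_trans; [apply Cmod_snd|auto]. }
  lra.
Qed.

Lemma ccont_mult g h : ccont g -> ccont h -> ccont (fun t => g t * h t)%C.
Proof. intros [H1 H2] [H3 H4]; split; simpl; cont. Qed.

Lemma ccont_minus g h : ccont g -> ccont h -> ccont (fun t => g t - h t)%C.
Proof. intros [H1 H2] [H3 H4]; split; simpl; cont. Qed.

Lemma ccont_RtoC f : cont f -> ccont (fun t => RtoC (f t)).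
Proof. intros H; split; simpl; cont. Qed.

Lemma ccont_line E E1 (d : C) : hasder E E1 -> ccont (fun t => E (t * d)%C).
Proof.
  intros H.
  assert (Z : forall t : R, (0 + t * d)%C = (t * d)%C) by (intros; ring).
  split.
  - apply cont_derive with (fun t : R => fst (E1 (0 + t * d) * d)%C). intros t.
    eapply is_derive_ext; [|apply (cder_path E 0%C d t), H]. intros s; simpl; rewrite Z; auto.
  - apply cont_derive with (fun t : R => snd (E1 (0 + t * d) * d)%C). intros t.
    eapply is_derive_ext; [|apply (cder_path E 0%C d t), H]. intros s; simpl; rewrite Z; auto.
Qed.

Lemma taylor2 E E1 E2 (z w : C) B : hasder E E1 -> hasder E1 E2 -> 0 <= B ->
  (forall y, Cmod y <= Cmod z + Cmod (w - z) -> Cmod (E2 y) <= B) ->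
  Cmod (E w - E z - E1 z * (w - z)) <= 4 * B * Cmod (w - z) ^ 2.
Proof.
  intros H1 H2 HB Hb.
  assert (HD : hasder (fun y => E y - E1 z * y)%C (fun y => E1 y - E1 z)%C).
  { intros y. eapply cder_eq; [|apply cder_minus; [apply H1|apply cder_scal, cder_id]]. ring. }
  assert (K := segment_bound _ _ z w (2 * (B * Cmod (w - z))) HD).
  replace (E w - E z - E1 z * (w - z))%C with (E w - E1 z * w - (E z - E1 z * z))%C by ring.
  replace (4 * B * Cmod (w - z) ^ 2) with (2 * (2 * (B * Cmod (w - z)) * Cmod (w - z))) by ring.
  apply K. intros t Ht.
  assert (Hn := Cmod_ge_0 (w - z)).
  eapply Rle_trans; [apply (segment_bound E1 E2 z _ B H2)|].
  - intros s Hs. apply Hb. replace (z + s * (z + t * (w - z) - z))%C with (z + RtoC (s * t) * (w - z))%C by (rewrite RtoC_mult; ring).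
    eapply Rle_trans; [apply Cmod_triangle|]. rewrite Cmod_mult, Cmod_R, Rabs_pos_eq by nra.
    apply Rplus_le_compat_l. rewrite <- (Rmult_1_l (Cmod (w - z))) at 2. apply Rmult_le_compat_r; auto. nra.
  - replace (z + t * (w - z) - z)%C with (t * (w - z))%C by ring. rewrite Cmod_mult, Cmod_R, Rabs_pos_eq by lra. 
    apply Rmult_le_compat_l; [lra|]. apply Rmult_le_compat_l; auto. nra.
Qed.

(** The kernel is a parameter because the derivative of a transform with kernel [Ccas] is one with
    kernel [Csac]: [hasder_TE], used once more, shows that this derivative is itself entire. *)
Definition TE (E : C -> C) (a : R) (f : R -> R) (z : C) : C :=
  CI (fun t => RtoC (f t) * E (t * (RtoC (2 * PI) * z)))%C (- a) a.

Lemma ccont_TE E E1 f z : hasder E E1 -> cont f -> ccont (fun t => RtoC (f t) * E (t * (RtoC (2 * PI) * z)))%C.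
Proof. intros H Hf. apply ccont_mult; [apply ccont_RtoC; auto|]. apply (ccont_line E E1); auto. Qed.

Lemma TE_line a t z : - a <= t <= a -> 0 <= a -> Cmod (t * (RtoC (2 * PI) * z)) <= 2 * PI * a * Cmod z.
Proof.
  intros Ht Ha. generalize PI_RGT_0; intros HP. rewrite !Cmod_mult, !Cmod_R, (Rabs_pos_eq (2 * PI)) by lra.
  assert (Rabs t <= a) by (apply Rabs_le; lra). assert (H0 := Cmod_ge_0 z). assert (0 <= 2 * PI * Cmod z) by nra. nra.
Qed.

(** Differentiation under the integral sign: the second order remainder of [E] is bounded uniformly
    for [t] in [[-a, a]], so its integral is of order [Cmod (w - z)^2]. *)
Lemma hasder_TE E E1 E2 a f : hasder E E1 -> hasder E1 E2 -> (forall w, Cmod (E2 w) <= 2 * exp (Cmod w)) ->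
  cont f -> 0 < a -> hasder (TE E a f) (TE E1 a (fun t => f t * (2 * PI * t))).
Proof.
  intros H1 H2 Hg Hf Ha z. generalize PI_RGT_0; intros HP.
  destruct (cont_bounded f (- a) a Hf ltac:(lra)) as [B [HB Hb]].
  (* A bound for [E2] at all arguments reached while [w] stays within distance 1 of [z]. *)
  set (M := 2 * exp (2 * PI * a * (Cmod z + 1))).
  assert (HM : 0 <= M) by (unfold M; generalize (exp_pos (2 * PI * a * (Cmod z + 1))); lra).
  set (Q := 2 * (2 * a * (B * (4 * M * (2 * PI * a) ^ 2)))).
  assert (Ha2 : 0 <= (2 * PI * a) ^ 2) by apply pow2_ge_0.
  assert (HQ : 0 <= Q) by (unfold Q; assert (0 <= 4 * M * (2 * PI * a) ^ 2) by (apply Rmult_le_pos; lra); assert (0 <= B * (4 * M * (2 * PI * a) ^ 2)) by (apply Rmult_le_pos; auto); nra).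
  intros eps He. exists (Rmin 1 (eps / (Q + 1))). split.
  { apply Rmin_glb_lt; [lra|]. apply Rdiv_lt_0_compat; lra. }
  intros w Hw. assert (Hw1 := Rlt_le_trans _ _ _ Hw (Rmin_l _ _)). assert (Hw2 := Rlt_le_trans _ _ _ Hw (Rmin_r _ _)).
  assert (Hn := Cmod_ge_0 (w - z)). assert (Hz := Cmod_ge_0 z).
  assert (Cf' : cont (fun t => f t * (2 * PI * t))) by cont.
  assert (Gw := ccont_TE E E1 f w H1 Hf). assert (Gz := ccont_TE E E1 f z H1 Hf).
  assert (G1 := ccont_TE E1 E2 _ z H2 Cf').
  assert (G2 := ccont_mult _ _ (conj (cont_const (fst (w - z)%C)) (cont_const (snd (w - z)%C)) : ccont (fun _ => (w - z)%C)) G1).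
  assert (G3 := ccont_minus _ _ (ccont_minus _ _ Gw Gz) G2).
  replace (TE E a f w - TE E a f z - TE E1 a (fun t => (f t * (2 * PI * t))%R) z * (w - z))%C with
    (CI (fun t => RtoC (f t) * E (t * (RtoC (2 * PI) * w)) - RtoC (f t) * E (t * (RtoC (2 * PI) * z))
       - (w - z) * (RtoC (f t * (2 * PI * t))%R * E1 (t * (RtoC (2 * PI) * z))))%C (- a) a).
  2:{ rewrite CI_minus, CI_minus, CI_scal; auto; [unfold TE; ring|]. apply (ccont_minus _ _ Gw Gz). }
  apply Rle_trans with (Q * Cmod (w - z) * Cmod (w - z)).
  - replace (Q * Cmod (w - z) * Cmod (w - z)) with (2 * ((a - - a) * (B * (4 * M * (2 * PI * a * Cmod (w - z)) ^ 2)))) by (unfold Q; ring).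
    apply CI_bound; [lra|exact G3|].
    + intros t Ht. set (Z := (t * (RtoC (2 * PI) * z))%C). set (W := (t * (RtoC (2 * PI) * w))%C).
      replace (_ - _ - _)%C with (RtoC (f t) * (E W - E Z - E1 Z * (W - Z)))%C.
      2:{ unfold W, Z. rewrite !RtoC_mult. ring. }
      assert (EW : Cmod (W - Z) <= 2 * PI * a * Cmod (w - z)).
      { replace (W - Z)%C with (t * (RtoC (2 * PI) * (w - z)))%C by (unfold W, Z; ring). apply TE_line; lra. }
      rewrite Cmod_mult, Cmod_R. apply Rmult_le_compat; [apply Rabs_pos|apply Cmod_ge_0|auto|].
      eapply Rle_trans; [apply (taylor2 E E1 E2 Z W M H1 H2 HM)|].
      * intros y Hy. eapply Rle_trans; [apply Hg|]. unfold M. apply Rmult_le_compat_l; [lra|]. apply exp_le.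
        eapply Rle_trans; [exact Hy|]. assert (EZ := TE_line a t z Ht ltac:(lra)). fold Z in EZ.
        assert (0 < 2 * PI * a) by nra. assert (2 * PI * a * Cmod (w - z) <= 2 * PI * a * 1) by (apply Rmult_le_compat_l; lra). lra.
      * apply Rmult_le_compat_l; [lra|]. apply pow_incr. split; [apply Cmod_ge_0|auto].
  - apply Rmult_le_compat_r; auto.
    assert (Hlt : Cmod (w - z) * (Q + 1) < eps) by (apply Rlt_div_r in Hw2; lra). nra.
Qed.

(** [Ccas] and [Csac] are the entire extensions of [cos + sin] and of its derivative [cos - sin],
    expanded in [exp (i w)] and [exp (- i w)] with coefficients [(1 -+ i) / 2] and
    [(1 +- i) / 2]. *)
Definition Ccas (w : C) : C := ((1/2, -1/2)%R * Cexp (Ci * w) + (1/2, 1/2)%R * Cexp (- Ci * w))%C.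
Definition Csac (w : C) : C := ((1/2, 1/2)%R * Cexp (Ci * w) + (1/2, -1/2)%R * Cexp (- Ci * w))%C.

Lemma hasder_comb (c d : C) : hasder (fun w => c * Cexp (Ci * w) + d * Cexp (- Ci * w))%C
  (fun w => (c * Ci) * Cexp (Ci * w) + (- d * Ci) * Cexp (- Ci * w))%C.
Proof.
  intros w. eapply cder_eq; [|apply cder_plus; apply cder_scal, cder_Cexp_comp, cder_scal, cder_id]. ring.
Qed.

Lemma hasder_Ccas : hasder Ccas Csac.
Proof.
  intros w. eapply cder_eq; [|apply hasder_comb]. unfold Csac.
  f_equal; f_equal; apply injective_projections; simpl; field.
Qed.

Lemma hasder_Csac : hasder Csac (fun w => - Ccas w)%C.
Proof.
  intros w. eapply cder_eq; [|apply hasder_comb]. unfold Ccas.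
  replace (- ((1/2, -1/2)%R * Cexp (Ci * w) + (1/2, 1/2)%R * Cexp (- Ci * w)))%C with
    ((- (1/2, -1/2)%R) * Cexp (Ci * w) + (- (1/2, 1/2)%R) * Cexp (- Ci * w))%C by ring.
  f_equal; f_equal; apply injective_projections; simpl; field.
Qed.

Lemma Cmod_comb (c d w : C) : Cmod c <= 1 -> Cmod d <= 1 -> Cmod (c * Cexp (Ci * w) + d * Cexp (- Ci * w)) <= 2 * exp (Cmod w).
Proof.
  intros Hc Hd. eapply Rle_trans; [apply Cmod_triangle|]. rewrite !Cmod_mult, !Cmod_Cexp.
  assert (B := Cmod_snd w). apply Rabs_le_between in B.
  assert (E1 : exp (fst (Ci * w)%C) <= exp (Cmod w)) by (apply exp_le; destruct w; simpl in *; lra).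
  assert (E2 : exp (fst (- Ci * w)%C) <= exp (Cmod w)) by (apply exp_le; destruct w; simpl in *; lra).
  assert (H1 := exp_pos (fst (Ci * w)%C)). assert (H2 := exp_pos (fst (- Ci * w)%C)).
  assert (H3 := Cmod_ge_0 c). assert (H4 := Cmod_ge_0 d). nra.
Qed.

Lemma Cmod_half_le s : Rabs s = 1/2 -> Cmod ((1/2, s)%R : C) <= 1.
Proof. intros H. eapply Rle_trans; [apply Cmod_le_add|]. rewrite H, Rabs_pos_eq; lra. Qed.

Lemma half_abs : Rabs (1/2) = 1/2 /\ Rabs (-1/2) = 1/2.
Proof. split; [apply Rabs_pos_eq; lra|rewrite Rabs_left; lra]. Qed.

Lemma Cmod_Ccas w : Cmod (Ccas w) <= 2 * exp (Cmod w).
Proof. apply Cmod_comb; apply Cmod_half_le; apply half_abs. Qed.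

Lemma Cmod_Csac w : Cmod (Csac w) <= 2 * exp (Cmod w).
Proof. apply Cmod_comb; apply Cmod_half_le; apply half_abs. Qed.

Lemma Ccas_real (x : R) : Ccas x = RtoC (cas x).
Proof.
  unfold Ccas, cas, Cexp. apply injective_projections; simpl;
  replace (0 * x - 1 * 0) with 0 by ring; replace (- 0 * x - - (1) * 0) with 0 by ring;
  replace (0 * 0 + 1 * x) with x by ring; replace (- 0 * 0 + - (1) * x) with (- x) by ring;
  rewrite exp_0, cos_neg, sin_neg; field.
Qed.

Definition Tf (a : R) (f : R -> R) : C -> C := TE Ccas a f.
Definition Tf' (a : R) (f : R -> R) : C -> C := TE Csac a (fun t => f t * (2 * PI * t)).

Lemma hasder_Tf a f : cont f -> 0 < a -> hasder (Tf a f) (Tf' a f).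
Proof.
  intros Hf Ha. apply (hasder_TE Ccas Csac (fun w => - Ccas w)%C); auto using hasder_Ccas, hasder_Csac.
  intros w. rewrite Cmod_opp. apply Cmod_Ccas.
Qed.

Lemma entire_Tf' a f : cont f -> 0 < a -> entire (Tf' a f).
Proof.
  intros Hf Ha. eapply hasder_entire. apply (hasder_TE Csac (fun w => - Ccas w)%C (fun w => - Csac w)%C); auto using hasder_Csac.
  - intros w. apply cder_ext with (fun w => - (1) * Ccas w)%C; [intros; ring|].
    eapply cder_eq; [|apply cder_scal, hasder_Ccas]. ring.
  - intros w. rewrite Cmod_opp. apply Cmod_Csac.
  - cont.
Qed.

Lemma Tf_bound a f : cont f -> 0 < a -> exists A, forall z, Cmod (Tf a f z) <= A * exp (2 * PI * a * Cmod z).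
Proof.
  intros Hf Ha. destruct (cont_bounded f (- a) a Hf ltac:(lra)) as [B [HB Hb]].
  exists (2 * ((a - - a) * (B * 2))). intros z.
  replace (2 * ((a - - a) * (B * 2)) * exp (2 * PI * a * Cmod z)) with (2 * ((a - - a) * (B * (2 * exp (2 * PI * a * Cmod z))))) by ring.
  apply CI_bound; [lra|apply (ccont_TE Ccas Csac); auto using hasder_Ccas|].
  intros t Ht. rewrite Cmod_mult, Cmod_R. apply Rmult_le_compat; [apply Rabs_pos|apply Cmod_ge_0|auto|].
  eapply Rle_trans; [apply Cmod_Ccas|]. apply Rmult_le_compat_l; [lra|]. apply exp_le, TE_line; lra.
Qed.

Lemma Tf_exp_type a f : cont f -> 0 < a -> exp_type_le (Tf a f) (2 * PI * a).
Proof.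
  intros Hf Ha eps He. destruct (Tf_bound a f Hf Ha) as [A HA]. exists A; intros z.
  eapply Rle_trans; [apply HA|].
  assert (HA0 := growth_const_pos _ _ _ HA).
  apply Rmult_le_compat_l; auto. apply exp_le. generalize (Cmod_ge_0 z); nra.
Qed.

Lemma Tf_real a f (x : R) : Tf a f x = RtoC (hart a f x).
Proof.
  assert (P : forall t : R, (RtoC (f t) * Ccas (t * (RtoC (2 * PI) * x)))%C = RtoC (f t * cas (2 * PI * x * t))).
  { intros t. replace (t * (RtoC (2 * PI) * x))%C with (RtoC (2 * PI * x * t)) by (rewrite !RtoC_mult; ring).
    rewrite Ccas_real, RtoC_mult. reflexivity. }
  unfold Tf, TE, CI, hart. apply injective_projections; cbn [fst snd].
  - apply RI_ext; intros t. rewrite P. reflexivity.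
  - rewrite (RI_ext _ (fun _ => 0)); [rewrite RI_const; simpl; ring|]. intros t. rewrite P. reflexivity.
Qed.

(** * The inequality for entire functions *)

Lemma entire_mult F G : entire F -> entire G -> entire (fun z => F z * G z)%C.
Proof.
  intros HF HG z. destruct (entire_cder F HF z) as [l Hl]. destruct (entire_cder G HG z) as [m Hm].
  eexists. apply is_derive_cder, cder_mult; eassumption.
Qed.

Lemma entire_plus F G : entire F -> entire G -> entire (fun z => F z + G z)%C.
Proof.
  intros HF HG z. destruct (entire_cder F HF z) as [l Hl]. destruct (entire_cder G HG z) as [m Hm].
  eexists. apply is_derive_cder, cder_plus; eassumption.
Qed.

Lemma entire_minus F G : entire F -> entire G -> entire (fun z => F z - G z)%C.
Proof.
  intros HF HG z. destruct (entire_cder F HF z) as [l Hl]. destruct (entire_cder G HG z) as [m Hm].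
  eexists. apply is_derive_cder, cder_minus; eassumption.
Qed.

Lemma entire_const c : entire (fun _ => c).
Proof. intros z; eexists. apply is_derive_cder, cder_const. Qed.

Lemma entire_lin_shift c d F : entire F -> entire (fun z => F (c * z + d)%C).
Proof.
  intros HF z. destruct (entire_cder F HF (c * z + d)%C) as [l Hl]. eexists. apply is_derive_cder.
  apply (cder_comp F (fun z => c * z + d)%C); [exact Hl|].
  apply cder_plus; [apply cder_scal, cder_id|apply cder_const].
Qed.

Lemma entire_lin c F : entire F -> entire (fun z => F (c * z)%C).
Proof.
  intros HF z. destruct (entire_cder F HF (c * z)%C) as [l Hl]. eexists. apply is_derive_cder, cder_lin, Hl.
Qed.

Lemma Cmod_sqr (z : C) : Cmod z ^ 2 = fst z ^ 2 + snd z ^ 2.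
Proof. unfold Cmod. rewrite pow2_sqrt; auto. generalize (pow2_ge_0 (fst z)) (pow2_ge_0 (snd z)); lra. Qed.

Lemma absF2_eq F x : absF2 F x = fst (F (RtoC x)) ^ 2 + snd (F (RtoC x)) ^ 2.
Proof. apply Cmod_sqr. Qed.

Lemma cont_absF2 F : entire F -> cont (absF2 F).
Proof.
  intros HF. destruct (entire_real_cont F HF) as [C1 C2].
  apply cont_ext with (fun x => fst (F (RtoC x)) ^ 2 + snd (F (RtoC x)) ^ 2); [intros; symmetry; apply absF2_eq|].
  cont.
Qed.

Definition wgt (al be x : R) : R := al + be * snc (2 * PI * x).

Lemma cont_wgt al be : cont (wgt al be).
Proof. assert (H := cont_snc). unfold wgt. cont. Qed.

Lemma wgt_bound al be x : Rabs (wgt al be x) <= Rabs al + Rabs be.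
Proof.
  unfold wgt. eapply Rle_trans; [apply Rabs_triang|]. rewrite Rabs_mult.
  assert (H := snc_bound (2 * PI * x)). assert (K := Rabs_pos be). assert (K' := Rabs_pos (snc (2 * PI * x))). nra.
Qed.

(** One statement for both directions: [be = 1] bounds [qform] above by [al], and [be = -1] bounds
    it below by [- al], relative to the square norm. *)
Definition form_bound (a al be : R) : Prop :=
  forall f, cont f -> be * qform a f <= al * RI (fun t => f t ^ 2) (- a) a.

Lemma tends_eventually_ge I l b : tends I l -> b <= l -> forall eps, 0 < eps -> exists M0, 1 <= M0 /\ forall M, M0 <= M -> b - eps <= I M.
Proof.
  intros [C [HC H]] Hb eps He. set (s := C / eps + 1).
  assert (Hs : 1 <= s) by (unfold s; assert (0 <= C / eps) by (apply Rdiv_le_0_compat; lra); lra).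
  exists (s * s); split; [nra|]. intros M HM.
  assert (HM1 : 1 <= M) by nra. specialize (H M HM1).
  assert (Hsq : s <= sqrt M). { rewrite <- (sqrt_square s) by lra. apply sqrt_le_1_alt; auto. }
  assert (K : C / sqrt M <= eps).
  { apply Rle_div_l; [lra|]. apply Rle_trans with (eps * s); [|apply Rmult_le_compat_l; lra].
    unfold s. replace (eps * (C / eps + 1)) with (C + eps) by (field; lra). lra. }
  apply Rabs_le_between in H. lra.
Qed.

(** The integral against [wgt] tends to [al * N + be * (u 0 ^ 2 - qform a f)], and [form_bound] says
    that this is at least [be * u 0 ^ 2]. *)
Lemma real_part_ineq u du a C al be : cont du -> (forall x, is_derive u x (du x)) -> 0 < a -> 0 <= C ->
  (forall x, Rabs (u x) <= C * rb x) -> (forall t, a < Rabs t -> htr u t = 0) -> form_bound a al be ->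
  forall eps, 0 < eps -> exists M0, 1 <= M0 /\ forall M, M0 <= M -> be * u 0 ^ 2 - eps <= RI (fun x => u x ^ 2 * wgt al be x) (- M) M.
Proof.
  intros Hdu Hu Ha HC Hb Hv HF. assert (Cu := cont_derive _ _ Hu). assert (Cs := cont_snc).
  destruct (htr_parseval u du a C Hdu Hu Ha HC Hb Hv) as [f [Cf [E0 [T1 T2]]]].
  set (N := RI (fun t => f t ^ 2) (- a) a) in *.
  apply tends_eventually_ge with (al * N + be * (u 0 ^ 2 - qform a f)).
  - destruct T1 as [C1 [HC1 T1]]. destruct T2 as [C2 [HC2 T2]].
    exists (Rabs al * C1 + Rabs be * C2). assert (Ha1 := Rabs_pos al). assert (Hb1 := Rabs_pos be). split; [nra|].
    intros M HM. specialize (T1 M HM). specialize (T2 M HM).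
    replace (RI (fun x => u x ^ 2 * wgt al be x) (- M) M) with
      (al * RI (fun x => u x ^ 2) (- M) M + be * RI (fun x => u x ^ 2 * snc (2 * PI * x)) (- M) M).
    2:{ rewrite <- !RI_scal, <- RI_plus by cont. apply RI_ext; intros; unfold wgt; ring. }
    set (I1 := RI (fun x => u x ^ 2) (- M) M) in *. set (I2 := RI (fun x => u x ^ 2 * snc (2 * PI * x)) (- M) M) in *.
    replace (al * I1 + be * I2 - (al * N + be * (u 0 ^ 2 - qform a f))) with (al * (I1 - N) + be * (I2 - (u 0 ^ 2 - qform a f))) by ring.
    eapply Rle_trans; [apply Rabs_triang|]. rewrite !Rabs_mult.
    replace ((Rabs al * C1 + Rabs be * C2) / sqrt M) with (Rabs al * (C1 / sqrt M) + Rabs be * (C2 / sqrt M)) by (unfold Rdiv; ring).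
    apply Rplus_le_compat; apply Rmult_le_compat_l; auto.
  - specialize (HF f Cf). fold N in HF. lra.
Qed.

Lemma nice_ineq K K' a c al be : hasder K K' -> entire K' -> exp_type_le K (2 * PI * a) -> 0 < a -> 0 <= c ->
  (forall x, Cmod (K (RtoC x)) <= c * rb x) -> form_bound a al be ->
  forall eps, 0 < eps -> exists M0, 1 <= M0 /\ forall M, M0 <= M -> be * absF2 K 0 - eps <= RI (fun x => absF2 K x * wgt al be x) (- M) M.
Proof.
  intros HK HK' Hty Ha Hc Hline HF eps He.
  assert (EK := hasder_entire _ _ HK).
  destruct (entire_real_cont K EK) as [C1 C2]. destruct (entire_real_cont K' HK') as [C3 C4].
  assert (HR := hasder_real K K' HK). assert (HV := htr_vanish K a c EK Hty Ha Hc Hline).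
  assert (Cw := cont_wgt al be).
  destruct (real_part_ineq (fun x => fst (K (RtoC x))) (fun x => fst (K' (RtoC x))) a c al be C3 (fun x => proj1 (HR x)) Ha Hc
    (fun x => Rle_trans _ _ _ (Cmod_fst _) (Hline x)) (fun t Ht => proj1 (HV t Ht)) HF (eps / 2) ltac:(lra)) as [M1 [HM1 K1]].
  destruct (real_part_ineq (fun x => snd (K (RtoC x))) (fun x => snd (K' (RtoC x))) a c al be C4 (fun x => proj2 (HR x)) Ha Hc
    (fun x => Rle_trans _ _ _ (Cmod_snd _) (Hline x)) (fun t Ht => proj2 (HV t Ht)) HF (eps / 2) ltac:(lra)) as [M2 [HM2 K2]].
  exists (Rmax M1 M2). split; [eapply Rle_trans; [exact HM1|apply Rmax_l]|]. intros M HM.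
  specialize (K1 M (Rle_trans _ _ _ (Rmax_l _ _) HM)). specialize (K2 M (Rle_trans _ _ _ (Rmax_r _ _) HM)).
  rewrite (RI_ext _ (fun x => fst (K (RtoC x)) ^ 2 * wgt al be x + snd (K (RtoC x)) ^ 2 * wgt al be x)) by (intros; rewrite absF2_eq; ring).
  rewrite RI_plus by cont. rewrite absF2_eq. lra.
Qed.

(** * Regularization by averaging, dilation and a squared sinc *)

Section Regularization.
Variables (F G : C -> C) (Delta : R).
Hypotheses (HG : hasder G F) (HF : entire F) (Hty : exp_type_le F (PI * Delta)) (HDelta : 0 < Delta).

(** The mean of [F] over the segment from [z] to [z + b]. Unlike [F] it is visibly bounded on the
    line, by Cauchy-Schwarz, and its derivative is visibly entire. *)
Definition Fh (b : R) (z : C) : C := (RtoC (/ b) * (G (z + b) - G z))%C.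
(** The entire function [sin (2 PI b z) / (2 PI b z)], obtained as the transform of a constant so
    that its derivative and growth come from the results on [Tf]. *)
Definition sfac (b : R) (z : C) : C := (RtoC (/ (2 * b)) * Tf b (fun _ => 1%R) z)%C.
Definition sfac' (b : R) (z : C) : C := (RtoC (/ (2 * b)) * Tf' b (fun _ => 1%R) z)%C.
(* The dilation makes up for the type [4 pi b] of the factor [sfac b z ^ 2]. *)
Definition lamb (b : R) : R := 1 - 4 * b / Delta.
Definition Kb (b : R) (z : C) : C := (Fh b (RtoC (lamb b) * z) * (sfac b z * sfac b z))%C.
Definition Kb' (b : R) (z : C) : C :=
  ((RtoC (lamb b) * (RtoC (/ b) * (F (RtoC (lamb b) * z + b) - F (RtoC (lamb b) * z)))) * (sfac b z * sfac b z)
   + Fh b (RtoC (lamb b) * z) * (sfac' b z * sfac b z + sfac b z * sfac' b z))%C.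

Lemma hasder_Fh b : hasder (Fh b) (fun z => RtoC (/ b) * (F (z + b) - F z))%C.
Proof.
  intros z. unfold Fh. apply (cder_scal (RtoC (/ b)) (fun z => G (z + b) - G z)%C).
  apply cder_minus; [apply (cder_shift (RtoC b) G), HG|apply HG].
Qed.

Lemma hasder_sfac b : 0 < b -> hasder (sfac b) (sfac' b).
Proof.
  intros Hb z. unfold sfac, sfac'. apply (cder_scal (RtoC (/ (2 * b))) (Tf b (fun _ => 1%R))).
  apply hasder_Tf; auto. cont.
Qed.

Lemma hasder_Kb b : 0 < b -> hasder (Kb b) (Kb' b).
Proof.
  intros Hb z. apply (cder_mult (fun z => Fh b (RtoC (lamb b) * z)) (fun z => sfac b z * sfac b z))%C.
  - apply (cder_lin (RtoC (lamb b)) (Fh b)), hasder_Fh.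
  - apply (cder_mult (sfac b) (sfac b)); apply hasder_sfac; auto.
Qed.

Lemma entire_Kb' b : 0 < b -> entire (Kb' b).
Proof.
  intros Hb. assert (E1 := hasder_entire _ _ (hasder_sfac b Hb)). assert (E2 := hasder_entire _ _ (hasder_Fh b)).
  assert (E3 : entire (sfac' b)).
  { apply entire_mult; [apply entire_const|]. apply entire_Tf'; auto. cont. }
  apply entire_plus; apply entire_mult.
  - apply entire_mult; [apply entire_const|]. apply entire_mult; [apply entire_const|].
    apply entire_minus; [apply entire_lin_shift|apply entire_lin]; auto.
  - apply entire_mult; auto.
  - apply (entire_lin _ (Fh b)); auto.
  - apply entire_plus; apply entire_mult; auto.
Qed.

Lemma sfac_real b (x : R) : 0 < b -> sfac b x = RtoC (snc (2 * PI * b * x)).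
Proof.
  intros Hb. unfold sfac. rewrite Tf_real, <- RtoC_mult. f_equal.
  assert (E : hart b (fun _ => 1) x = 2 * b * snc (2 * PI * b * x)).
  { assert (Hs := cont_cas). unfold hart.
    rewrite (RI_ext _ (fun t => cos (2 * PI * t * x) + sin (2 * PI * t * x))).
    - rewrite RI_plus by cont. rewrite RI_cos_dk, (RI_odd (fun t => sin (2 * PI * t * x))); [unfold dk; ring|cont|].
      intros t. replace (2 * PI * - t * x) with (- (2 * PI * t * x)) by ring. apply sin_neg.
    - intros t. unfold cas. replace (2 * PI * x * t) with (2 * PI * t * x) by ring. ring. }
  rewrite E. field. lra.
Qed.

Lemma Kb_exp_type b : 0 < b -> 4 * b <= Delta -> exp_type_le (Kb b) (PI * Delta).
Proof.
  intros Hb Hb4 eps He. generalize PI_RGT_0; intros HP.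
  destruct (Hty eps He) as [A HA]. destruct (Tf_bound b (fun _ => 1) ltac:(cont) Hb) as [D HD].
  assert (Hib : 0 < / b) by (apply Rinv_0_lt_compat; auto).
  assert (Hi2b : 0 < / (2 * b)) by (apply Rinv_0_lt_compat; lra).
  assert (HA0 := growth_const_pos _ _ _ HA).
  assert (HD0 := growth_const_pos _ _ _ HD).
  set (ka := PI * Delta + eps) in *. assert (Hka : 0 < ka) by (unfold ka; nra).
  exists ((/ b * (2 * (A * exp (ka * b) * b))) * ((/ (2 * b) * D) * (/ (2 * b) * D))). intros z.
  assert (Hl : 0 <= lamb b <= 1).
  { unfold lamb. assert (0 <= 4 * b / Delta <= 1); [|lra]. split; [apply Rdiv_le_0_compat; lra|apply Rle_div_l; lra]. }
  unfold Kb. rewrite !Cmod_mult. assert (Hz := Cmod_ge_0 z).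
  assert (B1 : Cmod (Fh b (RtoC (lamb b) * z)) <= / b * (2 * (A * exp (ka * b) * b)) * exp (ka * (lamb b * Cmod z))).
  { unfold Fh. rewrite Cmod_mult, Cmod_R, Rabs_pos_eq, (Rmult_assoc (/ b)) by lra. apply Rmult_le_compat_l; [lra|].
    eapply Rle_trans; [apply (segment_bound G F _ _ (A * exp (ka * (lamb b * Cmod z + b))) HG)|].
    - intros t Ht. eapply Rle_trans; [apply HA|]. apply Rmult_le_compat_l; auto. apply exp_le, Rmult_le_compat_l; [lra|].
      eapply Rle_trans; [apply Cmod_triangle|].
      replace (RtoC (lamb b) * z + b - RtoC (lamb b) * z)%C with (RtoC b) by ring.
      rewrite !Cmod_mult, !Cmod_R, (Rabs_pos_eq b), (Rabs_pos_eq t), (Rabs_pos_eq (lamb b)) by lra. nra.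
    - replace (RtoC (lamb b) * z + b - RtoC (lamb b) * z)%C with (RtoC b) by ring.
      rewrite Cmod_R, (Rabs_pos_eq b), Rmult_plus_distr_l, exp_plus by lra. right; ring. }
  assert (B2 : Cmod (sfac b z) <= / (2 * b) * D * exp (2 * PI * b * Cmod z)).
  { unfold sfac. rewrite Cmod_mult, Cmod_R, Rabs_pos_eq, (Rmult_assoc (/ (2 * b))) by lra. apply Rmult_le_compat_l; [lra|auto]. }
  eapply Rle_trans.
  { apply Rmult_le_compat; [apply Cmod_ge_0|apply Rmult_le_pos; apply Cmod_ge_0|exact B1|].
    apply Rmult_le_compat; [apply Cmod_ge_0|apply Cmod_ge_0|exact B2|exact B2]. }
  set (P := / b * (2 * (A * exp (ka * b) * b))). set (Q := / (2 * b) * D).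
  replace (P * exp (ka * (lamb b * Cmod z)) * (Q * exp (2 * PI * b * Cmod z) * (Q * exp (2 * PI * b * Cmod z)))) with
    (P * (Q * Q) * exp (ka * (lamb b * Cmod z) + 2 * PI * b * Cmod z + 2 * PI * b * Cmod z)) by (rewrite !exp_plus; ring).
  apply Rmult_le_compat_l.
  - unfold P, Q. assert (0 <= A * exp (ka * b) * b) by (repeat apply Rmult_le_pos; try lra; apply Rlt_le, exp_pos).
    apply Rmult_le_pos; [nra|]. assert (0 <= / (2 * b) * D) by nra. nra.
  - apply exp_le. unfold ka, lamb.
    replace ((PI * Delta + eps) * ((1 - 4 * b / Delta) * Cmod z) + 2 * PI * b * Cmod z + 2 * PI * b * Cmod z) with
      ((PI * Delta + eps) * Cmod z - eps * (4 * b / Delta) * Cmod z) by (field; lra).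
    assert (0 <= eps * (4 * b / Delta) * Cmod z); [|lra]. repeat apply Rmult_le_pos; try lra.
    apply Rlt_le, Rinv_0_lt_compat; lra.
Qed.

Lemma Fh_real b (y : R) : fst (Fh b y) = RI (fun x => fst (F (RtoC x))) y (y + b) / b /\
  snd (Fh b y) = RI (fun x => snd (F (RtoC x))) y (y + b) / b.
Proof.
  assert (HR := hasder_real G F HG). destruct (entire_real_cont F HF) as [C1 C2].
  assert (E1 : RI (fun x => fst (F (RtoC x))) y (y + b) = fst (G (RtoC (y + b))) - fst (G (RtoC y))).
  { apply (RI_FTC (fun x => fst (G (RtoC x)))); auto. intros x; apply HR. }
  assert (E2 : RI (fun x => snd (F (RtoC x))) y (y + b) = snd (G (RtoC (y + b))) - snd (G (RtoC y))).
  { apply (RI_FTC (fun x => snd (G (RtoC x)))); auto. intros x; apply HR. }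
  rewrite E1, E2. unfold Fh. rewrite <- RtoC_plus. simpl. split; unfold Rdiv; ring.
Qed.

Lemma absF2_Fh b y : 0 < b -> absF2 (Fh b) y <= RI (absF2 F) y (y + b) / b.
Proof.
  intros Hb. destruct (entire_real_cont F HF) as [C1 C2].
  rewrite absF2_eq. destruct (Fh_real b y) as [E1 E2]. rewrite E1, E2.
  assert (S1 := RI_sqr_le _ y (y + b) ltac:(lra) C1). assert (S2 := RI_sqr_le _ y (y + b) ltac:(lra) C2).
  rewrite (RI_ext (absF2 F) (fun x => fst (F (RtoC x)) ^ 2 + snd (F (RtoC x)) ^ 2)) by (intros; apply absF2_eq).
  rewrite RI_plus by cont. replace (y + b - y) with b in * by ring.
  set (I1 := RI (fun x => fst (F (RtoC x))) y (y + b)) in *. set (I2 := RI (fun x => snd (F (RtoC x))) y (y + b)) in *.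
  apply Rmult_le_reg_r with (b ^ 2); [nra|].
  replace (((I1 / b) ^ 2 + (I2 / b) ^ 2) * b ^ 2) with (I1 ^ 2 + I2 ^ 2) by (field; lra).
  set (J1 := RI (fun x => fst (F (RtoC x)) ^ 2) y (y + b)) in *. set (J2 := RI (fun x => snd (F (RtoC x)) ^ 2) y (y + b)) in *.
  replace ((J1 + J2) / b * b ^ 2) with (b * J1 + b * J2) by (field; lra). lra.
Qed.

Lemma absF2_Kb b x : 0 < b -> absF2 (Kb b) x = absF2 (Fh b) (lamb b * x) * (snc (2 * PI * b * x)) ^ 4.
Proof.
  intros Hb. unfold absF2, Kb. rewrite !Cmod_mult, sfac_real, <- RtoC_mult, Cmod_R by auto.

  replace (snc (2 * PI * b * x) ^ 4) with ((snc (2 * PI * b * x) ^ 2) ^ 2) by ring.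
  rewrite <- (pow2_abs (snc (2 * PI * b * x))). ring.
Qed.

(** Averaging does not create mass. With [P] a primitive, the left side telescopes to the difference
    of the means of [P] over [[d, d + b]] and [[c, c + b]], and [P] is nondecreasing. *)
Lemma RI_avg_le (phi : R -> R) b c d : cont phi -> (forall x, 0 <= phi x) -> 0 < b -> c <= d ->
  RI (fun y => RI phi y (y + b) / b) c d <= RI phi c (d + b).
Proof.
  intros Hp H0 Hb Hcd. set (P := fun x => RI phi 0 x).
  assert (CP : cont P) by (apply cont_RI; auto).
  assert (Inc : forall x y, x <= y -> P x <= P y).
  { intros x y Hxy. unfold P. rewrite <- (RI_Chasles phi 0 x y) by auto.
    assert (0 <= RI phi x y) by (apply RI_ge0; auto). lra. }
  assert (E : forall x y, RI phi x y = P y - P x).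
  { intros x y. unfold P. rewrite <- (RI_Chasles phi 0 x y) by auto. ring. }
  rewrite (RI_ext _ (fun y => / b * (P (y + b) - P y))) by (intros; rewrite E; unfold Rdiv; ring).
  rewrite RI_scal, RI_minus, RI_shift by cont.
  rewrite E. assert (X1 := RI_Chasles P c d (d + b) CP). assert (X2 := RI_Chasles P c (c + b) (d + b) CP).
  assert (Y1 : RI P d (d + b) <= b * P (d + b)).
  { replace (b * P (d + b)) with (RI (fun _ => P (d + b)) d (d + b)) by (rewrite RI_const; ring).
    apply RI_le; auto; [lra|cont|]. intros x Hx; apply Inc; lra. }
  assert (Y2 : b * P c <= RI P c (c + b)).
  { replace (b * P c) with (RI (fun _ => P c) c (c + b)) by (rewrite RI_const; ring).
    apply RI_le; auto; [lra|cont|]. intros x Hx; apply Inc; lra. }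
  apply Rmult_le_reg_l with b; auto. rewrite <- Rmult_assoc, Rinv_r, Rmult_1_l by lra. lra.
Qed.

Variable N : R.
Hypothesis HN : forall c d, c <= d -> RI (absF2 F) c d <= N.

Lemma absF2_pos H x : 0 <= absF2 H x.
Proof. apply pow2_ge_0. Qed.

(** The constant blows up as [b] tends to 0. This is harmless: it serves to make the transform of
    [Kb b] available, and the inequality obtained in [Kb_ineq] does not contain it. *)
Lemma Kb_decay b : 0 < b -> exists c, 0 <= c /\ forall x, Cmod (Kb b (RtoC x)) <= c * rb x.
Proof.
  intros Hb. generalize PI_RGT_0; intros HP.
  exists (sqrt (N / b) * (1 + / (2 * PI * b) ^ 2)).
  assert (H2 : 0 < (2 * PI * b) ^ 2) by (apply pow_lt; nra).
  assert (H3 : 0 < / (2 * PI * b) ^ 2) by (apply Rinv_0_lt_compat; auto).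
  split; [apply Rmult_le_pos; [apply sqrt_pos|lra]|]. intros x.
  unfold Kb. rewrite !Cmod_mult, sfac_real by auto. rewrite Cmod_R, (Rmult_assoc (sqrt (N / b))).
  apply Rmult_le_compat; [apply Cmod_ge_0|apply Rmult_le_pos; apply Rabs_pos| |].
  - rewrite <- RtoC_mult. rewrite <- (sqrt_pow2 (Cmod _)) by apply Cmod_ge_0. apply sqrt_le_1_alt.
    eapply Rle_trans; [apply (absF2_Fh b (lamb b * x) Hb)|]. unfold Rdiv. apply Rmult_le_compat_r; [apply Rlt_le, Rinv_0_lt_compat; auto|].
    apply HN; lra.
  - unfold rb. assert (Hx1 : 0 < 1 + (1 * x) ^ 2) by (generalize (pow2_ge_0 (1 * x)); lra).
    apply (Rle_div_r _ _ (1 + (1 * x) ^ 2)); auto.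
    rewrite <- Rabs_mult, Rabs_pos_eq by apply Rle_0_sqr.
    set (s := snc (2 * PI * b * x)).
    assert (Hs : s * s <= 1). { assert (Q := snc_bound (2 * PI * b * x)). fold s in Q. apply Rabs_le_between in Q. nra. }
    assert (Hx : s * s * (1 * x) ^ 2 <= / (2 * PI * b) ^ 2).
    { apply Rmult_le_reg_r with ((2 * PI * b) ^ 2); auto. rewrite Rinv_l by lra.
      replace (s * s * (1 * x) ^ 2 * (2 * PI * b) ^ 2) with ((2 * PI * b * x * s) ^ 2) by ring.
      unfold s. rewrite snc_mul. assert (Q := SIN_bound (2 * PI * b * x)). nra. }
    lra.
Qed.

(** Uniform in [b]: the dilation factor is at least [1/2] and the averaging length at most 1, so the
    mass of [Kb b] beyond [X] comes from that of [F] beyond [X / 2 - 1]. The factor 2 is the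
    Jacobian bound. *)
Lemma Kb_tail b X M : 0 < b <= 1 -> 8 * b <= Delta -> 4 <= X <= M ->
  RI (absF2 (Kb b)) X M <= 2 * (N - RI (absF2 F) (- (X / 2 - 1)) (X / 2 - 1)) /\
  RI (absF2 (Kb b)) (- M) (- X) <= 2 * (N - RI (absF2 F) (- (X / 2 - 1)) (X / 2 - 1)).
Proof.
  intros Hb Hb8 HX. set (Z := X / 2 - 1). assert (HZ : 0 < Z) by (unfold Z; lra).
  assert (Cphi := cont_absF2 F HF).
  assert (CK := cont_absF2 _ (hasder_entire _ _ (hasder_Kb b ltac:(lra)))).
  set (l := lamb b). assert (Hl : 1 / 2 <= l <= 1).
  { unfold l, lamb. assert (0 <= 4 * b / Delta <= 1 / 2); [|lra]. split; [apply Rdiv_le_0_compat; lra|apply Rle_div_l; lra]. }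
  set (psi := fun y => RI (absF2 F) y (y + b) / b).
  assert (Cpsi : cont psi).
  { apply cont_ext with (fun y => / b * (RI (absF2 F) 0 (y + b) - RI (absF2 F) 0 y)).
    - intros y. unfold psi. rewrite <- (RI_Chasles (absF2 F) 0 y (y + b)) by auto. unfold Rdiv. ring.
    - apply cont_mult; [cont|]. apply cont_minus; [|apply cont_RI; auto].
      apply (cont_comp (fun x => RI (absF2 F) 0 x)); [apply cont_RI; auto|cont]. }
  assert (Hpsi0 : forall y, 0 <= psi y).
  { intros y. unfold psi. apply Rdiv_le_0_compat; [|lra]. apply RI_ge0; auto; [lra|intros; apply absF2_pos]. }
  assert (Pt : forall x, absF2 (Kb b) x <= psi (l * x)).
  { intros x. rewrite absF2_Kb by lra. fold l. assert (Q := absF2_Fh b (l * x) ltac:(lra)). fold (psi (l * x)) in Q.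
    assert (Q2 := snc_bound (2 * PI * b * x)). set (s := snc (2 * PI * b * x)) in *.
    assert (s ^ 2 <= 1) by (apply Rabs_le_between in Q2; nra). assert (Hs2 := pow2_ge_0 s).
    assert (s ^ 4 <= 1) by (replace (s ^ 4) with (s ^ 2 * s ^ 2) by ring; nra).
    assert (0 <= s ^ 4) by (replace (s ^ 4) with (s ^ 2 * s ^ 2) by ring; nra).
    assert (Q3 := absF2_pos (Fh b) (l * x)). nra. }
  assert (Int : forall c d, c <= d -> RI (absF2 (Kb b)) c d <= 2 * RI (absF2 F) (l * c) (l * d + b)).
  { intros c d Hcd. apply Rle_trans with (2 * RI psi (l * c) (l * d)).
    - assert (EL := RI_lin psi l 0 c d Cpsi). rewrite !Rplus_0_r in EL. rewrite <- EL.
      rewrite <- RI_scal by cont. apply RI_le; auto; [cont|]. intros x _.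
      rewrite Rplus_0_r. specialize (Pt x). specialize (Hpsi0 (l * x)). nra.
    - apply Rmult_le_compat_l; [lra|]. apply RI_avg_le; auto; [intros; apply absF2_pos|lra|nra]. }
  assert (Pos : forall c d, c <= d -> 0 <= RI (absF2 F) c d) by (intros; apply RI_ge0; auto; intros; apply absF2_pos).
  split.
  - eapply Rle_trans; [apply Int; lra|]. apply Rmult_le_compat_l; [lra|].
    assert (T := HN (- Z) (l * M + b) ltac:(unfold Z; nra)).
    assert (P1 := Pos Z (l * X) ltac:(unfold Z; nra)).
    rewrite <- (RI_Chasles _ (- Z) Z (l * M + b)), <- (RI_Chasles _ Z (l * X) (l * M + b)) in T by auto. lra.
  - eapply Rle_trans; [apply Int; lra|]. apply Rmult_le_compat_l; [lra|].
    assert (T := HN (l * - M) Z ltac:(unfold Z; nra)).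
    assert (P1 := Pos (l * - X + b) (- Z) ltac:(unfold Z; nra)).
    rewrite <- (RI_Chasles _ (l * - M) (l * - X + b) Z), <- (RI_Chasles _ (l * - X + b) (- Z) Z) in T by auto. lra.
Qed.

(** The integral over the line is cut at an [X] independent of [b], so that letting [b] tend to 0
    requires only uniform convergence on [[-X, X]]. *)
Lemma Kb_ineq b X al be : 0 < b <= 1 -> 8 * b <= Delta -> 4 <= X -> form_bound (Delta / 2) al be ->
  be * absF2 (Kb b) 0 <= RI (fun x => absF2 (Kb b) x * wgt al be x) (- X) X
    + (Rabs al + Rabs be) * (4 * (N - RI (absF2 F) (- (X / 2 - 1)) (X / 2 - 1))).
Proof.
  intros Hb Hb8 HX Hform. apply le_epsilon; intros eps He.
  destruct (Kb_decay b ltac:(lra)) as [c [Hc Hdec]].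
  assert (HK := hasder_Kb b ltac:(lra)). assert (CK := cont_absF2 _ (hasder_entire _ _ HK)).
  assert (Cw := cont_wgt al be).
  assert (Ety : exp_type_le (Kb b) (2 * PI * (Delta / 2))).
  { replace (2 * PI * (Delta / 2)) with (PI * Delta) by field. apply Kb_exp_type; lra. }
  destruct (nice_ineq (Kb b) (Kb' b) (Delta / 2) c al be HK (entire_Kb' b ltac:(lra)) Ety ltac:(lra) Hc Hdec Hform eps He) as [M0 [HM0 K]].
  set (M := Rmax M0 X). assert (HM : M0 <= M) by apply Rmax_l. assert (HMX : X <= M) by apply Rmax_r.
  specialize (K M HM).
  destruct (Kb_tail b X M Hb Hb8 ltac:(lra)) as [T1 T2].
  assert (Cf : cont (fun x => absF2 (Kb b) x * wgt al be x)) by cont.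
  rewrite <- (RI_Chasles _ (- M) (- X) M), <- (RI_Chasles _ (- X) X M) in K by auto.
  set (B := Rabs al + Rabs be) in *. assert (HB : 0 <= B) by (unfold B; generalize (Rabs_pos al) (Rabs_pos be); lra).
  assert (Up : forall c d, c <= d -> RI (fun x => absF2 (Kb b) x * wgt al be x) c d <= B * RI (absF2 (Kb b)) c d).
  { intros c' d' Hcd. rewrite <- RI_scal by auto. apply RI_le; auto; [cont|]. intros x _.
    rewrite Rmult_comm. apply Rmult_le_compat_r; [apply absF2_pos|].
    eapply Rle_trans; [apply Rle_abs|apply wgt_bound]. }
  assert (U1 := Up (- M) (- X) ltac:(lra)). assert (U2 := Up X M HMX). nra.
Qed.

Lemma avg_close u X eps : cont u -> 0 < X -> 0 < eps -> exists d, 0 < d /\ forall b x, 0 < b <= d -> Rabs x <= X ->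
  Rabs (RI u (lamb b * x) (lamb b * x + b) / b - u x) <= eps.
Proof.
  intros Cu HX He.
  destruct (Heine_cor2 (f := u) (a := - X - 1) (b := X + 1) (fun x _ => cont_pt u Cu x) (mkposreal eps He)) as [dl Hdl].
  (* The dilation moves [x] by at most [b * (4 * X / Delta)] and the averaging window adds [b];
     [b * q] exceeds both together, which leaves room for a strict inequality. *)
  simpl in Hdl. set (q := 4 * X / Delta + 2). 
  assert (Hq0 : 0 <= 4 * X / Delta) by (apply Rdiv_le_0_compat; lra).
  assert (Hq : 0 < q) by (unfold q; lra).
  assert (Hm : 0 < Rmin dl 1) by (apply Rmin_glb_lt; [apply cond_pos|lra]).
  exists (Rmin dl 1 / q). split; [apply Rdiv_lt_0_compat; auto|]. intros b x Hb Hx.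
  assert (Hbq : b * q <= Rmin dl 1) by (apply Rle_div_r; lra).
  assert (H1 := Rmin_l dl 1). assert (H2 := Rmin_r dl 1).
  assert (Hx' := Hx). apply Rabs_le_between in Hx'.
  assert (Hlx : Rabs (lamb b * x - x) <= b * (4 * X / Delta)).
  { unfold lamb. replace ((1 - 4 * b / Delta) * x - x) with (- (b * (4 * x / Delta))) by (field; lra).
    rewrite Rabs_Ropp, Rabs_mult, (Rabs_pos_eq b) by lra. apply Rmult_le_compat_l; [lra|].
    unfold Rdiv. rewrite !Rabs_mult, (Rabs_pos_eq 4), (Rabs_pos_eq (/ Delta)) by (try lra; apply Rlt_le, Rinv_0_lt_compat; auto).
    apply Rmult_le_compat_r; [apply Rlt_le, Rinv_0_lt_compat; auto|lra]. }
  apply Rabs_le_between in Hlx. unfold q in Hbq.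
  assert (K := RI_near u (lamb b * x) b (u x) eps Cu). rewrite (Rabs_pos_eq b) in K by lra.
  replace (RI u (lamb b * x) (lamb b * x + b) / b - u x) with ((RI u (lamb b * x) (lamb b * x + b) - u x * b) / b) by (field; lra).
  unfold Rdiv. rewrite Rabs_mult, (Rabs_pos_eq (/ b)) by (apply Rlt_le, Rinv_0_lt_compat; lra).
  apply Rle_div_l; [lra|]. apply K. intros t Ht. apply Rabs_le_between in Ht.
  apply Rlt_le, Hdl; [lra|lra|]. apply Rabs_def1; lra.
Qed.

Lemma sqr_close u v eta U : Rabs u <= U -> 0 <= eta <= 1 -> Rabs (v - u) <= eta -> Rabs (v ^ 2 - u ^ 2) <= eta * (2 * U + 1).
Proof.
  intros Hu He Hv. replace (v ^ 2 - u ^ 2) with ((v - u) * ((v - u) + 2 * u)) by ring. rewrite Rabs_mult.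
  apply Rmult_le_compat; try apply Rabs_pos; auto. eapply Rle_trans; [apply Rabs_triang|].
  rewrite Rabs_mult, (Rabs_pos_eq 2) by lra. lra.
Qed.

Lemma Kb_close X eps : 0 < X -> 0 < eps -> exists d, 0 < d /\ forall b x, 0 < b <= d -> Rabs x <= X ->
  Rabs (absF2 (Kb b) x - absF2 F x) <= eps.
Proof.
  intros HX He. generalize PI_RGT_0; intros HP. destruct (entire_real_cont F HF) as [C1 C2].
  set (u := fun x => fst (F (RtoC x))) in *. set (v := fun x => snd (F (RtoC x))) in *.
  destruct (cont_bounded u (- X) X C1 ltac:(lra)) as [U [HU Hu]]. destruct (cont_bounded v (- X) X C2 ltac:(lra)) as [V [HV Hv]].
  set (Q := (2 * U + 1) + (2 * V + 1) + (U ^ 2 + V ^ 2)).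
  assert (HQ : 0 < Q) by (unfold Q; nra).
  set (eta := Rmin 1 (eps / Q)).
  assert (Heta : 0 < eta) by (apply Rmin_glb_lt; [lra|apply Rdiv_lt_0_compat; auto]).
  assert (Heta1 : eta <= 1) by apply Rmin_l.
  assert (HetaQ : eta * Q <= eps) by (apply Rle_div_r; [auto|apply Rmin_r]).
  destruct (avg_close u X eta C1 HX Heta) as [d1 [Hd1 K1]]. destruct (avg_close v X eta C2 HX Heta) as [d2 [Hd2 K2]].
  assert (Cs := cont_snc). assert (Cs4 : cont (fun y => snc y ^ 4)) by cont.
  destruct (cont_pt _ Cs4 0 eta Heta) as [d3 [Hd3 K3]].
  set (d := Rmin (Rmin d1 d2) (d3 / (8 * PI * (X + 1)))).
  assert (H8 : 0 < 8 * PI * (X + 1)) by nra.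
  exists d; split; [unfold d; repeat apply Rmin_glb_lt; auto; apply Rdiv_lt_0_compat; auto|].
  intros b x Hb Hx.
  assert (Hb1 : b <= d1) by (apply Rle_trans with d; [lra|]; eapply Rle_trans; [apply Rmin_l|apply Rmin_l]).
  assert (Hb2 : b <= d2) by (apply Rle_trans with d; [lra|]; eapply Rle_trans; [apply Rmin_l|apply Rmin_r]).
  assert (Hb3 : b * (8 * PI * (X + 1)) <= d3) by (apply Rle_div_r; [auto|]; apply Rle_trans with d; [lra|apply Rmin_r]).
  specialize (K1 b x ltac:(lra) Hx). specialize (K2 b x ltac:(lra) Hx).
  rewrite absF2_Kb by lra. rewrite !absF2_eq. destruct (Fh_real b (lamb b * x)) as [E1 E2].
  fold u v in E1, E2. rewrite E1, E2. fold (u x) (v x).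
  set (u' := RI u (lamb b * x) (lamb b * x + b) / b) in *. set (v' := RI v (lamb b * x) (lamb b * x + b) / b) in *.
  assert (Hx' := Hx). apply Rabs_le_between in Hx'.
  assert (Bu := Hu x ltac:(lra)). assert (Bv := Hv x ltac:(lra)).
  assert (S1 := sqr_close _ _ _ _ Bu (conj (Rlt_le _ _ Heta) Heta1) K1). assert (S2 := sqr_close _ _ _ _ Bv (conj (Rlt_le _ _ Heta) Heta1) K2).
  assert (S3 : Rabs (snc (2 * PI * b * x) ^ 4 - 1) <= eta).
  { destruct (Req_dec (2 * PI * b * x) 0) as [E|E].
    - rewrite E, snc_0, pow1, Rminus_diag, Rabs_R0. lra.
    - assert (K := K3 (2 * PI * b * x)). simpl in K; unfold R_dist in K. rewrite snc_0, Rminus_0_r in K.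
      replace (1 * (1 * (1 * (1 * 1)))) with 1 in K by ring.
      apply Rlt_le. apply K. split; [split; [exact I|auto]|].
      rewrite !Rabs_mult, (Rabs_pos_eq 2), (Rabs_pos_eq PI), (Rabs_pos_eq b) by lra.
      apply Rle_lt_trans with (2 * PI * b * X); [apply Rmult_le_compat_l; [nra|auto]|].
      assert (0 < PI * b) by nra. nra. }
  set (s := snc (2 * PI * b * x)) in *.
  assert (Hs4 : Rabs (s ^ 4) <= 1).
  { rewrite <- RPow_abs. assert (Q0 := snc_bound (2 * PI * b * x)). fold s in Q0. assert (Q1 := Rabs_pos s).
    rewrite <- (pow1 4). apply pow_incr; lra. }
  replace ((u' ^ 2 + v' ^ 2) * s ^ 4 - (u x ^ 2 + v x ^ 2)) with
    (((u' ^ 2 - u x ^ 2) + (v' ^ 2 - v x ^ 2)) * s ^ 4 + (u x ^ 2 + v x ^ 2) * (s ^ 4 - 1)) by ring.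
  eapply Rle_trans; [apply Rabs_triang|]. rewrite !Rabs_mult.
  assert (T1 : Rabs ((u' ^ 2 - u x ^ 2) + (v' ^ 2 - v x ^ 2)) * Rabs (s ^ 4) <= (eta * (2 * U + 1) + eta * (2 * V + 1)) * 1).
  { apply Rmult_le_compat; try apply Rabs_pos; auto. eapply Rle_trans; [apply Rabs_triang|]. lra. }
  assert (T2 : Rabs (u x ^ 2 + v x ^ 2) * Rabs (s ^ 4 - 1) <= (U ^ 2 + V ^ 2) * eta).
  { apply Rmult_le_compat; try apply Rabs_pos; auto. rewrite Rabs_pos_eq by nra.
    rewrite <- (pow2_abs (u x)), <- (pow2_abs (v x)).
    assert (P1 := Rabs_pos (u x)). assert (P2 := Rabs_pos (v x)). nra. }
  unfold Q in HetaQ. lra.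
Qed.

(** The limit [b -> 0] of [Kb_ineq]; [q] collects the errors of the integral over [[-X, X]] and of
    the value at 0. *)
Lemma PW_ineq_X X al be : 4 <= X -> form_bound (Delta / 2) al be ->
  be * absF2 F 0 <= RI (fun x => absF2 F x * wgt al be x) (- X) X
    + (Rabs al + Rabs be) * (4 * (N - RI (absF2 F) (- (X / 2 - 1)) (X / 2 - 1))).
Proof.
  intros HX Hform. apply le_epsilon; intros eps He.
  set (B := Rabs al + Rabs be). assert (HB : 0 <= B) by (unfold B; generalize (Rabs_pos al) (Rabs_pos be); lra).
  assert (Hbe : Rabs be <= B) by (unfold B; generalize (Rabs_pos al); lra).
  set (q := 2 * X * B + B + 1). assert (Hq : 0 < q) by (unfold q; nra).
  destruct (Kb_close X (eps / q) ltac:(lra) ltac:(apply Rdiv_lt_0_compat; auto)) as [d [Hd K]].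
  set (b := Rmin d (Rmin 1 (Delta / 8))).
  assert (Hb : 0 < b) by (unfold b; repeat apply Rmin_glb_lt; lra).
  assert (Hbd : b <= d) by apply Rmin_l. assert (Hb1 : b <= 1) by (eapply Rle_trans; [apply Rmin_r|apply Rmin_l]).
  assert (Hb8 : b <= Delta / 8) by (eapply Rle_trans; [apply Rmin_r|apply Rmin_r]).
  assert (I := Kb_ineq b X al be ltac:(lra) ltac:(lra) HX Hform). fold B in I.
  assert (CK := cont_absF2 _ (hasder_entire _ _ (hasder_Kb b Hb))). assert (CF := cont_absF2 F HF). assert (Cw := cont_wgt al be).
  set (e := eps / q) in *. assert (Ee : e * q = eps) by (unfold e; field; lra).
  assert (D1 : Rabs (RI (fun x => absF2 (Kb b) x * wgt al be x) (- X) X - RI (fun x => absF2 F x * wgt al be x) (- X) X) <= (X - - X) * (e * B)).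
  { rewrite <- RI_minus by cont. apply RI_abs_const; [lra|cont|]. intros x Hx.
    rewrite <- Rmult_minus_distr_r, Rabs_mult. apply Rmult_le_compat; try apply Rabs_pos; [|apply wgt_bound].
    apply K; [lra|apply Rabs_le; lra]. }
  assert (D0 : Rabs (be * (absF2 (Kb b) 0 - absF2 F 0)) <= B * e).
  { rewrite Rabs_mult. apply Rmult_le_compat; try apply Rabs_pos; auto. apply K; [lra|rewrite Rabs_R0; lra]. }
  apply Rabs_le_between in D0. apply Rabs_le_between in D1.
  assert (He0 : 0 < e) by (unfold e; apply Rdiv_lt_0_compat; auto).
  assert (Eq : e * q = 2 * X * (e * B) + B * e + e) by (unfold q; ring).
  lra.
Qed.

End Regularization.

(** * An entire function vanishing on the real line is zero *)

Lemma max_on_rect (w : R -> R -> R) x0 y0 W Ht : cont2 w -> 0 <= W -> 0 <= Ht ->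
  exists u v, x0 <= u <= x0 + W /\ y0 <= v <= y0 + Ht /\
    forall x y, x0 <= x <= x0 + W -> y0 <= y <= y0 + Ht -> w x y <= w u v.
Proof.
  intros Cw HW HH.
  set (cof := fun x1 y1 W1 H1 => x0 <= x1 /\ x1 + W1 <= x0 + W /\ y0 <= y1 /\ y1 + H1 <= y0 + Ht /\ 0 <= W1 /\ 0 <= H1 /\
    forall x y, x0 <= x <= x0 + W -> y0 <= y <= y0 + Ht ->
    exists x' y', x1 <= x' <= x1 + W1 /\ y1 <= y' <= y1 + H1 /\ w x y <= w x' y').
  destruct (quarter_nest cof x0 y0 W Ht HW HH) as [u [v Huv]].
  - intros x1 y1 W1 H1 (G1 & G2 & G3 & G4 & G5 & G6 & K). apply NNPP; intros N.
    apply not_or_and in N; destruct N as [N1 N]. apply not_or_and in N; destruct N as [N2 N]. apply not_or_and in N; destruct N as [N3 N4].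
    assert (Wit : forall xa ya, x0 <= xa -> xa + W1 / 2 <= x0 + W -> y0 <= ya -> ya + H1 / 2 <= y0 + Ht ->
      ~ cof xa ya (W1 / 2) (H1 / 2) -> exists x y, (x0 <= x <= x0 + W /\ y0 <= y <= y0 + Ht) /\
        forall x' y', xa <= x' <= xa + W1 / 2 -> ya <= y' <= ya + H1 / 2 -> w x' y' < w x y).
    { intros xa ya Q1 Q2 Q3 Q4 Nc. apply NNPP; intros Ne. apply Nc. unfold cof. repeat split; try lra.
      intros x y Hx Hy. apply NNPP; intros Ne2. apply Ne. exists x, y. split; [auto|]. intros x' y' Hx' Hy'.
      apply Rnot_le_lt; intros Hle. apply Ne2. exists x', y'. auto. }
    destruct (Wit x1 y1 ltac:(lra) ltac:(lra) ltac:(lra) ltac:(lra) N1) as (a1 & b1 & R1 & D1).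
    destruct (Wit (x1 + W1 / 2) y1 ltac:(lra) ltac:(lra) ltac:(lra) ltac:(lra) N2) as (a2 & b2 & R2 & D2).
    destruct (Wit x1 (y1 + H1 / 2) ltac:(lra) ltac:(lra) ltac:(lra) ltac:(lra) N3) as (a3 & b3 & R3 & D3).
    destruct (Wit (x1 + W1 / 2) (y1 + H1 / 2) ltac:(lra) ltac:(lra) ltac:(lra) ltac:(lra) N4) as (a4 & b4 & R4 & D4).
    assert (Two : forall a b c d, (x0 <= a <= x0 + W /\ y0 <= b <= y0 + Ht) -> (x0 <= c <= x0 + W /\ y0 <= d <= y0 + Ht) ->
      exists e f, (x0 <= e <= x0 + W /\ y0 <= f <= y0 + Ht) /\ w a b <= w e f /\ w c d <= w e f).
    { intros a b c d Q1 Q2. destruct (Rle_dec (w a b) (w c d)); [exists c, d|exists a, b]; repeat split; try tauto; lra. }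
    destruct (Two a1 b1 a2 b2 R1 R2) as (a5 & b5 & R5 & L1 & L2). destruct (Two a3 b3 a4 b4 R3 R4) as (a6 & b6 & R6 & L3 & L4).
    destruct (Two a5 b5 a6 b6 R5 R6) as (a7 & b7 & R7 & L5 & L6).
    destruct (K a7 b7 (proj1 R7) (proj2 R7)) as (x' & y' & Hx' & Hy' & Hle).
    destruct (Rle_dec x' (x1 + W1 / 2)); destruct (Rle_dec y' (y1 + H1 / 2)).
    + specialize (D1 x' y' ltac:(lra) ltac:(lra)). lra.
    + specialize (D3 x' y' ltac:(lra) ltac:(lra)). lra.
    + specialize (D2 x' y' ltac:(lra) ltac:(lra)). lra.
    + specialize (D4 x' y' ltac:(lra) ltac:(lra)). lra.
  - unfold cof. repeat split; try lra. intros x y Hx Hy. exists x, y. repeat split; lra.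
  - exists u, v. destruct (Huv 0%nat) as (xa & ya & (Q1 & Q2 & Q3 & Q4 & Q5 & Q6 & _) & Hu & Hv). simpl in Q2, Q4, Hu, Hv.
    rewrite Rdiv_1_r in Q2, Q4, Hu, Hv. split; [lra|split; [lra|]].
    intros x y Hx Hy. apply le_epsilon; intros eps He.
    destruct (Cw u v (mkposreal eps He)) as [d Hd]. simpl in Hd.
    destruct (nfloor_ex ((W + Ht) / d)) as [n [_ Hn]]; [apply Rdiv_le_0_compat; [lra|apply cond_pos]|].
    destruct (Huv (S n)) as (xb & yb & (_ & _ & _ & _ & _ & _ & K) & Hu' & Hv').
    assert (Hp : INR n + 1 <= 2 ^ S n).
    { clear. induction n as [|n IH]; [simpl; lra|]. rewrite S_INR. assert (1 <= 2 ^ S n) by (apply pow_R1_Rle; lra).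
      change (2 ^ S (S n)) with (2 * 2 ^ S n). lra. }
    assert (P2 : 0 < 2 ^ S n) by (apply pow_lt; lra).
    assert (Hdp := cond_pos d).
    assert (Hlt : W + Ht < d * 2 ^ S n).
    { apply Rlt_le_trans with (d * (INR n + 1)); [|apply Rmult_le_compat_l; lra].
      apply Rlt_div_l in Hn; auto. lra. }
    assert (HWd : W / 2 ^ S n < d) by (apply Rlt_div_l; auto; lra).
    assert (HHd : Ht / 2 ^ S n < d) by (apply Rlt_div_l; auto; lra).
    destruct (K x y Hx Hy) as (x' & y' & Hx' & Hy' & Hle).
    assert (Hc : Rabs (w x' y' - w u v) < eps) by (apply Hd; apply Rabs_def1; lra).
    apply Rabs_def2 in Hc. lra.
Qed.

(** If [l > 0], then [df] lies above [df m] just right of [m] and below it just left: for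
    [df m >= 0] the function exceeds [f m] on the right, otherwise on the left. It is not necessary
    to know [df m = 0] first. *)
Lemma second_derivative_max (f df : R -> R) m l r : 0 < r -> (forall x, is_derive f x (df x)) -> is_derive df m l ->
  (forall x, Rabs (x - m) < r -> f x <= f m) -> l <= 0.
Proof.
  intros Hr Hf Hdf Hmax. apply Rnot_lt_le; intros Hl.
  apply is_derive_Reals in Hdf. destruct (Hdf (l / 2) ltac:(lra)) as [d Hd].
  set (h := Rmin (d / 2) (r / 2)). assert (Hd0 := cond_pos d).
  assert (Hh : 0 < h) by (apply Rmin_glb_lt; lra). assert (Hh1 : h <= d / 2) by apply Rmin_l. assert (Hh2 : h <= r / 2) by apply Rmin_r.
  assert (Sl : forall t, t <> 0 -> Rabs t <= h -> l / 2 < (df (m + t) - df m) / t).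
  { intros t Ht0 Ht. assert (K := Hd t Ht0 ltac:(lra)). apply Rabs_def2 in K. lra. }
  assert (MV : forall a b, a < b -> exists c, a <= c <= b /\ f b - f a = df c * (b - a)).
  { intros a b Hab. destruct (MVT_gen f a b df) as [c [Hc E]].
    - intros; apply Hf.
    - intros x _; apply continuity_pt_filterlim, (ex_derive_continuous f). exists (df x); apply Hf.
    - rewrite Rmin_left, Rmax_right in Hc by lra. exists c; auto. }
  destruct (Rle_dec 0 (df m)) as [Hs|Hs].
  - assert (Pos : forall c, m < c <= m + h -> 0 < df c).
    { intros c Hc. assert (K2 := Sl (c - m) ltac:(lra) ltac:(rewrite Rabs_pos_eq; lra)). replace (m + (c - m)) with c in K2 by ring.
      apply (Rlt_div_r (l / 2)) in K2; [|lra]. assert (0 < l / 2 * (c - m)) by (apply Rmult_lt_0_compat; lra). lra. }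
    assert (K := Hmax (m + h)). replace (m + h - m) with h in K by ring. rewrite Rabs_pos_eq in K by lra. specialize (K ltac:(lra)).
    destruct (MV (m + h / 2) (m + h) ltac:(lra)) as [c2 [Hc2 E2]]. destruct (MV m (m + h / 2) ltac:(lra)) as [c3 [Hc3 E3]].
    assert (P2 : 0 < df c2 * (m + h - (m + h / 2))) by (apply Rmult_lt_0_compat; [apply Pos|]; lra).
    assert (P3 : 0 <= df c3 * (m + h / 2 - m)).
    { apply Rmult_le_pos; [|lra]. destruct (Req_dec c3 m) as [->|H3]; auto. apply Rlt_le, Pos; lra. }
    lra.
  - destruct (MV (m - h) m ltac:(lra)) as [c [Hc E]]. assert (K := Hmax (m - h)).
    replace (m - h - m) with (- h) in * by ring. rewrite Rabs_Ropp, Rabs_pos_eq in K by lra. specialize (K ltac:(lra)).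
    replace (m - (m - h)) with h in E by ring.
    assert (df c < 0).
    { destruct (Req_dec c m) as [->|Hcm]; [lra|].
      assert (K2 := Sl (c - m) ltac:(lra) ltac:(rewrite Rabs_left; lra)). replace (m + (c - m)) with c in K2 by ring.
      replace ((df c - df m) / (c - m)) with ((df m - df c) / (m - c)) in K2 by (field; lra).
      apply (Rlt_div_r (l / 2)) in K2; [|lra]. nra. }
    nra.
Qed.

Lemma entire_hasder F : entire F -> exists F', hasder F F'.
Proof.
  intros H. exists (fun z => epsilon (inhabits (RtoC 0)) (fun l => cder F z l)). intros z.
  apply (epsilon_spec (inhabits (RtoC 0)) (fun l => cder F z l)), entire_cder, H.
Qed.

Lemma path_x (z : R) y : ((0, y) + RtoC z * 1)%C = ((z, y) : C).
Proof. apply injective_projections; simpl; ring. Qed.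

Lemma path_y x (z : R) : ((x, 0) + RtoC z * Ci)%C = ((x, z) : C).
Proof. apply injective_projections; simpl; ring. Qed.

(* [u + eps (x - xp)^2] has positive Laplacian, hence no interior maximum. *)
Lemma max_principle_re Phi Phi1 x0 y0 W Ht M xp yp : hasder Phi Phi1 -> entire Phi1 -> 0 < W -> 0 < Ht ->
  (forall x y, x0 <= x <= x0 + W -> y0 <= y <= y0 + Ht -> (x = x0 \/ x = x0 + W \/ y = y0 \/ y = y0 + Ht) -> fst (Phi (x, y)) <= M) ->
  x0 <= xp <= x0 + W -> y0 <= yp <= y0 + Ht -> fst (Phi (xp, yp)) <= M.
Proof.
  intros H1 E1 HW HH Hbd Hxp Hyp. apply Rnot_lt_le; intros Hlt.
  destruct (entire_hasder Phi1 E1) as [Phi2 H2].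
  set (eps := (fst (Phi (xp, yp)) - M) / (2 * W ^ 2)).
  assert (HW2 : 0 < W ^ 2) by nra.
  assert (He : 0 < eps) by (apply Rdiv_lt_0_compat; lra).
  assert (HeW : eps * W ^ 2 = (fst (Phi (xp, yp)) - M) / 2) by (unfold eps; field; lra).
  set (w := fun x y => reP Phi x y + eps * (x - xp) ^ 2).
  destruct (entire_cont Phi (hasder_entire _ _ H1)) as [C1 _].
  assert (Cw : cont2 w).
  { unfold w. apply cont2_plus; auto. apply cont2_1. cont. }
  destruct (max_on_rect w x0 y0 W Ht Cw ltac:(lra) ltac:(lra)) as (u & v & Hu & Hv & Hmax).
  assert (Hp := Hmax xp yp Hxp Hyp). unfold w in Hp at 1. unfold reP in Hp.
  replace (eps * (xp - xp) ^ 2) with 0 in Hp by ring.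
  assert (Nb : ~ (u = x0 \/ u = x0 + W \/ v = y0 \/ v = y0 + Ht)).
  { intros B. specialize (Hbd u v Hu Hv B). unfold w, reP in Hp.
    assert ((u - xp) ^ 2 <= W ^ 2) by nra. nra. }
  assert (Hu' : x0 < u < x0 + W) by (split; apply Rnot_le_lt; intros Q; apply Nb; lra).
  assert (Hv' : y0 < v < y0 + Ht) by (split; apply Rnot_le_lt; intros Q; apply Nb; lra).
  (* The second derivatives of [w] in [x] and [y] are [Re Phi'' + 2 eps] and [- Re Phi'']. At an
     interior maximum both are nonpositive, although their sum is positive. *)
  assert (Lx : fst (Phi2 (u, v)) + 2 * eps <= 0).
  { apply (second_derivative_max (fun x => w x v) (fun x => fst (Phi1 (x, v)) + 2 * eps * (x - xp)) u _ (Rmin (u - x0) (x0 + W - u))).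
    - apply Rmin_glb_lt; lra.
    - intros x. unfold w, reP.
      assert (P := proj1 (cder_path Phi (0, v) 1 x _ (H1 _))).
      rewrite path_x, Cmult_1_r in P.
      apply (is_derive_plus (fun x => fst (Phi (x, v))) (fun x => eps * (x - xp) ^ 2)).
      + eapply is_derive_ext; [|exact P]. intros t; simpl; rewrite path_x; auto.
      + auto_derive; auto. ring.
    - assert (P := proj1 (cder_path Phi1 (0, v) 1 u _ (H2 _))).
      rewrite path_x, Cmult_1_r in P.
      apply (is_derive_plus (fun x => fst (Phi1 (x, v))) (fun x => 2 * eps * (x - xp))).
      + eapply is_derive_ext; [|exact P]. intros t; simpl; rewrite path_x; auto.
      + auto_derive; auto. ring.
    - intros x Hx. assert (Q1 := Rlt_le_trans _ _ _ Hx (Rmin_l _ _)). assert (Q2 := Rlt_le_trans _ _ _ Hx (Rmin_r _ _)).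
      apply Rabs_def2 in Q1. apply Rabs_def2 in Q2. apply Hmax; lra. }
  assert (Ly : - fst (Phi2 (u, v)) <= 0).
  { apply (second_derivative_max (fun y => w u y) (fun y => fst (Phi1 (u, y) * Ci)%C) v _ (Rmin (v - y0) (y0 + Ht - v))).
    - apply Rmin_glb_lt; lra.
    - intros y. unfold w, reP.
      assert (P := proj1 (cder_path Phi (u, 0) Ci y _ (H1 _))). rewrite path_y in P.
      assert (P' : is_derive (fun y => fst (Phi (u, y))) y (fst (Phi1 (u, y) * Ci)%C)).
      { eapply is_derive_ext; [|exact P]. intros t; simpl; rewrite path_y; auto. }
      assert (Q := is_derive_plus _ _ _ _ _ P' (is_derive_const (eps * (u - xp) ^ 2) y)).
      rewrite plus_zero_r in Q. exact Q.
    - assert (P : cder (fun z => Phi1 z * Ci)%C ((u, 0) + RtoC v * Ci)%C (Phi2 (u, v) * Ci)%C).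
      { rewrite path_y. apply cder_ext with (fun z => Ci * Phi1 z)%C; [intros; ring|].
        eapply cder_eq; [|apply cder_scal, H2]. ring. }
      apply cder_path, proj1 in P.
      replace (fst (Phi2 (u, v) * Ci * Ci)%C) with (- fst (Phi2 (u, v))) in P by (simpl; ring).
      eapply is_derive_ext; [|apply P]. intros t; cbv beta; rewrite path_y; auto.
    - intros y Hy. assert (Q1 := Rlt_le_trans _ _ _ Hy (Rmin_l _ _)). assert (Q2 := Rlt_le_trans _ _ _ Hy (Rmin_r _ _)).
      apply Rabs_def2 in Q1. apply Rabs_def2 in Q2. apply Hmax; lra. }
  lra.
Qed.

Lemma max_principle Phi Phi1 x0 y0 W Ht M xp yp : hasder Phi Phi1 -> entire Phi1 -> 0 < W -> 0 < Ht ->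
  (forall x y, x0 <= x <= x0 + W -> y0 <= y <= y0 + Ht -> (x = x0 \/ x = x0 + W \/ y = y0 \/ y = y0 + Ht) -> Cmod (Phi (x, y)) <= M) ->
  x0 <= xp <= x0 + W -> y0 <= yp <= y0 + Ht -> Cmod (Phi (xp, yp)) <= M.
Proof.
  intros H1 E1 HW HH Hbd Hxp Hyp.
  destruct (Req_dec (Cmod (Phi (xp, yp))) 0) as [E0|E0].
  { rewrite E0. eapply Rle_trans; [apply Cmod_ge_0|apply (Hbd x0 y0); lra]. }
  set (r := Cmod (Phi (xp, yp))) in *. assert (Hr : 0 < r) by (generalize (Cmod_ge_0 (Phi (xp, yp))); fold r; lra).
  (* A unimodular factor that rotates the value at the given point to its modulus and so reduces the
     claim to real parts. *)
  set (c := (RtoC (/ r) * Cconj (Phi (xp, yp)))%C).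
  assert (Hc : Cmod c = 1).
  { unfold c. rewrite Cmod_mult, Cmod_conj, Cmod_R, Rabs_pos_eq by (apply Rlt_le, Rinv_0_lt_compat; auto). fold r. field; lra. }
  assert (Er : fst (c * Phi (xp, yp))%C = r).
  { unfold c. assert (E := Cmod_sqr (Phi (xp, yp))). fold r in E. simpl.
    transitivity (/ r * (fst (Phi (xp, yp)) ^ 2 + snd (Phi (xp, yp)) ^ 2)); [ring|]. rewrite <- E. field; lra. }
  rewrite <- Er.
  apply (max_principle_re (fun z => c * Phi z)%C (fun z => c * Phi1 z)%C x0 y0 W Ht M); auto.
  - intros z. apply cder_scal, H1.
  - apply entire_mult; auto. apply entire_const.
  - intros x y Hx Hy B. eapply Rle_trans; [apply Rle_abs|]. eapply Rle_trans; [apply Cmod_fst|].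
    rewrite Cmod_mult, Hc, Rmult_1_l. auto.
Qed.

(* [Re (i z - z^2) = - y - x^2 + y^2] is at most [-1/4] on three sides of
   [[-1/2, 1/2] x [0, 1/2]] and larger than that at [i y]. *)
Lemma zero_above_line H H1 s x0 y M : hasder H H1 -> entire H1 -> (forall x, H (x, s) = 0%C) ->
  (forall x t, -1/2 <= x <= 1/2 -> 0 <= t <= 1/2 -> Cmod (H (x0 + x, s + t)%R) <= M) ->
  0 <= y < 1/2 -> H (x0, s + y)%R = 0%C.
Proof.
  intros HH E1 Hz Hb Hy.
  assert (HM : 0 <= M) by (eapply Rle_trans; [apply Cmod_ge_0|apply (Hb 0 0); lra]).
  (* [dl] is the gap between the exponents: [- y + y^2 + 1/4 = (1/2 - y)^2]. Letting [N] grow then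
     forces the value to be 0. *)
  set (c0 := ((x0, s) : C)). set (dl := (1/2 - y) ^ 2). assert (Hdl : 0 < dl) by (unfold dl; nra).
  assert (W : forall N, 0 < N -> Cmod (H (x0, s + y)%R) <= M * exp (- (N * dl))).
  { intros N HN.
    set (E := fun z => Cexp (RtoC N * (Ci * z - z * z))%C).
    set (E' := fun z => (RtoC N * (Ci - (z + z)) * Cexp (RtoC N * (Ci * z - z * z)))%C).
    assert (DE : hasder E E').
    { intros z. apply (cder_Cexp_comp (fun z => RtoC N * (Ci * z - z * z))%C).
      apply cder_scal. eapply cder_eq; [|apply cder_minus; [apply cder_scal, cder_id|apply cder_mult; apply cder_id]]. cbv beta. ring. }
    assert (EE : entire E) by (eapply hasder_entire; exact DE).
    assert (EE' : entire E').
    { apply entire_mult; auto. apply entire_mult; [apply entire_const|]. apply entire_minus; [apply entire_const|].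
      apply entire_plus; intros z; eexists; apply is_derive_cder, cder_id. }
    assert (HS : entire (fun z => H (z + c0)%C)).
    { intros z. eexists. apply is_derive_cder, cder_shift, HH. }
    assert (HS1 : entire (fun z => H1 (z + c0)%C)).
    { intros z. destruct (entire_cder H1 E1 (z + c0)%C) as [l Hl]. eexists. apply is_derive_cder, cder_shift, Hl. }
    assert (DP : hasder (fun z => H (z + c0) * E z)%C (fun z => H1 (z + c0) * E z + H (z + c0) * E' z)%C).
    { intros z. apply (cder_mult (fun z => H (z + c0)%C) E); [apply cder_shift, HH|apply DE]. }
    assert (EP : entire (fun z => H1 (z + c0) * E z + H (z + c0) * E' z)%C).
    { apply entire_plus; apply entire_mult; auto. }
    assert (ME : forall x t, Cmod (E (x, t)) = exp (N * (- t - x ^ 2 + t ^ 2))).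
    { intros x t. unfold E. rewrite Cmod_Cexp. f_equal. simpl. ring. }
    assert (Sh : forall x t, ((x, t) + c0)%C = ((x0 + x, s + t)%R : C)) by (intros; apply injective_projections; simpl; ring).
    assert (K := max_principle _ _ (-1/2) 0 1 (1/2) (M * exp (- (N * (1/4)))) 0 y DP EP ltac:(lra) ltac:(lra)).
    assert (K' : Cmod (H ((0, y) + c0)%C * E (0, y)) <= M * exp (- (N * (1/4)))).
    { apply K; [|lra|lra]. intros x t Hx Ht B. rewrite Cmod_mult, ME, Sh.
      destruct (Req_dec t 0) as [->|Ht0].
      - rewrite Rplus_0_r, Hz, Cmod_0, Rmult_0_l. apply Rmult_le_pos; auto. apply Rlt_le, exp_pos.
      - apply Rmult_le_compat; [apply Cmod_ge_0|apply Rlt_le, exp_pos|apply Hb; lra|]. apply exp_le.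
        assert (- t - x ^ 2 + t ^ 2 <= - (1/4)).
        { assert (0 <= t * (1/2 - t)) by nra. destruct B as [B|[B|[B|B]]]; subst; nra. }
        nra. }
    rewrite Cmod_mult, ME, Sh, Rplus_0_r in K'.
    apply Rmult_le_reg_r with (exp (N * (- y - 0 ^ 2 + y ^ 2))); [apply exp_pos|].
    eapply Rle_trans; [exact K'|]. rewrite Rmult_assoc, <- exp_plus. right. do 2 f_equal. unfold dl. field. }
  apply Cmod_eq_0. apply Rle_antisym; [|apply Cmod_ge_0].
  apply (le_of_le_inv _ _ (M / dl)); [apply Rdiv_le_0_compat; auto|]. intros P HP. rewrite Rplus_0_l.
  eapply Rle_trans; [apply (W P ltac:(lra))|].
  replace (M / dl / P) with (M * / (P * dl)) by (field; lra). apply Rmult_le_compat_l; auto.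
  rewrite exp_Ropp. apply Rinv_le_contravar; [nra|]. generalize (exp_ineq1_le (P * dl)); lra.
Qed.

(** Climbs in strips of height [1/4], within the reach [1/2] of [zero_above_line]. The exponential
    growth bound enters only as a finite bound on each rectangle. *)
Lemma zero_upper H H1 A kap : hasder H H1 -> entire H1 -> 0 <= A -> 0 <= kap -> (forall z, Cmod (H z) <= A * exp (kap * Cmod z)) ->
  (forall x, H (x, 0) = 0%C) -> forall x y, 0 <= y -> H (x, y) = 0%C.
Proof.
  intros HH E1 HA Hk Hgr Hz.
  assert (St : forall s x y, (forall x, H (x, s) = 0%C) -> 0 <= y < 1/2 -> H (x, s + y)%R = 0%C).
  { intros s x y Hs Hy.
    apply (zero_above_line H H1 s x y (A * exp (kap * (Rabs x + 1/2 + (Rabs s + 1/2)))) HH E1 Hs); auto.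
    intros x' t Hx' Ht. eapply Rle_trans; [apply Hgr|]. apply Rmult_le_compat_l; auto. apply exp_le, Rmult_le_compat_l; auto.
    eapply Rle_trans; [apply Cmod_le_add|]. apply Rplus_le_compat.
    - eapply Rle_trans; [apply Rabs_triang|]. apply Rplus_le_compat_l, Rabs_le; lra.
    - eapply Rle_trans; [apply Rabs_triang|]. apply Rplus_le_compat_l, Rabs_le; lra. }
  assert (Ind : forall n x y, 0 <= y <= INR n / 4 -> H (x, y) = 0%C).
  { induction n as [|n IH]; intros x y Hy.
    - simpl in Hy. replace y with 0 by lra. apply Hz.
    - rewrite S_INR in Hy. destruct (Rle_dec y (INR n / 4)) as [Hl|Hl]; [apply IH; lra|].
      replace y with (INR n / 4 + (y - INR n / 4)) by ring. apply St; [|lra].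
      intros x'. apply IH. assert (Q := pos_INR n). lra. }
  intros x y Hy. destruct (nfloor_ex (4 * y) ltac:(lra)) as [n [_ Hn]].
  apply (Ind (S n)). rewrite S_INR. lra.
Qed.

(** The maximum principle asks for an entire derivative, which is not known for [F] itself. It is
    applied to [G (z + b) - G z] with [G] a primitive of [F]: this vanishes on the line, hence above
    it, and below it by reflection. So [G] has every period [b > 0], and its derivative [F] is 0. *)
Lemma entire_zero F kap : entire F -> 0 <= kap -> exp_type_le F kap -> (forall x : R, F x = 0%C) -> forall z, F z = 0%C.
Proof.
  intros HF Hk Hty H0. destruct (entire_primitive F HF) as [G HG].
  destruct (Hty 1 Rlt_0_1) as [A HA].
  assert (HA0 := growth_const_pos _ _ _ HA).
  set (ka := kap + 1) in *.
  assert (Per : forall b z, 0 < b -> (G (z + RtoC b) = G z)%C).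
  { intros b.
    intros z Hb.
    set (D := fun z => (G (z + RtoC b) - G z)%C).
    assert (HD : hasder D (fun z => F (z + RtoC b) - F z)%C).
    { intros w. apply cder_minus; [apply cder_shift, HG|apply HG]. }
    assert (ED : entire (fun z => F (z + RtoC b) - F z)%C).
    { apply entire_minus; auto. intros w. destruct (entire_cder F HF (w + RtoC b)%C) as [l Hl]. eexists. apply is_derive_cder, cder_shift, Hl. }
    assert (Hgr : forall w, Cmod (D w) <= 2 * (A * exp (ka * b) * b) * exp (ka * Cmod w)).
    { intros w. unfold D. eapply Rle_trans; [apply (segment_bound G F _ _ (A * exp (ka * (Cmod w + b))) HG)|].
      - intros t Ht. eapply Rle_trans; [apply HA|]. apply Rmult_le_compat_l; auto. apply exp_le, Rmult_le_compat_l; [unfold ka; lra|].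
        eapply Rle_trans; [apply Cmod_triangle|]. replace (w + RtoC b - w)%C with (RtoC b) by ring.
        rewrite Cmod_mult, !Cmod_R, !Rabs_pos_eq by lra. nra.
      - replace (w + RtoC b - w)%C with (RtoC b) by ring.
        rewrite Cmod_R, (Rabs_pos_eq b), Rmult_plus_distr_l, exp_plus by lra. right; ring. }
    assert (Hc : 0 <= 2 * (A * exp (ka * b) * b)).
    { assert (0 <= A * exp (ka * b) * b) by (repeat apply Rmult_le_pos; try lra; apply Rlt_le, exp_pos). lra. }
    assert (Dz : forall x, D (x, 0) = 0%C).
    { intros x. apply Cmod_eq_0, Rle_antisym; [|apply Cmod_ge_0]. unfold D.
      eapply Rle_trans; [apply (segment_bound G F _ _ 0 HG)|rewrite Rmult_0_l; lra].
      intros t Ht. replace ((x, 0) + t * ((x, 0) + RtoC b - (x, 0)))%C with (RtoC (x + t * b)).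
      - rewrite H0, Cmod_0. lra.
      - apply injective_projections; simpl; ring. }
    assert (Up := zero_upper D _ _ ka HD ED Hc ltac:(unfold ka; lra) Hgr Dz).
    set (D2 := fun z => D (- z)%C).
    assert (HD2 : hasder D2 (fun z => - (1) * (F (- z + RtoC b) - F (- z)))%C).
    { intros w. apply cder_ext with (fun w => D (- (1) * w)%C); [intros v; unfold D2; f_equal; ring|].
      replace (- (1) * (F (- w + RtoC b) - F (- w)))%C with (- (1) * (fun z => F (z + RtoC b) - F z) (- (1) * w))%C.
      - apply cder_lin, HD.
      - cbv beta. replace (- (1) * w)%C with (- w)%C by ring. ring. }
    assert (ED2 : entire (fun z => - (1) * (F (- z + RtoC b) - F (- z)))%C).
    { apply entire_mult; [apply entire_const|]. apply (entire_neg (fun z => F (z + RtoC b) - F z)%C), ED. }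
    assert (Hgr2 : forall w, Cmod (D2 w) <= 2 * (A * exp (ka * b) * b) * exp (ka * Cmod w)).
    { intros w. unfold D2. rewrite <- (Cmod_opp w). apply Hgr. }
    assert (Dz2 : forall x, D2 (x, 0) = 0%C).
    { intros x. unfold D2. rewrite <- (Dz (- x)). f_equal. apply injective_projections; simpl; ring. }
    assert (Dn := zero_upper D2 _ _ ka HD2 ED2 Hc ltac:(unfold ka; lra) Hgr2 Dz2).
    assert (Z : D z = 0%C).
    { destruct z as [x y]. destruct (Rle_dec 0 y) as [Hy|Hy]; [apply Up; auto|].
      rewrite <- (Dn (- x) (- y)) by lra. unfold D2. f_equal. apply injective_projections; simpl; ring. }
    unfold D in Z. replace (G (z + RtoC b))%C with (G (z + RtoC b) - G z + G z)%C by ring. rewrite Z. ring. }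
  intros z. apply Cmod_eq_0, Rle_antisym; [|apply Cmod_ge_0]. apply le_epsilon; intros eps He. rewrite Rplus_0_l.
  destruct (HG z eps He) as [d [Hd K]]. specialize (K (z + RtoC (d / 2))%C).
  replace (z + RtoC (d / 2) - z)%C with (RtoC (d / 2)) in K by ring.
  rewrite Cmod_R, Rabs_pos_eq in K by lra. specialize (K ltac:(lra)). rewrite Per in K by lra.
  replace (G z - G z - F z * RtoC (d / 2))%C with (- (F z * RtoC (d / 2)))%C in K by ring.
  rewrite Cmod_opp, Cmod_mult, Cmod_R, Rabs_pos_eq in K by lra. nra.
Qed.

(** * Improper integrals *)

(** The Fourier estimates use symmetric intervals. For nonnegative integrands, monotonicity in the
    interval upgrades this to the two-sided improper integral, by [gen_of_symlim]. *)
Definition symlim (phi : R -> R) (l : R) : Prop :=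
  forall eps, 0 < eps -> exists M0, 1 <= M0 /\ forall M, M0 <= M -> Rabs (RI phi (- M) M - l) <= eps.

Lemma symlim_of_gen phi l : cont phi -> is_RInt_gen phi (Rbar_locally m_infty) (Rbar_locally p_infty) l -> symlim phi l.
Proof.
  intros Hp H eps He.
  destruct (H (fun y => Rabs (y - l) <= eps)) as [Q1 Q2 [m1 H1] [m2 H2] K].
  { exists (mkposreal eps He). intros y Hy. apply Rlt_le, Hy. }
  set (M0 := Rmax 1 (Rmax (- m1 + 1) (m2 + 1))).
  assert (A0 : 1 <= M0) by apply Rmax_l.
  assert (A1 : - m1 + 1 <= M0) by (eapply Rle_trans; [apply Rmax_l|apply Rmax_r]).
  assert (A2 : m2 + 1 <= M0) by (eapply Rle_trans; [apply Rmax_r|apply Rmax_r]).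
  exists M0; split; auto. intros M HM.
  destruct (K (- M) M) as [y [Hy Hl]]; [apply H1; lra|apply H2; lra|]. simpl in Hy.
  assert (E : RI phi (- M) M = y) by (apply is_RInt_unique; exact Hy). rewrite E. auto.
Qed.

Lemma RI_mono phi a b c d : cont phi -> (forall x, 0 <= phi x) -> a <= b -> b <= c -> c <= d -> RI phi b c <= RI phi a d.
Proof.
  intros Hp H0 H1 H2 H3. rewrite <- (RI_Chasles phi a b d), <- (RI_Chasles phi b c d) by auto.
  assert (0 <= RI phi a b) by (apply RI_ge0; auto). assert (0 <= RI phi c d) by (apply RI_ge0; auto). lra.
Qed.

Lemma symlim_upper phi l : cont phi -> (forall x, 0 <= phi x) -> symlim phi l -> forall c d, c <= d -> RI phi c d <= l.
Proof.
  intros Hp H0 H c d Hcd. apply le_epsilon; intros eps He. destruct (H eps He) as [M0 [HM0 K]].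
  set (M := Rmax M0 (Rmax (- c) d)).
  assert (A0 : M0 <= M) by apply Rmax_l.
  assert (A1 : - c <= M) by (eapply Rle_trans; [apply Rmax_l|apply Rmax_r]).
  assert (A2 : d <= M) by (eapply Rle_trans; [apply Rmax_r|apply Rmax_r]).
  specialize (K M A0). apply Rabs_le_between in K.
  assert (Q := RI_mono phi (- M) c d M Hp H0 ltac:(lra) Hcd A2). lra.
Qed.

Lemma gen_of_symlim phi l : cont phi -> (forall x, 0 <= phi x) -> symlim phi l ->
  is_RInt_gen phi (Rbar_locally m_infty) (Rbar_locally p_infty) l.
Proof.
  intros Hp H0 H P [eps HP]. destruct (H (eps / 2) ltac:(generalize (cond_pos eps); lra)) as [M0 [HM0 K]].
  apply Filter_prod with (fun x => x < - M0) (fun x => M0 < x).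
  - exists (- M0); auto.
  - exists M0; auto.
  - intros x y Hx Hy. exists (RI phi x y). split; [apply (RInt_correct phi); auto|].
    apply HP. assert (Q1 := symlim_upper phi l Hp H0 H x y ltac:(lra)).
    assert (Q2 := RI_mono phi x (- M0) M0 y Hp H0 ltac:(lra) ltac:(lra) ltac:(lra)).
    specialize (K M0 ltac:(lra)). apply Rabs_le_between in K.
    change (Rabs (RI phi x y - l) < eps). apply Rabs_def1; generalize (cond_pos eps); lra.
Qed.

Lemma symlim_exists phi B : cont phi -> (forall x, 0 <= phi x) -> (forall M, 0 <= M -> RI phi (- M) M <= B) -> exists l, symlim phi l.
Proof.
  intros Hp H0 HB.
  destruct (completeness (fun y => exists M, 0 <= M /\ y = RI phi (- M) M)) as [l [Hl1 Hl2]].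
  - exists B. intros y [M [HM ->]]. auto.
  - exists (RI phi (- 0) 0), 0; split; [lra|auto].
  - exists l. intros eps He.
    assert (Ex : exists M, 0 <= M /\ l - eps < RI phi (- M) M).
    { apply NNPP; intros N. assert (l <= l - eps); [|lra]. apply Hl2. intros y [M [HM ->]].
      apply Rnot_lt_le; intros Q. apply N. exists M; auto. }
    destruct Ex as [M1 [HM1 K]]. exists (Rmax 1 M1). split; [apply Rmax_l|]. intros M HM.
    assert (A0 := Rle_trans _ _ _ (Rmax_l _ _) HM). assert (A1 := Rle_trans _ _ _ (Rmax_r _ _) HM).
    assert (Q := RI_mono phi (- M) (- M1) M1 M Hp H0 ltac:(lra) ltac:(lra) ltac:(lra)).
    assert (Q2 : RI phi (- M) M <= l) by (apply Hl1; exists M; split; [lra|auto]).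
    apply Rabs_le; lra.
Qed.

Lemma symlim_of_tends phi l : tends (fun M => RI phi (- M) M) l -> symlim phi l.
Proof.
  intros [C [HC H]] eps He. set (s := C / eps + 1).
  assert (Hs : 1 <= s) by (unfold s; assert (0 <= C / eps) by (apply Rdiv_le_0_compat; lra); lra).
  exists (s * s); split; [nra|]. intros M HM.
  assert (HM1 : 1 <= M) by nra. eapply Rle_trans; [apply (H M HM1)|].
  assert (Hsq : s <= sqrt M). { rewrite <- (sqrt_square s) by lra. apply sqrt_le_1_alt; auto. }
  apply Rle_div_l; [lra|]. apply Rle_trans with (eps * s); [|apply Rmult_le_compat_l; lra].
  unfold s. replace (eps * (C / eps + 1)) with (C + eps) by (field; lra). lra.
Qed.

Lemma symlim_lin phi psi l m a b : cont phi -> cont psi -> symlim phi l -> symlim psi m ->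
  symlim (fun x => a * phi x + b * psi x) (a * l + b * m).
Proof.
  intros Hp Hq H1 H2 eps He. set (q := Rabs a + Rabs b + 1).
  assert (Hqa := Rabs_pos a). assert (Hqb := Rabs_pos b). assert (Hq0 : 0 < q) by (unfold q; lra).
  assert (He' : 0 < eps / q) by (apply Rdiv_lt_0_compat; auto).
  destruct (H1 _ He') as [M1 [HM1 K1]]. destruct (H2 _ He') as [M2 [HM2 K2]].
  exists (Rmax M1 M2); split; [eapply Rle_trans; [exact HM1|apply Rmax_l]|]. intros M HM.
  specialize (K1 M (Rle_trans _ _ _ (Rmax_l _ _) HM)). specialize (K2 M (Rle_trans _ _ _ (Rmax_r _ _) HM)).
  rewrite RI_plus, !RI_scal by cont.
  replace (a * RI phi (- M) M + b * RI psi (- M) M - (a * l + b * m)) with (a * (RI phi (- M) M - l) + b * (RI psi (- M) M - m)) by ring.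
  eapply Rle_trans; [apply Rabs_triang|]. rewrite !Rabs_mult.
  set (e := eps / q) in *. replace eps with (e * q) by (unfold e; field; lra). unfold q.
  assert (Rabs a * Rabs (RI phi (- M) M - l) <= Rabs a * e) by (apply Rmult_le_compat_l; auto).
  assert (Rabs b * Rabs (RI psi (- M) M - m) <= Rabs b * e) by (apply Rmult_le_compat_l; auto). lra.
Qed.

Lemma wcont_bounds x : 0 <= wcont x <= 2.
Proof. rewrite wcont_snc. assert (H := snc_bound (2 * PI * x)). apply Rabs_le_between in H. lra. Qed.

Lemma cont_wcont : cont wcont.
Proof.
  assert (H := cont_snc). apply cont_ext with (fun x => 1 - snc (2 * PI * x)); [intros; symmetry; apply wcont_snc|]. cont.
Qed.

Lemma L2sq_unique F N : cont (absF2 F) -> symlim (absF2 F) N -> sq_integrable_R F /\ L2sq F = N.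
Proof.
  intros C1 H. assert (G := gen_of_symlim _ _ C1 (absF2_pos F) H). split.
  - exists N; exact G.
  - apply is_RInt_gen_unique; auto; apply Proper_StrongProper; typeclasses eauto.
Qed.

Lemma WL2sq_unique F W : cont (absF2 F) -> symlim (fun x => absF2 F x * wcont x) W -> WL2sq F = W + absF2 F 0.
Proof.
  intros C1 H. assert (Cw := cont_wcont).
  assert (G := gen_of_symlim (fun x => absF2 F x * wcont x) W ltac:(cont)
    (fun x => Rmult_le_pos _ _ (absF2_pos F x) (proj1 (wcont_bounds x))) H).
  unfold WL2sq. rewrite (is_RInt_gen_unique (V := R_CompleteNormedModule) _ _ G). reflexivity.
Qed.

Lemma PW_norms Delta F : PW Delta F -> exists N W, L2sq F = N /\ symlim (absF2 F) N /\
  WL2sq F = W + absF2 F 0 /\ symlim (fun x => absF2 F x * wcont x) W.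
Proof.
  intros [HF [Hty [N HN]]]. assert (C1 := cont_absF2 F HF). assert (Cw := cont_wcont).
  assert (S := symlim_of_gen _ _ C1 HN).
  destruct (symlim_exists (fun x => absF2 F x * wcont x) (2 * N)) as [W HW].
  - cont.
  - intros x. apply Rmult_le_pos; [apply absF2_pos|apply wcont_bounds].
  - intros M HM. apply Rle_trans with (2 * RI (absF2 F) (- M) M).
    + rewrite <- RI_scal by auto. apply RI_le; [lra|cont|cont|]. intros x _.
      assert (Q := wcont_bounds x). assert (Q2 := absF2_pos F x). nra.
    + apply Rmult_le_compat_l; [lra|]. apply (symlim_upper _ _ C1 (absF2_pos F) S); lra.
  - exists N, W. split; [apply (L2sq_unique F N C1 S)|]. split; auto. split; auto. apply WL2sq_unique; auto.
Qed.

(** [N - W] is the integral of [|F|^2] against [snc (2 PI x)]. The limit [X -> oo] removes the tail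
    term of [PW_ineq_X], because its integral over [[-(X/2 - 1), X/2 - 1]] tends to [N]. *)
Lemma PW_ineq Delta F N W al be : PW Delta F -> 0 < Delta -> symlim (absF2 F) N -> symlim (fun x => absF2 F x * wcont x) W ->
  form_bound (Delta / 2) al be -> be * absF2 F 0 <= al * N + be * (N - W).
Proof.
  intros [HF [Hty _]] HD HN HW Hform. assert (C1 := cont_absF2 F HF). assert (Cw := cont_wcont). assert (Cg := cont_wgt al be).
  destruct (entire_primitive F HF) as [G HG].
  assert (HB := symlim_upper _ _ C1 (absF2_pos F) HN).
  assert (SL := symlim_lin (absF2 F) (fun x => absF2 F x * wcont x) N W (al + be) (- be) C1 ltac:(cont) HN HW).
  replace (al * N + be * (N - W)) with ((al + be) * N + - be * W) by ring.
  apply le_epsilon; intros eps He.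
  set (B := Rabs al + Rabs be). assert (HB0 : 0 <= B) by (unfold B; generalize (Rabs_pos al) (Rabs_pos be); lra).
  destruct (SL (eps / 2) ltac:(lra)) as [M1 [HM1 K1]].
  destruct (HN (eps / (8 * B + 8)) ltac:(apply Rdiv_lt_0_compat; lra)) as [M2 [HM2 K2]].
  set (X := Rmax (Rmax 4 M1) (2 * M2 + 2)).
  assert (X4 : 4 <= X) by (eapply Rle_trans; [apply Rmax_l|apply Rmax_l]).
  assert (X1 : M1 <= X) by (eapply Rle_trans; [apply Rmax_r|apply Rmax_l]).
  assert (X2 : 2 * M2 + 2 <= X) by apply Rmax_r.
  assert (I := PW_ineq_X F G Delta HG HF Hty HD N HB X al be X4 Hform). fold B in I.
  specialize (K1 X X1). specialize (K2 (X / 2 - 1) ltac:(lra)).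
  rewrite (RI_ext _ (fun x => (al + be) * absF2 F x + - be * (absF2 F x * wcont x))) in I.
  2:{ intros x. rewrite wcont_snc. unfold wgt. ring. }
  apply Rabs_le_between in K1. apply Rabs_le_between in K2.
  set (t := eps / (8 * B + 8)) in *. assert (Et : t * (8 * B + 8) = eps) by (unfold t; field; lra).
  assert (Ht0 : 0 < t) by (unfold t; apply Rdiv_lt_0_compat; lra).
  assert (B * (4 * (N - RI (absF2 F) (- (X / 2 - 1)) (X / 2 - 1))) <= B * (4 * t)) by (apply Rmult_le_compat_l; lra).
  nra.
Qed.

Lemma RI_pos_of_pos phi x0 : cont phi -> (forall x, 0 <= phi x) -> 0 < phi x0 -> 0 < RI phi (x0 - 1) (x0 + 1).
Proof.
  intros Hp H0 Hx. destruct (cont_pt phi Hp x0 (phi x0 / 2) ltac:(lra)) as [d [Hd K]].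
  set (e := Rmin (d / 2) 1). assert (He : 0 < e) by (apply Rmin_glb_lt; lra). assert (He1 : e <= 1) by apply Rmin_r. assert (He2 : e <= d / 2) by apply Rmin_l.
  apply Rlt_le_trans with (RI (fun _ => phi x0 / 2) (x0 - e) (x0 + e)).
  - rewrite RI_const. apply Rmult_lt_0_compat; lra.
  - apply Rle_trans with (RI phi (x0 - e) (x0 + e)); [|apply RI_mono; auto; lra].
    apply RI_le; auto; [lra|cont|]. intros x Hx'. destruct (Req_dec x x0) as [->|Hne]; [lra|].
    assert (Q := K x). simpl in Q; unfold R_dist in Q.
    assert (Q' : Rabs (phi x - phi x0) < phi x0 / 2).
    { apply Q. split; [split; [exact I|auto]|]. apply Rabs_def1; lra. }
    apply Rabs_def2 in Q'. lra.
Qed.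

Lemma PW_pos Delta F N : PW Delta F -> 0 < Delta -> symlim (absF2 F) N -> (exists z, F z <> 0%C) -> 0 < N.
Proof.
  intros [HF [Hty _]] HD HN [z Hz]. assert (C1 := cont_absF2 F HF).
  assert (HB := symlim_upper _ _ C1 (absF2_pos F) HN). generalize PI_RGT_0; intros HP.
  apply Rnot_le_lt; intros HN0. apply Hz. apply (entire_zero F (PI * Delta)); auto; [nra|].
  intros x. apply Cmod_eq_0. destruct (Req_dec (absF2 F x) 0) as [E|E].
  - unfold absF2 in E. simpl in E. rewrite Rmult_1_r in E. apply Rmult_integral in E. tauto.
  - exfalso. assert (Q := absF2_pos F x). assert (Q2 := RI_pos_of_pos _ x C1 (absF2_pos F) ltac:(lra)).
    specialize (HB (x - 1) (x + 1) ltac:(lra)). lra.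
Qed.

Lemma ratio_sqrt F : 0 < L2sq F -> ratio F = sqrt (WL2sq F / L2sq F).
Proof. intros H. unfold ratio. rewrite sqrt_div_alt; auto. Qed.

Lemma ratios_bounds Delta lo hi : 0 < Delta -> form_bound (Delta / 2) (- lo) (-1) -> form_bound (Delta / 2) hi 1 ->
  forall r, ratios Delta r -> sqrt (1 + lo) <= r <= sqrt (1 + hi).
Proof.
  intros HD Hlo Hhi r [F [HF [Hnz ->]]].
  destruct (PW_norms Delta F HF) as [N [W [E1 [S1 [E2 S2]]]]].
  assert (HN := PW_pos Delta F N HF HD S1 Hnz).
  rewrite ratio_sqrt by lra. rewrite E1, E2.
  assert (I1 := PW_ineq Delta F N W _ _ HF HD S1 S2 Hlo). assert (I2 := PW_ineq Delta F N W _ _ HF HD S1 S2 Hhi).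
  split; apply sqrt_le_1_alt; [apply Rle_div_r|apply Rle_div_l]; nra.
Qed.

(** The extremal [F] is the transform of [f]. Parseval is a hypothesis because it is not derived
    from mere continuity of [f]; each extremal function supplies it through its smooth pieces. *)
Lemma ratios_attained Delta f c : 0 < Delta -> cont f ->
  tends (fun M => RI (fun x => hart (Delta / 2) f x ^ 2) (- M) M) (RI (fun t => f t ^ 2) (- (Delta / 2)) (Delta / 2)) ->
  0 < RI (fun t => f t ^ 2) (- (Delta / 2)) (Delta / 2) ->
  qform (Delta / 2) f = c * RI (fun t => f t ^ 2) (- (Delta / 2)) (Delta / 2) -> ratios Delta (sqrt (1 + c)).
Proof.
  intros HD Hf HT HN Hq. set (a := Delta / 2) in *. assert (Ha : 0 < a) by (unfold a; lra).
  set (N := RI (fun t => f t ^ 2) (- a) a) in *.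
  assert (HTf := hasder_Tf a f Hf Ha). assert (EF := hasder_entire _ _ HTf). assert (C1 := cont_absF2 _ EF).
  assert (Eabs : forall x, absF2 (Tf a f) x = hart a f x ^ 2) by (intros x; rewrite absF2_eq, Tf_real; simpl; ring).
  assert (Ch := cont_hart a f Hf). assert (Cw := cont_wcont). assert (Cs := cont_snc).
  assert (S1 : symlim (absF2 (Tf a f)) N).
  { apply symlim_of_tends. eapply tends_ext; [|exact HT]. intros M _. apply RI_ext; intros; symmetry; apply Eabs. }
  destruct (cont_bounded f (- a) a Hf ltac:(lra)) as [B [HB Hb]].
  assert (S2 := symlim_of_tends _ _ (hart_snc_lim a f B Hf Ha HB Hb)).
  set (S := RI (fun s => f s * (RI f (- a) (clip a (s + 1)) - RI f (- a) (clip a (s - 1)))) (- a) a / 2) in *.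
  assert (S3 : symlim (fun x => absF2 (Tf a f) x * wcont x) (1 * N + -1 * S)).
  { assert (C2 : cont (fun x => hart a f x ^ 2 * snc (2 * PI * x))) by cont.
    assert (Q := symlim_lin _ _ N S 1 (-1) C1 C2 S1 S2). intros eps He. destruct (Q eps He) as [M0 [HM0 K]].
    exists M0; split; auto. intros M HM. rewrite (RI_ext _ (fun x => 1 * absF2 (Tf a f) x + -1 * (hart a f x ^ 2 * snc (2 * PI * x)))); auto.
    intros x. rewrite wcont_snc, Eabs. ring. }
  destruct (L2sq_unique _ _ C1 S1) as [Hsq EL]. assert (EW := WL2sq_unique _ _ C1 S3).
  exists (Tf a f). split; [|split].
  - split; [auto|split; [|auto]]. replace (PI * Delta) with (2 * PI * a) by (unfold a; field). apply Tf_exp_type; auto.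
  - apply NNPP; intros Nz. assert (Z : forall z, Tf a f z = 0%C) by (intros z; apply NNPP; intros Q; apply Nz; exists z; auto).
    assert (N <= 0); [|lra]. apply le_epsilon; intros eps He. destruct (S1 eps He) as [M0 [HM0 K]]. specialize (K M0 ltac:(lra)).
    rewrite (RI_ext _ (fun _ => 0)), RI_const in K by (intros; unfold absF2; rewrite Z, Cmod_0; ring).
    apply Rabs_le_between in K. lra.
  - rewrite ratio_sqrt by lra. f_equal. rewrite EL, EW, Eabs, hart_0.
    assert (Eq : qform a f = RI f (- a) a ^ 2 - S) by reflexivity. rewrite Hq in Eq.
    replace (1 * N + -1 * S + RI f (- a) a ^ 2) with (N + c * N) by (rewrite Eq; ring). field. lra.
Qed.

Lemma lub_glb_of_bounds E lo hi : (forall r, E r -> lo <= r <= hi) -> E lo -> E hi -> is_glb_Rbar E (Finite lo) /\ is_lub_Rbar E (Finite hi).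
Proof.
  intros H Hlo Hhi. split; split.
  - intros r Hr. apply (H r Hr).
  - intros b Hb. apply (Hb lo Hlo).
  - intros r Hr. apply (H r Hr).
  - intros b Hb. apply (Hb hi Hhi).
Qed.

(** The form is [(int f)^2 / 2]. It vanishes for functions of mean zero, such as [t], and
    Cauchy-Schwarz is an equality for constants, with the value [a = Delta / 2]. *)
Lemma theorem18_small Delta : 0 < Delta <= 1 ->
  is_glb_Rbar (ratios Delta) (Finite 1) /\ is_lub_Rbar (ratios Delta) (Finite (sqrt (1 + Delta / 2))).
Proof.
  intros HD. set (a := Delta / 2). assert (Ha : 0 < a <= 1 / 2) by (unfold a; lra).
  replace 1 with (sqrt (1 + 0)) at 1 by (rewrite Rplus_0_r; apply sqrt_1).
  assert (P : forall g dg, (forall x, is_derive g x (dg x)) -> cont dg ->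
    tends (fun M => RI (fun x => hart a g x ^ 2) (- M) M) (RI (fun t => g t ^ 2) (- a) a)).
  { intros g dg Hg Cdg. assert (Cg := cont_derive _ _ Hg).
    eapply tends_ext; [|apply (hart_sqr_piece a g (- a) a g dg); auto; lra].
    intros M _. cbv beta. rewrite hart_sqr_dk; auto. }
  apply lub_glb_of_bounds.
  - apply ratios_bounds; [lra| |]; intros f Hf; fold a; rewrite qform_small by auto.
    + generalize (pow2_ge_0 (RI f (- a) a)); lra.
    + assert (Q := RI_sqr_le f (- a) a ltac:(lra) Hf). lra.
  - assert (D1 : forall x, is_derive (fun x : R => x) x 1) by (intros x; auto_derive; auto).
    apply (ratios_attained Delta (fun t => t) 0); fold a; [lra|cont|apply (P _ (fun _ => 1)); [auto|cont]| |].
    + rewrite (RI_FTC (fun t => t ^ 3 / 3)); [|intros x; auto_derive; auto; field|cont].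
      assert (0 < a ^ 3) by (apply pow_lt; lra). replace (a ^ 3 / 3 - (- a) ^ 3 / 3) with (2 * a ^ 3 / 3) by field. lra.
    + rewrite qform_small, (RI_odd (fun t => t)) by (try lra; cont; intros; ring). lra.
  - apply (ratios_attained Delta (fun t => 1)); fold a; [lra|cont| | |].
    + apply (P _ (fun _ => 0)); [|cont]. intros x; auto_derive; auto.
    + rewrite RI_const. lra.
    + rewrite qform_small, !RI_const by (try lra; cont). field.
Qed.

(** * Extremal functions for [1 < Delta <= 2] *)

(** Equality in the completed square and in the Wirtinger step forces [p = cos (k u)] and
    [q = sin (k u)] up to scaling, that is [cas (k u)] with [u = s - 1/2]. Through [Rmax] the arm is
    continued as a constant to the left, so continuity is automatic. *)
Definition arm (k a s : R) : R := cas (k * (Rmax s (1 - a) - 1/2)).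

Lemma cont_arm k a : cont (arm k a).
Proof. unfold arm. apply (cont_comp cas); [apply cont_cas|cont]. Qed.

Lemma arm_hi k a s : 1 - a <= s -> arm k a s = cas (k * (s - 1/2)).
Proof. intros H; unfold arm. rewrite Rmax_left; auto. Qed.

Lemma arm_lo k a s : s <= 1 - a -> arm k a s = cas (k * (1/2 - a)).
Proof. intros H; unfold arm. rewrite Rmax_right by auto. f_equal; field. Qed.

(** Subtracting the common constant leaves [cas] on the right arm, its mirror image on the left, and
    a constant in the middle, as equality in Cauchy-Schwarz requires. The odd variant needs that
    constant to vanish, which happens at the angle [PI / 4]. *)
Definition ext_even (k a s : R) : R := arm k a s + arm k a (- s) - cas (k * (1/2 - a)).
Definition ext_odd (k a s : R) : R := arm k a s - arm k a (- s).

Lemma cont_ext_even k a : cont (ext_even k a).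
Proof. assert (H := cont_arm k a). unfold ext_even. cont. Qed.

Lemma cont_ext_odd k a : cont (ext_odd k a).
Proof. assert (H := cont_arm k a). unfold ext_odd. cont. Qed.

Lemma ext_even_neg k a s : ext_even k a (- s) = ext_even k a s.
Proof. unfold ext_even. rewrite Ropp_involutive. ring. Qed.

Lemma ext_odd_neg k a s : ext_odd k a (- s) = - ext_odd k a s.
Proof. unfold ext_odd. rewrite Ropp_involutive. ring. Qed.

Lemma ext_even_hi k a s : 1/2 < a <= 1 -> 1 - a <= s -> ext_even k a s = cas (k * (s - 1/2)).
Proof. intros Ha Hs. unfold ext_even. rewrite arm_hi, arm_lo by lra. ring. Qed.

Lemma ext_even_mid k a s : - (1 - a) <= s <= 1 - a -> ext_even k a s = cas (k * (1/2 - a)).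
Proof. intros Hs. unfold ext_even. rewrite !arm_lo by lra. ring. Qed.

Lemma ext_odd_hi k a s : 1/2 < a <= 1 -> 1 - a <= s -> cas (k * (1/2 - a)) = 0 -> ext_odd k a s = cas (k * (s - 1/2)).
Proof. intros Ha Hs H0. unfold ext_odd. rewrite arm_hi, arm_lo by lra. lra. Qed.

Lemma ext_odd_mid k a s : - (1 - a) <= s <= 1 - a -> ext_odd k a s = 0.
Proof. intros Hs. unfold ext_odd. rewrite !arm_lo by lra. ring. Qed.

Lemma parseval_three_pieces a f g1 dg1 g2 dg2 g3 dg3 : cont f -> 1/2 < a <= 1 ->
  (forall x, is_derive g1 x (dg1 x)) -> cont dg1 -> (forall x, is_derive g2 x (dg2 x)) -> cont dg2 ->
  (forall x, is_derive g3 x (dg3 x)) -> cont dg3 ->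
  (forall x, - a < x < - (1 - a) -> f x = g1 x) -> (forall x, - (1 - a) < x < 1 - a -> f x = g2 x) ->
  (forall x, 1 - a < x < a -> f x = g3 x) ->
  tends (fun M => RI (fun x => hart a f x ^ 2) (- M) M) (RI (fun t => f t ^ 2) (- a) a).
Proof.
  intros Hf Ha H1 C1 H2 C2 H3 C3 E1 E2 E3.
  assert (T1 := hart_sqr_piece a f (- a) (- (1 - a)) g1 dg1 Hf ltac:(lra) ltac:(lra) ltac:(lra) ltac:(lra) H1 C1 E1).
  assert (T2 := hart_sqr_piece a f (- (1 - a)) (1 - a) g2 dg2 Hf ltac:(lra) ltac:(lra) ltac:(lra) ltac:(lra) H2 C2 E2).
  assert (T3 := hart_sqr_piece a f (1 - a) a g3 dg3 Hf ltac:(lra) ltac:(lra) ltac:(lra) ltac:(lra) H3 C3 E3).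
  assert (Cs : cont (fun t => f t ^ 2)) by cont.
  rewrite <- (RI_Chasles _ (- a) (- (1 - a)) a Cs), <- (RI_Chasles _ (- (1 - a)) (1 - a) a Cs).
  eapply tends_ext; [|apply (tends_plus _ _ _ _ T1 (tends_plus _ _ _ _ T2 T3))].
  intros M _. cbv beta. rewrite hart_sqr_dk by auto.
  assert (Cd := cont_dk M).
  assert (Cm : cont (fun s => f s * RI (fun t => f t * dk M (s - t)) (- a) a)).
  { apply cont_mult; auto. apply (cont_RI_param (fun t s => f t * dk M (s - t))). cont2. }
  rewrite (RI_Chasles _ (- (1 - a)) (1 - a) a Cm), (RI_Chasles _ (- a) (- (1 - a)) a Cm). reflexivity.
Qed.

Lemma is_derive_cas_lin c k d x : is_derive (fun s => c * cas (k * (d * s - 1/2))) x (c * (k * d * (cos (k * (d * x - 1/2)) - sin (k * (d * x - 1/2))))).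
Proof. unfold cas. auto_derive; auto. unfold Rminus. ring. Qed.

(** Here [sg] is the parity, taken as 1 or -1 in the applications, and not the kernel of the same
    name. The three pieces are the two arms and the middle. *)
Lemma ext_parseval k a sg c0 f : cont f -> 1/2 < a <= 1 ->
  (forall s, 1 - a <= s -> f s = cas (k * (s - 1/2))) -> (forall s, f (- s) = sg * f s) ->
  (forall s, - (1 - a) <= s <= 1 - a -> f s = c0) ->
  tends (fun M => RI (fun x => hart a f x ^ 2) (- M) M) (RI (fun t => f t ^ 2) (- a) a).
Proof.
  intros Hf Ha Hhi Hsg Hmid.
  apply (parseval_three_pieces a f (fun s => sg * cas (k * (-1 * s - 1/2))) (fun x => sg * (k * -1 * (cos (k * (-1 * x - 1/2)) - sin (k * (-1 * x - 1/2)))))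
    (fun _ => c0) (fun _ => 0)
    (fun s => 1 * cas (k * (1 * s - 1/2))) (fun x => 1 * (k * 1 * (cos (k * (1 * x - 1/2)) - sin (k * (1 * x - 1/2)))))); auto.
  - intros x; apply is_derive_cas_lin.
  - cont.
  - intros x; auto_derive; auto.
  - cont.
  - intros x; apply is_derive_cas_lin.
  - cont.
  - intros s Hs. replace s with (- - s) at 1 by ring. rewrite Hsg, Hhi by lra. do 3 f_equal. ring.
  - intros s Hs. apply Hmid; lra.
  - intros s Hs. rewrite Hhi, !Rmult_1_l by lra. auto.
Qed.

Lemma RI_cos_lin k L : k <> 0 -> RI (fun u => cos (k * u)) 0 L = sin (k * L) / k.
Proof.
  intros Hk. rewrite (RI_FTC (fun u => sin (k * u) / k)); [|intros x; auto_derive; auto; field; auto|cont].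
  rewrite Rmult_0_r, sin_0. field; auto.
Qed.

Lemma RI_sin_sqr k L : k <> 0 -> RI (fun u => sin (k * u) * (sin (k * u) / k)) 0 L = (L - sin (k * L) * cos (k * L) / k) / (2 * k).
Proof.
  intros Hk. rewrite (RI_FTC (fun u => (u - sin (k * u) * cos (k * u) / k) / (2 * k))); [| |cont].
  - rewrite !Rmult_0_r, sin_0. field; auto.
  - intros x. auto_derive; auto. assert (E := sin2_cos2 (k * x)). unfold Rsqr in E.
    replace (/ (2 * k)) with (/ 2 * / k) by (field; auto).
    transitivity (/ 2 * / k * (1 - (cos (k * x) * cos (k * x) - sin (k * x) * sin (k * x)))); [field; auto|].
    rewrite <- E. field; auto.
Qed.

(* Both extremal functions are [cas (k u)] in the folded variable. *)
Lemma trig_half_form p q k L : cont p -> cont q -> k <> 0 -> 0 < L ->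
  (forall u, 0 < u < L -> p u = cos (k * u)) -> (forall u, 0 < u < L -> q u = sin (k * u)) ->
  RI p 0 L = sin (k * L) / k /\ RI (fun u => q u * RI p 0 u) 0 L = (L - sin (k * L) * cos (k * L) / k) / (2 * k)
  /\ RI (fun u => p u ^ 2 + q u ^ 2) 0 L = L.
Proof.
  intros Cp Cq Hk HL Hp Hq. split; [|split].
  - rewrite <- RI_cos_lin by auto. apply RI_ext_le; [lra|auto].
  - rewrite <- RI_sin_sqr by auto. apply RI_ext_le; [lra|]. intros u Hu. rewrite Hq by auto. f_equal.
    rewrite <- RI_cos_lin by auto. apply RI_ext_le; [lra|]. intros v Hv; apply Hp; lra.
  - rewrite (RI_ext_le _ (fun _ => 1)); [rewrite RI_const; ring|lra|]. intros u Hu. rewrite Hp, Hq by auto.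
    generalize (sin2_cos2 (k * u)); unfold Rsqr; intros E. rewrite <- E. ring.
Qed.

Lemma zero_half_form p q L : 0 < L -> (forall u, 0 < u < L -> p u = 0) -> (forall u, 0 < u < L -> q u = 0) ->
  RI p 0 L = 0 /\ RI (fun u => q u * RI p 0 u) 0 L = 0 /\ RI (fun u => p u ^ 2 + q u ^ 2) 0 L = 0.
Proof.
  intros HL Hp Hq. split; [|split].
  - rewrite (RI_ext_le _ (fun _ => 0)); [rewrite RI_const; ring|lra|auto].
  - rewrite (RI_ext_le _ (fun _ => 0)); [rewrite RI_const; ring|lra|]. intros u Hu. rewrite Hq by auto. ring.
  - rewrite (RI_ext_le _ (fun _ => 0)); [rewrite RI_const; ring|lra|]. intros u Hu. rewrite Hp, Hq by auto. ring.
Qed.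

Lemma cas_even_part x : (cas x + cas (- x)) / 2 = cos x.
Proof. unfold cas. rewrite cos_neg, sin_neg. field. Qed.

Lemma cas_odd_part x : (cas x - cas (- x)) / 2 = sin x.
Proof. unfold cas. rewrite cos_neg, sin_neg. field. Qed.

Lemma ext_even_form a theta : 1/2 < a <= 1 -> 0 < theta < PI / 4 ->
  (1 - 4 * theta * (1 - a) / (2 * a - 1)) * (cos theta - sin theta) = 4 * sin theta ->
  let f := ext_even (theta / (a - 1/2)) a in
  0 < RI (fun t => f t ^ 2) (- a) a /\ qform a f = (2 * a - 1) / (4 * theta) * RI (fun t => f t ^ 2) (- a) a.
Proof.
  intros Ha Ht Heq f. set (k := theta / (a - 1/2)) in *. set (L := a - 1/2) in *.
  assert (HL : 0 < L) by (unfold L; lra). assert (Hk : 0 < k) by (apply Rdiv_lt_0_compat; lra).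
  assert (EkL : k * L = theta) by (unfold k; field; lra).
  assert (Cf : cont f) by apply cont_ext_even. destruct (cont_parts f Cf) as [C1 [C2 [C3 C4]]].
  assert (V1 : forall u, 0 < u < L -> f (1/2 + u) = cas (k * u) /\ f (1/2 - u) = cas (- (k * u))
     /\ f (-1/2 - u) = cas (k * u) /\ f (-1/2 + u) = cas (- (k * u))).
  { intros u Hu. unfold L in Hu. unfold f.
    replace (-1/2 - u) with (- (1/2 + u)) by field. replace (-1/2 + u) with (- (1/2 - u)) by field. rewrite !ext_even_neg.
    rewrite !ext_even_hi by lra. repeat split; f_equal; field. }
  destruct (trig_half_form (evp f) (evq f) k L C1 C2 ltac:(lra) HL) as [A1 [A2 A3]].
  { intros u Hu. destruct (V1 u Hu) as [E1 [E2 [E3 E4]]]. unfold evp. rewrite E1, E2, E3, E4, <- cas_even_part. field. }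
  { intros u Hu. destruct (V1 u Hu) as [E1 [E2 [E3 E4]]]. unfold evq. rewrite E1, E2, E3, E4, <- cas_odd_part. field. }
  destruct (zero_half_form (odp f) (odq f) L HL) as [B1 [B2 B3]].
  { intros u Hu. destruct (V1 u Hu) as [E1 [E2 [E3 E4]]]. unfold odp. rewrite E1, E2, E3, E4. field. }
  { intros u Hu. destruct (V1 u Hu) as [E1 [E2 [E3 E4]]]. unfold odq. rewrite E1, E2, E3, E4. field. }
  rewrite qform_parts, RI_sqr_parts by auto. fold L. rewrite A1, A2, A3, B1, B2, B3. rewrite EkL.
  set (f0 := cas (k * (1/2 - a))).
  assert (Ef0 : f0 = cos theta - sin theta).
  { unfold f0. replace (k * (1/2 - a)) with (- theta) by (rewrite <- EkL; unfold L; ring). unfold cas. rewrite cos_neg, sin_neg. ring. }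
  assert (M1 : RI f (- (1 - a)) (1 - a) = 2 * (1 - a) * f0).
  { rewrite (RI_ext_le _ (fun _ => f0)), RI_const; [ring|lra|]. intros s Hs. apply ext_even_mid; lra. }
  assert (M2 : RI (fun s => f s ^ 2) (- (1 - a)) (1 - a) = 2 * (1 - a) * f0 ^ 2).
  { rewrite (RI_ext_le _ (fun _ => f0 ^ 2)), RI_const; [ring|lra|]. intros s Hs. unfold f. rewrite ext_even_mid by lra. reflexivity. }
  rewrite M1, M2. split.
  - assert (0 <= f0 ^ 2) by apply pow2_ge_0. nra.
  - assert (Eeta : (2 * a - 1) / (4 * theta) = 1 / (2 * k)) by (unfold k, L; field; lra). rewrite Eeta.
    assert (Eq : 4 * theta * (1 - a) / (2 * a - 1) = 2 * k * (1 - a)) by (unfold k, L; field; lra).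
    rewrite Eq, <- Ef0 in Heq.
    (* The equation for [theta] makes both [s] and [cos theta] multiples of [f0], after which the
       claim is a rational identity. *)
    set (s := sin theta) in *. assert (Ec : cos theta = f0 + s) by lra. rewrite Ec.
    assert (Es : s = (1 - 2 * k * (1 - a)) * f0 / 4) by lra. rewrite Es. field. lra.
Qed.

Lemma ext_odd_form a : 1/2 < a <= 1 ->
  let f := ext_odd (PI / 4 / (a - 1/2)) a in
  0 < RI (fun t => f t ^ 2) (- a) a /\ qform a f = - ((2 * a - 1) / PI) * RI (fun t => f t ^ 2) (- a) a.
Proof.
  intros Ha f. generalize PI_RGT_0; intros HP. set (k := PI / 4 / (a - 1/2)) in *. set (L := a - 1/2) in *.
  assert (HL : 0 < L) by (unfold L; lra). assert (Hk : 0 < k) by (apply Rdiv_lt_0_compat; lra).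
  assert (EkL : k * L = PI / 4) by (unfold k; field; lra).
  assert (H0 : cas (k * (1/2 - a)) = 0).
  { replace (k * (1/2 - a)) with (- (PI / 4)) by (rewrite <- EkL; unfold L; ring). unfold cas. rewrite cos_neg, sin_neg, cos_PI4, sin_PI4. ring. }
  assert (Cf : cont f) by apply cont_ext_odd. destruct (cont_parts f Cf) as [C1 [C2 [C3 C4]]].
  assert (V1 : forall u, 0 < u < L -> f (1/2 + u) = cas (k * u) /\ f (1/2 - u) = cas (- (k * u))
     /\ f (-1/2 - u) = - cas (k * u) /\ f (-1/2 + u) = - cas (- (k * u))).
  { intros u Hu. unfold L in Hu. unfold f.
    replace (-1/2 - u) with (- (1/2 + u)) by field. replace (-1/2 + u) with (- (1/2 - u)) by field. rewrite !ext_odd_neg.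
    rewrite !ext_odd_hi by (auto; lra). repeat split; do 2 f_equal; try field. }
  destruct (trig_half_form (odp f) (odq f) k L C3 C4 ltac:(lra) HL) as [A1 [A2 A3]].
  { intros u Hu. destruct (V1 u Hu) as [E1 [E2 [E3 E4]]]. unfold odp. rewrite E1, E2, E3, E4, <- cas_even_part. field. }
  { intros u Hu. destruct (V1 u Hu) as [E1 [E2 [E3 E4]]]. unfold odq. rewrite E1, E2, E3, E4, <- cas_odd_part. field. }
  destruct (zero_half_form (evp f) (evq f) L HL) as [B1 [B2 B3]].
  { intros u Hu. destruct (V1 u Hu) as [E1 [E2 [E3 E4]]]. unfold evp. rewrite E1, E2, E3, E4. field. }
  { intros u Hu. destruct (V1 u Hu) as [E1 [E2 [E3 E4]]]. unfold evq. rewrite E1, E2, E3, E4. field. }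
  rewrite qform_parts, RI_sqr_parts by auto. fold L. rewrite A1, A2, A3, B1, B2, B3. rewrite EkL.
  rewrite (RI_odd f), (RI_ext_le (fun s => f s ^ 2) (fun _ => 0)), RI_const; [| lra | | auto | apply ext_odd_neg].
  2:{ intros s Hs. unfold f. rewrite ext_odd_mid by lra. ring. }
  split; [lra|].
  assert (Eeta : (2 * a - 1) / PI = 1 / (2 * k)) by (unfold k, L; field; lra). rewrite Eeta.
  assert (Ecs : cos (PI / 4) = sin (PI / 4)) by (rewrite cos_PI4, sin_PI4; auto). rewrite Ecs. field. lra.
Qed.

(** * The equation for eta in the variable theta *)

Lemma theta_exists Delta : 1 < Delta <= 2 -> exists theta, 0 < theta < PI / 4 /\
  (1 - 2 * theta * (2 - Delta) / (Delta - 1)) * (cos theta - sin theta) = 4 * sin theta.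
Proof.
  intros HD. generalize PI_RGT_0; intros HP.
  set (h := fun t => 4 * sin t - (1 - 2 * t * (2 - Delta) / (Delta - 1)) * (cos t - sin t)).
  assert (Ch : cont h) by (unfold h; cont).
  assert (H0 : h 0 < 0) by (unfold h; rewrite sin_0, cos_0; replace (2 * 0 * (2 - Delta) / (Delta - 1)) with 0 by (field; lra); lra).
  assert (Hs4 : 0 < sin (PI / 4)) by (apply sin_gt_0; lra).
  assert (H1 : 0 < h (PI / 4)).
  { unfold h. replace (cos (PI / 4)) with (sin (PI / 4)) by (rewrite sin_PI4, cos_PI4; auto). lra. }
  destruct (IVT h 0 (PI / 4)) as [t [Ht Hz]]; auto; [intros x; apply cont_pt; auto|lra|].
  exists t. split; [|unfold h in Hz; lra].
  split; apply Rnot_le_lt; intros Q.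
  - replace t with 0 in Hz by lra. lra.
  - replace t with (PI / 4) in Hz by lra. lra.
Qed.

(** The argument of the trigonometric functions is [2 * theta]; the double angle formulas and
    [1 = sin^2 + cos^2] give both sides the common factor [cos theta + sin theta]. Cancelling it
    leaves the condition of [qform_upper]. *)
Lemma eta_eq_theta Delta theta : 1 < Delta -> theta <> 0 ->
  (eta_eq Delta ((Delta - 1) / (4 * theta)) <->
   (3 - 2 * theta * (2 - Delta) / (Delta - 1)) * ((cos theta - sin theta) * (cos theta + sin theta)) = 2 * (cos theta + sin theta) ^ 2).
Proof.
  intros HD Ht. unfold eta_eq.
  assert (E1 : (Delta - 1) / (2 * ((Delta - 1) / (4 * theta))) = 2 * theta) by (field; lra).
  assert (E2 : (2 - Delta) / (4 * ((Delta - 1) / (4 * theta))) = theta * (2 - Delta) / (Delta - 1)) by (field; lra).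
  rewrite E1, E2, cos_2a, sin_2a. assert (E := sin2_cos2 theta). unfold Rsqr in E.
  set (c := cos theta) in *. set (s := sin theta) in *.
  assert (Er : 2 * theta * (2 - Delta) / (Delta - 1) = 2 * (theta * (2 - Delta) / (Delta - 1))) by (field; lra). rewrite Er.
  set (r := theta * (2 - Delta) / (Delta - 1)) in *.
  assert (Hne : (Delta - 1) / (4 * theta) <> 0).
  { unfold Rdiv. apply Rmult_integral_contrapositive_currified; [lra|]. apply Rinv_neq_0_compat. lra. }
  replace (2 * (c + s) ^ 2) with (2 + 4 * (s * c)) by (rewrite <- (Rmult_1_r 2) at 1; rewrite <- E; ring).
  split; [intros [_ H]|intros H; split; auto]; lra.
Qed.

Lemma cos_sin_pos t : 0 < t < PI / 4 -> 0 < sin t /\ 0 < cos t - sin t.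
Proof.
  intros Ht. generalize PI_RGT_0; intros HP. split; [apply sin_gt_0; lra|].
  assert (sin t < cos (PI / 4)) by (rewrite cos_PI4, <- sin_PI4; apply sin_increasing_1; lra).
  assert (cos (PI / 4) < cos t) by (apply cos_decreasing_1; lra). lra.
Qed.

Lemma eta_as_theta Delta eta : 1 < Delta -> eta <> 0 -> eta = (Delta - 1) / (4 * ((Delta - 1) / (4 * eta))).
Proof. intros HD He. field. split; lra. Qed.

(** A larger [eta] means a smaller positive angle [t < theta]. There the common factor is positive,
    and passing from [theta] to [t] raises [(1 - q) * (cos - sin)] while lowering [4 * sin], so no
    root is left. *)
Lemma eta_max Delta theta eta : 1 < Delta <= 2 -> 0 < theta < PI / 4 ->
  (1 - 2 * theta * (2 - Delta) / (Delta - 1)) * (cos theta - sin theta) = 4 * sin theta ->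
  eta_eq Delta eta -> eta <= (Delta - 1) / (4 * theta).
Proof.
  intros HD Ht Heq He. apply Rnot_lt_le; intros Hlt.
  assert (Hp : 0 < (Delta - 1) / (4 * theta)) by (apply Rdiv_lt_0_compat; lra).
  set (t := (Delta - 1) / (4 * eta)).
  assert (Ht0 : 0 < t) by (apply Rdiv_lt_0_compat; lra).
  assert (Htt : t < theta).
  { unfold t. apply Rlt_div_l; [lra|]. apply Rlt_div_l in Hlt; lra. }
  rewrite (eta_as_theta Delta eta) in He by lra. fold t in He.
  apply eta_eq_theta in He; [|lra|lra].
  destruct (cos_sin_pos t ltac:(lra)) as [S1 S2]. destruct (cos_sin_pos theta Ht) as [S3 S4].
  generalize PI_RGT_0; intros HP.
  assert (D1 : sin t < sin theta) by (apply sin_increasing_1; lra).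
  assert (D2 : cos theta < cos t) by (apply cos_decreasing_1; lra).
  set (q := 2 * t * (2 - Delta) / (Delta - 1)) in *. set (q0 := 2 * theta * (2 - Delta) / (Delta - 1)) in *.
  assert (Hq : q <= q0).
  { unfold q, q0, Rdiv. apply Rmult_le_compat_r; [apply Rlt_le, Rinv_0_lt_compat; lra|]. apply Rmult_le_compat_r; lra. }
  assert (Hq0 : 0 < 1 - q0). { apply Rmult_lt_reg_r with (cos theta - sin theta); auto. rewrite Rmult_0_l, Heq. lra. }
  assert (He' : (3 - q) * (cos t - sin t) = 2 * (cos t + sin t)).
  { apply Rmult_eq_reg_r with (cos t + sin t); [|lra]. lra. }
  assert (K1 : (1 - q0) * (cos theta - sin theta) < (1 - q0) * (cos t - sin t)) by (apply Rmult_lt_compat_l; lra).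
  assert (K2 : (1 - q0) * (cos t - sin t) <= (1 - q) * (cos t - sin t)) by (apply Rmult_le_compat_r; lra).
  lra.
Qed.

(** A smaller [eta] means an angle [- t] with [0 < t < PI / 4]. The common factor [cos t - sin t] is
    then nonzero, and the remaining equation fails because [3 (cos t + sin t)] exceeds
    [2 (cos t - sin t)]. *)
Lemma eta_min Delta eta : 1 < Delta <= 2 -> eta_eq Delta eta -> - ((Delta - 1) / PI) <= eta.
Proof.
  intros HD He. apply Rnot_lt_le; intros Hlt. generalize PI_RGT_0; intros HP.
  assert (Hp : 0 < (Delta - 1) / PI) by (apply Rdiv_lt_0_compat; lra).
  set (t := (Delta - 1) / (4 * - eta)).
  assert (Ht0 : 0 < t) by (apply Rdiv_lt_0_compat; lra).
  assert (Htt : t < PI / 4).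
  { unfold t. apply Rlt_div_l; [lra|]. assert (Q : (Delta - 1) / PI < - eta) by lra. apply Rlt_div_l in Q; lra. }
  rewrite (eta_as_theta Delta eta) in He by lra.
  replace ((Delta - 1) / (4 * eta)) with (- t) in He by (unfold t; field; lra).
  apply eta_eq_theta in He; [|lra|lra]. rewrite cos_neg, sin_neg in He.
  destruct (cos_sin_pos t ltac:(lra)) as [S1 S2].
  set (q := 2 * - t * (2 - Delta) / (Delta - 1)) in *.
  assert (Hq : q <= 0).
  { unfold q. replace (2 * - t * (2 - Delta) / (Delta - 1)) with (- (2 * t * (2 - Delta) / (Delta - 1))) by (field; lra).
    assert (0 <= 2 * t * (2 - Delta) / (Delta - 1)) by (apply Rdiv_le_0_compat; [apply Rmult_le_pos; lra|lra]). lra. }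
  assert (He' : (3 - q) * (cos t + sin t) = 2 * (cos t - sin t)).
  { apply Rmult_eq_reg_r with (cos t - sin t); [|lra]. lra. }
  assert (3 * (cos t + sin t) <= (3 - q) * (cos t + sin t)) by (apply Rmult_le_compat_r; lra). lra.
Qed.

Lemma eta_eq_min Delta : 1 < Delta -> eta_eq Delta (- ((Delta - 1) / PI)).
Proof.
  intros HD. generalize PI_RGT_0; intros HP.
  replace (- ((Delta - 1) / PI)) with ((Delta - 1) / (4 * - (PI / 4))) by (field; lra).
  apply eta_eq_theta; [lra|lra|]. rewrite cos_neg, sin_neg, cos_PI4, sin_PI4. ring.
Qed.

Theorem theorem18 :
  (forall Delta : R, 0 < Delta <= 1 ->
     is_glb_Rbar (ratios Delta) (Finite 1) /\
     is_lub_Rbar (ratios Delta) (Finite (sqrt (1 + Delta / 2)))) /\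
  (forall Delta : R, 1 < Delta <= 2 ->
     exists eta_p eta_m : R,
       (eta_eq Delta eta_p /\ (forall eta, eta_eq Delta eta -> eta <= eta_p)) /\
       (eta_eq Delta eta_m /\ (forall eta, eta_eq Delta eta -> eta_m <= eta)) /\
       is_glb_Rbar (ratios Delta) (Finite (sqrt (1 + eta_m))) /\
       is_lub_Rbar (ratios Delta) (Finite (sqrt (1 + eta_p)))).
Proof.
  split; [exact theorem18_small|]. intros Delta HD. generalize PI_RGT_0; intros HP.
  destruct (theta_exists Delta HD) as [theta [Ht Heq]].
  destruct (cos_sin_pos theta Ht) as [S1 S2].
  (* The first value comes from the factor belonging to even functions; the second is the angle
     [- PI / 4], the zero of [cos + sin]. *)
  exists ((Delta - 1) / (4 * theta)), (- ((Delta - 1) / PI)).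
  split; [split|split; [split|]].
  - apply eta_eq_theta; [lra|lra|].
    set (q := 2 * theta * (2 - Delta) / (Delta - 1)) in *.
    transitivity (((1 - q) * (cos theta - sin theta) + 2 * (cos theta - sin theta)) * (cos theta + sin theta)); [ring|].
    rewrite Heq. ring.
  - intros eta He. apply eta_max; auto.
  - apply eta_eq_min; lra.
  - intros eta He. apply eta_min; auto.
  - set (a := Delta / 2). assert (Ha : 1/2 < a <= 1) by (unfold a; lra).
    replace (Delta - 1) with (2 * a - 1) by (unfold a; field).
    assert (Heq' : (1 - 4 * theta * (1 - a) / (2 * a - 1)) * (cos theta - sin theta) = 4 * sin theta).
    { rewrite <- Heq. do 2 f_equal. unfold a. field. lra. }
    apply lub_glb_of_bounds.
    + apply ratios_bounds; [lra| |]; intros f Hf; fold a.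
      * assert (Q := qform_lower a f Hf Ha). lra.
      * assert (Q := qform_upper a f theta Hf Ha Ht Heq'). lra.
    + destruct (ext_odd_form a Ha) as [N1 N2].
      apply (ratios_attained Delta (ext_odd (PI / 4 / (a - 1/2)) a)); fold a; auto; [lra|apply cont_ext_odd|].
      apply (ext_parseval (PI / 4 / (a - 1/2)) a (-1) 0); auto.
      * apply cont_ext_odd.
      * intros s Hs. apply ext_odd_hi; auto.
        replace (PI / 4 / (a - 1/2) * (1/2 - a)) with (- (PI / 4)) by (field; lra).
        unfold cas. rewrite cos_neg, sin_neg, cos_PI4, sin_PI4. ring.
      * intros s. rewrite ext_odd_neg. ring.
      * intros s Hs. apply ext_odd_mid; auto.
    + destruct (ext_even_form a theta Ha Ht Heq') as [N1 N2].
      apply (ratios_attained Delta (ext_even (theta / (a - 1/2)) a)); fold a; auto; [lra|apply cont_ext_even|].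
      apply (ext_parseval (theta / (a - 1/2)) a 1 (cas (theta / (a - 1/2) * (1/2 - a)))); auto.
      * apply cont_ext_even.
      * intros s Hs. apply ext_even_hi; auto.
      * intros s. rewrite ext_even_neg. ring.
      * intros s Hs. apply ext_even_mid; auto.
Qed.
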